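(* For all $\eta\ge0$, the scattering matrix $\mathbb{S}^\eta$ is symmetric. Moreover there holds $$\mathbb{S}^\eta\,\overline{\mathbb{S}^\eta}^{\top}+2\lambda\eta\,\mathbb{B}^\eta=\mathbb{I},$$ where $\mathbb{I}$ is the identity matrix of $\mathbb{C}^{J\times J}$ and $\mathbb{B}^\eta=(\mathbb{B}^\eta_{jk})_{0\le j,k\le J-1}$ is the positive definite Hermitian matrix with entries $$\mathbb{B}^\eta_{jk}=\int_{\mathcal{O}}b\,u_j^\eta\,\overline{u_k^\eta}\,dx.$$
   Context: Geometry. Let $d\ge 2$, $x=(y,z)$ with $y=(x_1,\dots,x_{d-1})$, $z=x_d$. $\Omega=\mathscr{R}\cup\Pi\subset\mathbb{R}^d$, where $\mathscr{R}\subset\{z<0\}$ is bounded and $\Pi=\omega\times[0,+\infty)$ with bounded cross section $\omega\subset\mathbb{R}^{d-1}$; $\Omega$ is a connected open set with Lipschitz boundary. $\mathcal{O}$ is a non-empty open set with smooth boundary and $\overline{\mathcal{O}}\subset\mathscr{R}$. $b\in\mathscr{C}^\infty(\overline{\mathcal{O}})$ is a positive function on $\overline{\mathcal{O}}$, extended by $0$ to $\Omega\setminus\overline{\mathcal{O}}$. Modes. Let $0=\lambda_0<\lambda_1\le\lambda_2\le\cdots\to+\infty$ be the eigenvalues of the Neumann Laplacian $-\Delta_y$ in $\omega$, with eigenfunctions $\varphi_j$ orthonormal in $L^2(\omega)$. Fix $J\in\{1,2,\dots\}$ and $\lambda\in(\lambda_{J-1},\lambda_J)$. For $j=0,\dots,J-1$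 set $\alpha_j=\sqrt{\lambda-\lambda_j}$ and $w_j^\pm(x)=(2\alpha_j)^{-1/2}e^{\pm i\alpha_j z}\varphi_j(y)$ (the $\varphi_j$ may be taken real valued). Let $\chi$ be a smooth cut-off function depending only on $z$, with $\chi=1$ for $z\ge1$ and $\chi=0$ for $z\le0$. Spaces. $\mathscr{C}_0^\infty(\overline\Omega)$ is the set of restrictions to $\Omega$ of functions in $\mathscr{C}^\infty_0(\mathbb{R}^d)$. Fix $\beta\in(0,\sqrt{\lambda_J-\lambda})$. $W^1_\beta(\Omega)$ is the completion of $\mathscr{C}_0^\infty(\overline\Omega)$ for the norm $\|e^{\beta z}u;H^1(\Omega)\|$. Scattering solutions. For $\eta\ge0$ and $j=0,\dots,J-1$, $u_j^\eta$ denotes the solution of $\Delta u_j^\eta+\lambda(1+i\eta b)u_j^\eta=0$ in $\Omega$, $\partial_nu_j^\eta=0$ on $\partial\Omega$ (in the weak sense), of the form $u_j^\eta=\chi w_j^-+\chi\sum_{k=0}^{J-1}s_{jk}^\eta w_k^++\tilde u_j^\eta$ with $s^\eta_{jk}\in\mathbb{C}$, $\tilde u_j^\eta\in W^1_\beta(\Omega)$; $\mathbb{S}^\eta=(s_{jk}^\eta)_{0\le j,k\le J-1}$ is the scattering matrix. Such solutions exist for all $\eta\ge0$ and $\mathbb{S}^\eta$ is uniquely defined; for $\eta>0$, $u_j^\eta$ is unique. For $\eta=0$, let $v_1^{\mathrm{tr}},\dots,v_T^{\mathrm{tr}}\in W^1_\beta(\Omega)$ be a basis (possibly empty) of the trapped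 modes, i.e. of the solutions in $W^1_\beta(\Omega)$ of the homogeneous problem with $\eta=0$; then $u_j^0$ is made unique by imposing $\int_{\mathcal{O}}b\,u_j^0\,\overline{v_\tau^{\mathrm{tr}}}\,dx=0$ for $\tau=1,\dots,T$. *)

(* Defs.v *)
From HB Require Import structures.
From mathcomp Require Import all_boot all_order all_algebra spectral sesquilinear.
From mathcomp Require Import complex.
From mathcomp Require Import all_classical all_reals all_analysis.

Set Implicit Arguments.
Unset Strict Implicit.
Unset Printing Implicit Defensive.

Import Order.TTheory GRing.Theory Num.Theory.
Import numFieldNormedType.Exports.

Local Open Scope classical_set_scope.
Local Open Scope ring_scope.
Local Open Scope complex_scope.

Fact row_display : measure_display.
Proof. exact: default_measure_display. Qed.

(* The sigma-algebra generated by the coordinates is the Borel one of R^n. *)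
Section row_measurable.
Context {R : realType} {n : nat}.

Definition row_coord (i : 'I_n) (v : 'rV[R]_n) : measurableTypeR R := v 0 i.

Let row_set0 : g_sigma_preimage row_coord set0.
Proof. exact: sigma_algebra0. Qed.

Let row_setC A : g_sigma_preimage row_coord A ->
  g_sigma_preimage row_coord (~` A).
Proof. exact: sigma_algebraC. Qed.

Let row_bigcup (F : (set 'rV[R]_n)^nat) :
  (forall i, g_sigma_preimage row_coord (F i)) ->
  g_sigma_preimage row_coord (\bigcup_i (F i)).
Proof. exact: sigma_algebra_bigcup. Qed.

HB.instance Definition _ := @isMeasurable.Build row_display 'rV[R]_n
  (g_sigma_preimage row_coord) row_set0 row_setC row_bigcup.

End row_measurable.

(* A point of R^(n+1) is x = (y, z), the axial coordinate z being the last. *)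
Section coordinates.
Context {R : realType}.
Implicit Types n : nat.

Definition ycoord n (x : 'rV[R]_n.+1) : 'rV[R]_n := col' ord_max x.

Definition zcoord n (x : 'rV[R]_n.+1) : R := x 0 ord_max.

Definition snoc n (p : 'rV[R]_n * measurableTypeR R) : 'rV[R]_n.+1 :=
  \row_i oapp (p.1 0) p.2 (unlift ord_max i).

Lemma ycoord_snoc n p : ycoord (@snoc n p) = p.1.
Proof. by apply/rowP => i; rewrite !mxE liftK. Qed.

Lemma zcoord_snoc n p : zcoord (@snoc n p) = p.2.
Proof. by rewrite /zcoord mxE unlift_none. Qed.

Lemma measurable_row_coord n (i : 'I_n) :
  measurable_fun [set: 'rV[R]_n] (@row_coord R n i).
Proof.
move=> _ Y mY; rewrite setTI; apply: sub_sigma_algebra => /=.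
rewrite -bigcup_seq/=; exists i => /=; first by rewrite mem_index_enum.
by exists Y => //; rewrite setTI.
Qed.

Lemma measurable_snoc n : measurable_fun setT (@snoc n).
Proof.
have mc i : measurable_fun setT (@row_coord R n.+1 i \o @snoc n).
  case: (unliftP ord_max i) => [j|] ->.
    rewrite (_ : _ \o _ = @row_coord R n j \o fst); last first.
      by apply/funext => p /=; rewrite /row_coord mxE liftK.
    by apply: measurableT_comp => //; exact: measurable_row_coord.
  rewrite (_ : _ \o _ = snd); first exact: measurable_snd.
  by apply/funext => p /=; rewrite /row_coord mxE unlift_none.
move=> _ A mA; rewrite setTI.
suff : g_sigma_preimage (@row_coord R n.+1) `<=`
    [set B | measurable (@snoc n @^-1` B)] by exact.
apply: smallest_sub.
  split => /= [|B mB|F mF].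
  - by rewrite preimage_set0; exact: measurable0.
  - by rewrite setTD preimage_setC; exact: measurableC.
  - by rewrite preimage_bigcup; exact: bigcup_measurable.
rewrite -bigcup_mkord_ord => B [i Hi [C mC <-]] /=.
by rewrite setTI -comp_preimage -[X in measurable X]setTI; exact: mc.
Qed.

End coordinates.

Section leb.
Context {R : realType}.

Definition leb_succ n (m : {measure set 'rV[R]_n -> \bar R}) :
    set 'rV[R]_n.+1 -> \bar R :=
  pushforward (m \x @lebesgue_measure R)%E (@snoc R n).

Section leb_succ_measure.
Context n (m : {measure set 'rV[R]_n -> \bar R}).

Let leb_succ0 : leb_succ m set0 = 0%E.
Proof. by rewrite /leb_succ /pushforward preimage_set0 measure0. Qed.

Let leb_succ_ge0 A : (0 <= leb_succ m A)%E.
Proof. by rewrite /leb_succ /pushforward measure_ge0. Qed.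

Let leb_succ_sigma_additive : semi_sigma_additive (leb_succ m).
Proof.
move=> F mF tF mUF; rewrite /leb_succ /pushforward preimage_bigcup.
have mp A : measurable A -> measurable (@snoc R n @^-1` A).
  by move=> mA; rewrite -[X in measurable X]setTI; exact: measurable_snoc.
apply: measure_semi_sigma_additive.
- by move=> k; exact: mp.
- apply/trivIsetP => /= i j _ _ ij; rewrite -preimage_setI.
  by move/trivIsetP : tF => /(_ _ _ _ _ ij) ->//; rewrite preimage_set0.
- by rewrite -preimage_bigcup; exact: mp.
Qed.

HB.instance Definition _ := isMeasure.Build _ _ _ (leb_succ m)
  leb_succ0 leb_succ_ge0 leb_succ_sigma_additive.

End leb_succ_measure.

(* Lebesgue measure of R^n, as an iterated product. *)
Fixpoint leb n : {measure set 'rV[R]_n -> \bar R} :=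
  match n with
  | 0 => @dirac _ _ (0 : 'rV[R]_0) R
  | n'.+1 => leb_succ (leb n')
  end.

Lemma measurable_box n (A : 'I_n -> set (measurableTypeR R)) :
  (forall i, measurable (A i)) ->
  measurable [set v : 'rV[R]_n | forall i, A i (v 0 i)].
Proof.
move=> mA; rewrite (_ : [set _ | _] =
  \bigcap_(i in [set: 'I_n]) (@row_coord R n i @^-1` A i)); last first.
  by apply/seteqP; split=> v /= h i *; exact: h.
apply: fin_bigcap_measurable => [|i _]; first exact: finite_finset.
by rewrite -[X in measurable X]setTI; exact: measurable_row_coord.
Qed.

Lemma leb_box n (A : 'I_n -> set (measurableTypeR R)) :
  (forall i, measurable (A i)) ->
  leb n [set v : 'rV[R]_n | forall i, A i (v 0 i)] =
  (\prod_(i < n) lebesgue_measure (A i))%E.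
Proof.
elim: n A => [|n IH] A mA /=.
  rewrite big_ord0 diracE mem_set//=; by case.
rewrite /leb_succ /pushforward (_ : _ @^-1` _ =
  [set y : 'rV[R]_n | forall i, A (lift ord_max i) (y 0 i)] `*` A ord_max); last first.
  apply/seteqP; split => -[y z] /=.
    by move=> h; split => [i|]; [move: (h (lift ord_max i)); rewrite mxE liftK |
      move: (h ord_max); rewrite mxE unlift_none].
  case=> h1 h2 i; rewrite mxE; case: unliftP => [j ->|->] //=; exact: h1.
rewrite product_measure1E//; last first.
  by apply: (@measurable_box _ (fun i => A (lift ord_max i))) => i; exact: mA.
rewrite (IH (fun i => A (lift ord_max i)))// big_ord_recr/=; congr (_ * _)%E.
apply: eq_bigr => i _; congr (lebesgue_measure (A _)).
by apply/val_inj => /=; rewrite /bump leqNgt ltn_ord add0n.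
Qed.

End leb.

Section smoothness.
Context {R : realType}.

Definition pderiv n (i : 'I_n) (f : 'rV[R]_n -> R) : 'rV[R]_n -> R :=
  'D_(delta_mx 0 i) f.

Fixpoint Ck k n (f : 'rV[R]_n -> R) : Prop :=
  continuous f /\
  if k is k'.+1 then
    forall i, (forall x, derivable f x (delta_mx 0 i)) /\ Ck k' (pderiv i f)
  else True.

Definition smooth n (f : 'rV[R]_n -> R) : Prop := forall k, Ck k f.

Definition smooth1 (f : R -> R) : Prop := forall k z, derivable (derive1n k f) z 1.

Definition lipschitz_fun n (f : 'rV[R]_n -> R) : Prop :=
  exists k : R, k.-lipschitz f.

Definition test_function n (D : set 'rV[R]_n) (psi : 'rV[R]_n -> R) : Prop :=
  smooth psi /\
  exists K, [/\ compact K, K `<=` D & forall x, ~ K x -> psi x = 0].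

(* Up to a rigid motion, the open set D is locally the subgraph of a function
   of the class P. *)
Definition regular_boundary n (P : ('rV[R]_n -> R) -> Prop)
    (D : set 'rV[R]_n.+1) : Prop :=
  forall p, (closure D `\` D) p ->
  exists (Q : 'M[R]_n.+1) (gamma : 'rV[R]_n -> R) (r : R),
    [/\ Q *m Q^T = 1%:M, P gamma, 0 < r &
        forall x, ball p r x ->
          (D x <-> zcoord ((x - p) *m Q) < gamma (ycoord ((x - p) *m Q)))].

End smoothness.

(* Functions are complex valued; only their values on the domain D matter. *)
Section sobolev.
Context {R : realType}.
Local Notation C := R[i].

Definition cint n (D : set 'rV[R]_n) (f : 'rV[R]_n -> C) : C :=
  (\int[leb n]_(x in D) complex.Re (f x)) +i*
  (\int[leb n]_(x in D) complex.Im (f x)).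

Definition L2norm2 n (D : set 'rV[R]_n) (f : 'rV[R]_n -> C) : \bar R :=
  (\int[leb n]_(x in D) (complex.Re (f x) ^+ 2 + complex.Im (f x) ^+ 2)%:E)%E.

Definition L2 n (D : set 'rV[R]_n) (f : 'rV[R]_n -> C) : Prop :=
  [/\ measurable_fun D (fun x => complex.Re (f x)),
      measurable_fun D (fun x => complex.Im (f x)) &
      (L2norm2 D f < +oo)%E].

(* L2 up to the boundary: on all bounded parts of D. *)
Definition L2loc n (D : set 'rV[R]_n) (f : 'rV[R]_n -> C) : Prop :=
  forall r : R, L2 (D `&` ball 0 r) f.

Definition weak_grad n (D : set 'rV[R]_n) (u : 'rV[R]_n -> C)
    (g : 'I_n -> 'rV[R]_n -> C) : Prop :=
  forall i psi, test_function D psi ->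
    cint D (fun x => u x * (pderiv i psi x)%:C) =
    - cint D (fun x => g i x * (psi x)%:C).

(* u is in H^1(D), with weak gradient g. *)
Definition H1 n (D : set 'rV[R]_n) (u : 'rV[R]_n -> C)
    (g : 'I_n -> 'rV[R]_n -> C) : Prop :=
  [/\ L2 D u, forall i, L2 D (g i) & weak_grad D u g].

Definition H1loc n (D : set 'rV[R]_n) (u : 'rV[R]_n -> C)
    (g : 'I_n -> 'rV[R]_n -> C) : Prop :=
  [/\ L2loc D u, forall i, L2loc D (g i) & weak_grad D u g].

Definition H1norm2 n (D : set 'rV[R]_n) (u : 'rV[R]_n -> C)
    (g : 'I_n -> 'rV[R]_n -> C) : \bar R :=
  (L2norm2 D u + \sum_(i < n) L2norm2 D (g i))%E.

Definition C0inf n (v : 'rV[R]_n -> C) : Prop :=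
  [/\ smooth (fun x => complex.Re (v x)), smooth (fun x => complex.Im (v x)) &
      exists r : R, forall x, r < `|x| -> v x = 0].

Definition weighted n (beta : R) (u : 'rV[R]_n.+1 -> C) : 'rV[R]_n.+1 -> C :=
  fun x => (expR (beta * zcoord x))%:C * u x.

(* The completion of C0inf for ||e^(beta z) u; H^1(D)||, realized as the
   functions u with finite norm that are limits of elements of C0inf. *)
Definition W1 n (beta : R) (D : set 'rV[R]_n.+1) (u : 'rV[R]_n.+1 -> C) : Prop :=
  (exists g, H1 D (weighted beta u) g) /\
  forall e : R, 0 < e -> exists v g,
    [/\ C0inf v, H1 D (weighted beta (fun x => u x - v x)) g &
        (H1norm2 D (weighted beta (fun x => u x - v x)%R) g < e%:E)%E].

(* Weak form of: Delta u + k u = 0 in D, with zero normal derivative on the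
   boundary of D. *)
Definition neumann_sol n (D : set 'rV[R]_n) (k u : 'rV[R]_n -> C) : Prop :=
  exists2 g, H1loc D u g &
    forall v h, H1 D v h ->
      (exists r : R, forall x, D x -> r < `|x| -> v x = 0) ->
      cint D (fun x => \sum_(i < n) g i x * h i x) =
      cint D (fun x => k x * u x * v x).

End sobolev.

Section waveguide.
Context {R : realType}.
Local Notation C := R[i].

Definition half_cylinder n (omega : set 'rV[R]_n) : set 'rV[R]_n.+1 :=
  [set x | omega (ycoord x) /\ 0 <= zcoord x].

Record waveguide n (Res : set 'rV[R]_n.+1) (omega : set 'rV[R]_n)
    (Omega : set 'rV[R]_n.+1) : Prop := Waveguide {
  wg_decomp : Omega = Res `|` half_cylinder omega ;
  wg_neg : Res `<=` [set x | zcoord x < 0] ;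
  wg_res_bounded : bounded_set Res ;
  wg_omega_bounded : bounded_set omega ;
  wg_open : open Omega ;
  wg_connected : connected Omega ;
  wg_lipschitz : regular_boundary (@lipschitz_fun R n) Omega }.

Record dissipative_part n (Res O : set 'rV[R]_n.+1) : Prop := DissipativePart {
  dp_nonempty : O !=set0 ;
  dp_open : open O ;
  dp_smooth : regular_boundary (@smooth R n) O ;
  dp_sub : closure O `<=` Res }.

Record absorption n (Omega O : set 'rV[R]_n.+1) (b : 'rV[R]_n.+1 -> R) : Prop :=
  Absorption {
  abs_smooth : exists2 f, smooth f & forall x, closure O x -> b x = f x ;
  abs_pos : forall x, closure O x -> 0 < b x ;
  abs_out : forall x, (Omega `\` closure O) x -> b x = 0 }.

(* The spectral decomposition of the Neumann Laplacian of omega: the last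
   field says that the orthonormal family phi is complete, i.e. that lam lists
   all the eigenvalues with their multiplicities. *)
Record neumann_spectrum n (omega : set 'rV[R]_n) (lam : nat -> R)
    (phi : nat -> 'rV[R]_n -> R) : Prop := NeumannSpectrum {
  ns_mono : {homo lam : i j / (i <= j)%N >-> i <= j} ;
  ns_0 : lam 0%N = 0 ;
  ns_1 : 0 < lam 1%N ;
  ns_infty : lam n @[n --> \oo] --> +oo ;
  ns_eigen : forall j,
    neumann_sol omega (fun=> (lam j)%:C) (fun y => (phi j y)%:C) ;
  ns_orthonormal : forall i j,
    \int[leb n]_(y in omega) (phi i y * phi j y) = (i == j)%:R ;
  ns_complete : forall f, L2 omega f ->
    (forall j, cint omega (fun y => f y * (phi j y)%:C) = 0) ->
    L2norm2 omega f = 0%E }.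

Record cutoff (chi : R -> R) : Prop := Cutoff {
  cutoff_smooth : smooth1 chi ;
  cutoff_one : forall z, 1 <= z -> chi z = 1 ;
  cutoff_zero : forall z, z <= 0 -> chi z = 0 }.

Definition expi (t : R) : C := cos t +i* sin t.

(* The mode w_j^+ for s = 1, w_j^- for s = -1. *)
Definition mode n (lambda : R) (lam : nat -> R) (phi : nat -> 'rV[R]_n -> R)
    (s : R) (j : nat) (x : 'rV[R]_n.+1) : C :=
  let alpha := Num.sqrt (lambda - lam j) in
  (Num.sqrt (2 * alpha))^-1%:C * expi (s * alpha * zcoord x) *
  (phi j (ycoord x))%:C.

Definition scattering_solution n (Omega : set 'rV[R]_n.+1) (lam : nat -> R)
    (phi : nat -> 'rV[R]_n -> R) (lambda beta : R) (chi : R -> R)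
    (b : 'rV[R]_n.+1 -> R) (eta : R) J (S : 'M[C]_J) (j : 'I_J)
    (u : 'rV[R]_n.+1 -> C) : Prop :=
  neumann_sol Omega (fun x => lambda%:C * (1 +i* (eta * b x))) u /\
  exists2 ut, W1 beta Omega ut &
    forall x, Omega x ->
      u x = (chi (zcoord x))%:C * mode lambda lam phi (-1) j x
          + (chi (zcoord x))%:C *
              (\sum_(k < J) S j k * mode lambda lam phi 1 k x)
          + ut x.

Definition trapped_mode n (Omega : set 'rV[R]_n.+1) (lambda beta : R)
    (v : 'rV[R]_n.+1 -> C) : Prop :=
  neumann_sol Omega (fun=> lambda%:C) v /\ W1 beta Omega v.

Definition trapped_basis n (Omega : set 'rV[R]_n.+1) (lambda beta : R) T
    (v : 'I_T -> 'rV[R]_n.+1 -> C) : Prop :=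
  [/\ forall t, trapped_mode Omega lambda beta (v t),
      forall c : 'I_T -> C,
        {ae leb n.+1, forall x, Omega x -> \sum_(t < T) c t * v t x = 0} ->
        forall t, c t = 0 &
      forall w, trapped_mode Omega lambda beta w ->
        exists c : 'I_T -> C,
        {ae leb n.+1, forall x, Omega x -> w x = \sum_(t < T) c t * v t x}].

Definition absorption_matrix n (O : set 'rV[R]_n.+1) (b : 'rV[R]_n.+1 -> R) J
    (u : 'I_J -> 'rV[R]_n.+1 -> C) : 'M[C]_J :=
  \matrix_(j, k) cint O (fun x => (b x)%:C * u j x * (u k x)^*).

End waveguide.

Local Open Scope sesquilinear_scope.

Definition hermitian_posdef {R : realType} J (B : 'M[R[i]]_J) : Prop :=
  B \is hermsymmx /\
  forall c : 'rV[R[i]]_J, c != 0 -> 0 < (c *m B *m c ^t* ) 0 0.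

(* Main.v *)
(* Green's formula in Omega for two solutions u, v with coefficients k1, k2 and
   the cut-off 1 - chi (z - L) turns the integral of (k1 - k2) u v over O into a
   flux of (d_z u) v - (d_z v) u through the slab L <= z <= L + 1. There
   u = sum_m (p_m w_m^- + q_m w_m^+) + r with e^(beta z) r in L^2, and likewise
   for d_z u by the du Bois-Reymond lemma. As the phi_m are orthonormal, the flux
   of the modal parts is - i sum_m (q_m p'_m - p_m q'_m) for every L, and the
   rest tends to 0 as L -> +oo. The pair (u_j, u_k) yields the symmetry, the
   pair (u_j, conj u_k) the energy identity.

   The quadratic form of the absorption matrix at c is the integral over O of
   b |U|^2 with U = sum_j c_j u_j. If it is 0 then U vanishes on O, hence solves
   Delta U + lambda U = 0 in Omega, hence vanishes in Omega by unique
   continuation, and its flux against w_m^+ gives c_m = 0.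

   Unique continuation comes from analyticity: Bernstein's maximum principle
   bounds the k-th derivatives of a solution by M (C k)^k, so that Taylor
   expansions along the axes propagate its zeros; a weak solution is first
   convolved with test functions. *)

Require Import Defs.
From HB Require Import structures.
From mathcomp Require Import all_boot all_order all_algebra spectral sesquilinear.
From mathcomp Require Import complex.
From mathcomp Require Import all_classical all_reals all_analysis measurable_realfun.
From mathcomp Require Import ring lra.

Set Implicit Arguments.
Unset Strict Implicit.
Unset Printing Implicit Defensive.

Import Order.TTheory GRing.Theory Num.Theory.
Import numFieldNormedType.Exports.

Local Open Scope classical_set_scope.
Local Open Scope ring_scope.
Local Open Scope complex_scope.
Local Open Scope sesquilinear_scope.

(** * Measure theory on R^n *)

Section row_topology.
Context {R : realType}.
Implicit Types n : nat.

(** The solutions are weak and come without traces on the sections z = L. The cut-off replaces such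
    a section by a slab; its derivative has integral -1, so the modal flux is the same for every L.
    The volume term of Green's formula does not depend on L either, hence the limit L -> +oo yields
    an exact identity. Modes do not decay: a remainder of weight e^(beta z) is paired with a factor
    that is square integrable for the weight e^(- beta z), so the mixed terms are integrable over
    the whole half-cylinder and dominated convergence removes them.

    The absorption is known to vanish only outside the closure of O, while the absorption matrix
    integrates over O itself. Hence the study of the boundary of O, which is null because it is
    locally a graph.

    For eta = 0 the energy identity contains no information on the absorption matrix, so its
    positivity has to come from unique continuation. There, zeros must spread over a distance
    independent of the neighbourhood in which they are known; otherwise connectedness could not be
    used. *)

Lemma ball_rowE n (x y : 'rV[R]_n) e :
  ball x e y <-> 0 < e /\ forall i, `|x 0 i - y 0 i| < e.
Proof.
split=> [[e0 h]|[e0 h]]; split=> // i; first exact: h.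
by move=> j; rewrite ord1; exact: h.
Qed.

Lemma measurable_ball_row n (x : 'rV[R]_n) e : measurable (ball x e).
Proof.
have [e0|e0] := ltP 0 e; last first.
  rewrite (_ : ball x e = set0) ?measurable0//.
  by apply/seteqP; split=> // y /ball_rowE[]; rewrite ltNge e0.
rewrite (_ : ball x e = [set v : 'rV[R]_n | forall i, ball (x 0 i) e (v 0 i)]).
  by apply: (@measurable_box _ _ (fun i => ball (x 0 i) e)) => i; exact: measurable_ball.
apply/seteqP; split => y /=; first by move/ball_rowE => [].
by move=> h; apply/ball_rowE; split.
Qed.

Lemma measurable_setI_ball n (D : set 'rV[R]_n) x e : measurable D -> measurable (D `&` ball x e).
Proof. by move=> mD; apply: measurableI => //; exact: measurable_ball_row. Qed.

Lemma rat_ball n (x : 'rV[R]_n) (e : R) : 0 < e ->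
  exists (q : 'rV[rat]_n) (r : rat), ball (map_mx ratr q : 'rV[R]_n) (ratr r) x /\
    ball (map_mx ratr q : 'rV[R]_n) (ratr r) `<=` ball x e.
Proof.
move=> e0.
have [r /andP[r0 re]] : exists r : rat, 0 < (ratr r : R) < e / 2.
  have := @rat_in_itvoo R 0 (e/2); rewrite divr_gt0// => /(_ isT) [r].
  by rewrite in_itv/= => h; exists r.
have H (i : 'I_n) : exists q : rat, x 0 i - ratr r < ratr q < x 0 i + ratr r.
  have /rat_in_itvoo[q] : x 0 i - ratr r < x 0 i + ratr r by lra.
  by rewrite in_itv/= => h; exists q.
have [q qP] := choice H.
exists (\row_i q i), r; split.
  apply/ball_rowE; split=> // i; rewrite !mxE ltr_norml; have := qP i; lra.
move=> y /ball_rowE[_ h]; apply/ball_rowE; split=> // i.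
have := h i; have := qP i; rewrite !mxE !ltr_norml; lra.
Qed.

(** The candidates are the countably many balls with rational centre and radius, enumerated by
    [unpickle]; those contained in no [ball x (r x)] receive the radius 0 and are empty. *)
Lemma countable_cover_balls n (D : set 'rV[R]_n) (r : 'rV[R]_n -> R) :
  (forall x, D x -> 0 < r x) ->
  exists c : nat -> 'rV[R]_n, exists e : nat -> R,
    (D `<=` \bigcup_k ball (c k) (e k)) /\
    forall k, (exists2 x, D x & ball (c k) (e k) `<=` ball x (r x)) \/ e k = 0.
Proof.
move=> r0.
pose G (k : nat) : 'rV[rat]_n * rat := odflt (0, 0) (unpickle k).
pose good (g : 'rV[rat]_n * rat) := `[< exists2 x, D x &
   ball (map_mx ratr g.1 : 'rV[R]_n) (ratr g.2) `<=` ball x (r x) >].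
exists (fun k => map_mx ratr (G k).1).
exists (fun k => if good (G k) then ratr (G k).2 else 0); split.
  move=> x Dx; have [q [s [h1 h2]]] := @rat_ball n x (r x) (r0 _ Dx).
  exists (pickle (q, s)) => //=; rewrite /G pickleK/=.
  by have -> : good (q, s) by apply/asboolP; exists x.
move=> k; case: ifPn => [/asboolP ?|_]; by [left|right].
Qed.

Lemma open_ballP n (D : set 'rV[R]_n) x : open D -> D x ->
  exists2 e, 0 < e & ball x e `<=` D.
Proof. by move=> oD Dx; have /nbhs_ballP[e /= e0 h] := open_nbhs_nbhs (conj oD Dx); exists e. Qed.

(** Balls of the sup norm are boxes, hence measurable for the sigma-algebra generated by the
    coordinates, and an open set is a countable union of them. *)
Lemma open_measurable_row n (D : set 'rV[R]_n) : open D -> measurable D.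
Proof.
move=> oD.
have H x : exists e, D x -> 0 < e /\ ball x e `<=` D.
  have [Dx|] := pselect (D x); last by exists 0.
  by have [e e0 h] := open_ballP oD Dx; exists e.
have [r rP] := choice H.
have [|c [e [cov sub]]] := @countable_cover_balls n D r.
  by move=> x /rP[].
rewrite (_ : D = \bigcup_k ball (c k) (e k)).
  by apply: bigcup_measurable => k _; exact: measurable_ball_row.
apply/seteqP; split=> // x [k _ /= xk].
have [[y Dy yk]|ek] := sub k.
  by apply: (rP y Dy).2; exact: yk.
by move/ball_rowE: xk; rewrite ek ltxx => -[].
Qed.

Lemma closed_measurable_row n (D : set 'rV[R]_n) : closed D -> measurable D.
Proof.
move=> cD; rewrite -(setCK D); apply: measurableC.
by apply: open_measurable_row; exact: closed_openC.
Qed.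

(* R^n is Lindelof. *)
Lemma ae_local n (mu : {measure set 'rV[R]_n -> \bar R}) (D : set 'rV[R]_n) (P : 'rV[R]_n -> Prop) :
  (forall x, D x -> exists2 e, 0 < e & {ae mu, forall y, ball x e y -> P y}) ->
  {ae mu, forall y, D y -> P y}.
Proof.
move=> h.
have H x : exists e, D x -> 0 < e /\ {ae mu, forall y, ball x e y -> P y}.
  have [Dx|] := pselect (D x); last by exists 0.
  by have [e e0 he] := h _ Dx; exists e.
have [r rP] := choice H.
have [|c [e [cov sub]]] := @countable_cover_balls n D r.
  by move=> x /rP[].
have : {ae mu, forall y k, ball (c k) (e k) y -> P y}.
  apply/ae_foralln => k.
  have [[x Dx xk]|ek] := sub k.
    by have [_] := rP _ Dx; apply: filterS => y hy /xk; exact: hy.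
  apply: aeW => y /ball_rowE; by rewrite ek ltxx => -[].
apply: filterS => y hy Dy; have [k _ ky] := cov _ Dy; exact: hy ky.
Qed.
End row_topology.

(** * Boxes and translation invariance of Lebesgue measure *)

Section lebesgue_row.
Context {R : realType}.
Implicit Types n : nat.

(** The class P of admissible sides is a parameter: all measurable sets for the uniqueness of
    measures, open rays for the Dynkin argument in [ae0_obox]. *)
Definition boxes n (P : set (set (measurableTypeR R))) : set (set 'rV[R]_n) :=
  [set B | exists2 A : 'I_n -> set (measurableTypeR R), (forall i, P (A i)) &
     B = [set v : 'rV[R]_n | forall i, A i (v 0 i)]].

Lemma setI_closed_boxes n P : setI_closed P -> setI_closed (@boxes n P).
Proof.
move=> PI _ _ [A PA ->] [B PB ->]; exists (fun i => A i `&` B i).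
  by move=> i; exact: PI.
by apply/seteqP; split=> v /=; [case=> a b i; split; [exact: a|exact: b]|
  move=> h; split=> i; have [] := h i].
Qed.

(** A coordinate preimage is the box whose other sides are the whole line, which is why [setT] must
    belong to P. *)
Lemma measurable_boxes n (P : set (set (measurableTypeR R))) :
  (@measurable _ (measurableTypeR R)) = <<s P>> -> P setT ->
  (@measurable _ 'rV[R]_n) = <<s @boxes n P>>.
Proof.
move=> mP PT; apply/seteqP; split.
  apply: smallest_sub; first exact: smallest_sigma_algebra.
  rewrite -bigcup_seq => B [i0 _ [C mC <-]] /=; rewrite setTI.
  have : <<s P>> C by rewrite -mP.
  suff : <<s P>> `<=` [set C | <<s @boxes n P>> (row_coord i0 @^-1` C)] by exact.
  apply: smallest_sub.
    split => /= [|B' mB|F mF].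
    - by rewrite preimage_set0; exact: sigma_algebra0.
    - by rewrite setTD preimage_setC; exact: sigma_algebraC.
    - by rewrite preimage_bigcup; exact: sigma_algebra_bigcup.
  move=> A PA; apply: sub_sigma_algebra.
  exists (fun k => if k == i0 then A else setT).
    by move=> k; case: ifP.
  apply/seteqP; split => v /=; rewrite /row_coord.
    by move=> Av k; case: ifPn => // /eqP ->.
  by move/(_ i0); rewrite eqxx.
apply: smallest_sub; first exact: sigma_algebra_measurable.
move=> _ [A PA ->]; apply: measurable_box => i.
rewrite mP; exact: sub_sigma_algebra.
Qed.

(** The pushforward by the translation gives the intervals []x, y]] their length, and this
    characterizes Lebesgue measure. *)
Lemma lebesgue_shift (a : R) (A : set (measurableTypeR R)) : measurable A ->
  lebesgue_measure [set t : measurableTypeR R | A (t + a)] = lebesgue_measure A.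
Proof.
move=> mA; have ms : measurable_fun setT (fun t : measurableTypeR R => (t + a : measurableTypeR R)).
  exact: measurable_funD.
symmetry.
pose mu := pushforward (@lebesgue_measure R) (fun t : measurableTypeR R => (t + a : measurableTypeR R)).
pose nu : {measure set (measurableTypeR R) -> \bar R} :=
  measure_function_pushforward__canonical__measure_function_Measure (@lebesgue_measure R) ms.
rewrite -[RHS]/(nu A).
apply: lebesgue_measure_unique => // X [[x y] _ /= <-].
rewrite /nu /= /pushforward /=.
rewrite (_ : _ @^-1` _ = `]x - a, y - a]%classic); last first.
  by apply/seteqP; split=> t /=; rewrite !in_itv/= ltrBlDr lerBrDr.
rewrite !lebesgue_measure_itv/= !lte_fin !EFinN -!EFinD ltrD2r.
by case: ifP => // _; congr (_%:E); lra.
Qed.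

Lemma measurable_all_boxes n :
  (@measurable _ 'rV[R]_n) = <<s @boxes n measurable>>.
Proof.
apply: measurable_boxes => //; apply/seteqP; split=> [C mC|].
  exact: sub_sigma_algebra.
by apply: smallest_sub; [exact: sigma_algebra_measurable|].
Qed.

Lemma measurable_fun_row {d} {T : measurableType d} n (f : T -> 'rV[R]_n) :
  (forall i, measurable_fun setT (fun t => f t 0 i : measurableTypeR R)) -> measurable_fun setT f.
Proof.
move=> mf _ B mB; rewrite setTI.
suff : <<s @boxes n measurable>> `<=` [set B | measurable (f @^-1` B)].
  by apply; rewrite -measurable_all_boxes.
apply: smallest_sub.
  split => /= [|B' mB'|F mF].
  - by rewrite preimage_set0; exact: measurable0.
  - by rewrite setTD preimage_setC; exact: measurableC.
  - by rewrite preimage_bigcup; exact: bigcup_measurable.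
move=> _ [A mA ->] /=.
rewrite (_ : _ @^-1` _ = \bigcap_(i in [set: 'I_n]) ((fun t => f t 0 i) @^-1` A i)).
  apply: fin_bigcap_measurable => [|i _]; first exact: finite_finset.
  by rewrite -[X in measurable X]setTI; exact: mf.
by apply/seteqP; split=> t /= h i *; exact: h.
Qed.

Lemma measurable_shift n (a : 'rV[R]_n) : measurable_fun setT (fun t : 'rV[R]_n => t + a).
Proof.
apply: measurable_fun_row => i; under eq_fun do rewrite mxE.
by apply: measurable_funD; [exact: measurable_row_coord|exact: measurable_cst].
Qed.

Lemma leb_ball_lt n (x : 'rV[R]_n) e : (leb n (ball x e) < +oo)%E.
Proof.
have [e0|e0] := ltP 0 e; last first.
  rewrite (_ : ball x e = set0) ?measure0//.
  by apply/seteqP; split=> // y /ball_rowE[]; rewrite ltNge e0.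
rewrite (_ : ball x e = [set v : 'rV[R]_n | forall i, ball (x 0 i) e (v 0 i)]); last first.
  apply/seteqP; split => y /=; first by move/ball_rowE => [].
  by move=> h; apply/ball_rowE; split.
rewrite (@leb_box _ _ (fun i => ball (x 0 i) e)) => [|i]; last exact: measurable_ball.
under eq_bigr do rewrite lebesgue_measure_ball ?ltW//.
by rewrite prodEFin ltry.
Qed.

(** On boxes the invariance holds side by side. Two measures that agree on boxes and are finite on
    the balls [g k], which are boxes exhausting the space, coincide. *)
Lemma leb_shift n (a : 'rV[R]_n) (A : set 'rV[R]_n) : measurable A ->
  leb n [set x | A (x + a)] = leb n A.
Proof.
move=> mA; have ms := measurable_shift a.
pose nu : {measure set 'rV[R]_n -> \bar R} :=
  measure_function_pushforward__canonical__measure_function_Measure (@leb R n) ms.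
rewrite -[LHS]/(nu A).
pose g k := [set v : 'rV[R]_n | forall i, ball (0:R) k.+1%:R (v 0 i)].
have gE k : g k = ball (0 : 'rV[R]_n) k.+1%:R.
  apply/seteqP; split=> y /=; last by move/ball_rowE => [_] h i; have := h i; rewrite !mxE.
  by move=> h; apply/ball_rowE; split => // i; rewrite mxE; exact: h.
apply: (@measure_unique _ R _ (@boxes n measurable) g) => //.
- exact: measurable_all_boxes.
- by apply: setI_closed_boxes => B C; exact: measurableI.
- by move=> k; exists (fun=> ball (0:R) k.+1%:R) => // i; exact: measurable_ball.
- apply/seteqP; split=> // y _; exists (Num.truncn `|y|) => //; rewrite gE.
  by rewrite -ball_normE /ball_/= sub0r normrN truncnS_gt.
- move=> _ [C mC ->]; rewrite /nu/= /pushforward.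
  rewrite (_ : _ @^-1` _ = [set v : 'rV[R]_n | forall i, [set t : measurableTypeR R | C i (t + a 0 i)] (v 0 i)]); last first.
    by apply/seteqP; split=> v /= h i; have := h i; rewrite mxE.
  rewrite (@leb_box _ _ (fun i => [set t : measurableTypeR R | C i (t + a 0 i)])).
    by rewrite (leb_box mC); apply: eq_bigr => i _; rewrite lebesgue_shift.
  move=> i; have := (@measurable_funD _ _ _ setT (fun t : measurableTypeR R => t) (cst (a 0 i))).
  by move=> /(_ _ _ measurableT (C i) (mC i)); rewrite setTI; apply => //.
- move=> k; rewrite gE /nu/= /pushforward (_ : _ @^-1` _ = ball (- a) k.+1%:R) ?leb_ball_lt//.
  apply/seteqP; split=> y /= /ball_rowE[_ h]; apply/ball_rowE; split=> // i;
   have := h i; rewrite !mxE.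
    by rewrite sub0r opprD addrC.
  by rewrite sub0r opprD addrC.
Qed.

Lemma ball0E n (r : R) : ball (0 : 'rV[R]_n) r = [set y | `|y| < r].
Proof. by rewrite -ball_normE; apply/seteqP; split=> y /=; rewrite sub0r normrN. Qed.

Lemma coord_le_norm n (y : 'rV[R]_n) i : `|y 0 i| <= `|y|.
Proof.
apply/ler_addgt0Pr => e e0.
have : ball (0 : 'rV[R]_n) (`|y| + e) y by rewrite ball0E/= ltrDl.
by move/ball_rowE => [_ /(_ i)]; rewrite mxE sub0r normrN => /ltW.
Qed.

Lemma bounded_set_le (V : normedModType R) (A : set V) : bounded_set A ->
  exists2 M : R, 0 < M & forall x, A x -> `|x| <= M.
Proof.
move=> [M [_ /(_ (`|M| + 1))]]; have -> : (M < `|M| + 1) by have := ler_norm M; lra.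
by move=> /(_ isT) h; exists (`|M| + 1); [have := normr_ge0 M; lra|exact: h].
Qed.

Lemma leb_bounded_lt n (A : set 'rV[R]_n) : measurable A -> bounded_set A ->
  (leb n A < +oo)%E.
Proof.
move=> mA /bounded_set_le[M _ h]; apply: le_lt_trans (leb_ball_lt (0 : 'rV[R]_n) (M + 1)).
apply: le_measure; rewrite ?inE//; first exact: measurable_ball_row.
by move=> y /h; rewrite ball0E /= => /le_lt_trans; apply; rewrite ltrDl.
Qed.

(* A copy of [leb] that can carry the sigma-finite structure Fubini needs. *)
Definition slebs n : set 'rV[R]_n -> \bar R := leb n.
HB.instance Definition _ n := Measure.copy (@slebs n) (leb n).

Let slebs_sigma n : sigma_finite setT (@slebs n).
Proof.
exists (fun k => ball (0 : 'rV[R]_n) k.+1%:R).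
  apply/seteqP; split=> // y _; exists (Num.truncn `|y|) => //.
  by rewrite ball0E /= truncnS_gt.
by move=> k; split; [exact: measurable_ball_row|exact: leb_ball_lt].
Qed.
HB.instance Definition _ n := @Measure_isSigmaFinite.Build _ _ _ (@slebs n) (@slebs_sigma n).
End lebesgue_row.

(** * Smooth functions and test functions *)

Section smooth_calculus.
Context {R : realType}.
Implicit Types n : nat.

(** Restriction to a line turns directional derivatives into derivatives in one real variable, where
    the mean value theorem and Taylor bounds are available. *)
Lemma derivable_line n (f : 'rV[R]_n -> R) v x t :
  derivable (fun s : R => f (s *: v + x)) t 1 = derivable f (t *: v + x) v.
Proof.
rewrite /derivable; set F := fun h => _; set G := fun h => _.
suff -> : F = G by []; apply/funext => h; rewrite /F /G /=.
by rewrite scalerDl addrA -!scalerA scale1r.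
Qed.

Lemma derive_line n (f : 'rV[R]_n -> R) v x t :
  derive1 (fun s : R => f (s *: v + x)) t = 'D_v f (t *: v + x).
Proof.
rewrite derive1E /derive; set F := fun h => _; set G := fun h => _.
suff -> : F = G by []; apply/funext => h; rewrite /F /G /=.
by rewrite scalerDl addrA -!scalerA scale1r.
Qed.

Lemma CkS k n (f : 'rV[R]_n -> R) : Ck k.+1 f -> Ck k f.
Proof.
elim: k f => [|k IH] f /=; first by case.
by case=> cf h; split=> // i; have [h1 h2] := h i; split=> //; apply: IH.
Qed.

Lemma Ck_cont k n (f : 'rV[R]_n -> R) : Ck k f -> continuous f.
Proof. by case: k => [|k] []. Qed.

Lemma Ck_derivable k n (f : 'rV[R]_n -> R) i x : Ck k.+1 f -> derivable f x (delta_mx 0 i).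
Proof. by case=> _ /(_ i) []. Qed.

Lemma Ck_pderiv k n (f : 'rV[R]_n -> R) i : Ck k.+1 f -> Ck k (pderiv i f).
Proof. by case=> _ /(_ i) []. Qed.

Lemma pderivD n (f g : 'rV[R]_n -> R) i : (forall x, derivable f x (delta_mx 0 i)) ->
  (forall x, derivable g x (delta_mx 0 i)) ->
  pderiv i (fun x => f x + g x) = (fun x => pderiv i f x + pderiv i g x).
Proof. by move=> df dg; apply/funext => x; rewrite /pderiv -deriveD. Qed.

Lemma pderivM n (f g : 'rV[R]_n -> R) i : (forall x, derivable f x (delta_mx 0 i)) ->
  (forall x, derivable g x (delta_mx 0 i)) ->
  pderiv i (fun x => f x * g x) = (fun x => pderiv i f x * g x + f x * pderiv i g x).
Proof.
move=> df dg; apply/funext => x; rewrite /pderiv (deriveM (df x) (dg x)).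
by rewrite addrC /GRing.scale/= mulrC.
Qed.

Lemma pderiv_cst n (c : R) i : pderiv i (fun _ : 'rV[R]_n => c) = fun=> 0.
Proof. by apply/funext => x; rewrite /pderiv derive_cst. Qed.

Lemma Ck_cst k n c : Ck k (fun _ : 'rV[R]_n => c).
Proof.
elim: k c => [|k IH] c; first by split=> //; exact: cst_continuous.
split=> [|i]; first exact: cst_continuous.
by split=> [x|]; [exact: derivable_cst|rewrite pderiv_cst].
Qed.

Lemma CkD k n (f g : 'rV[R]_n -> R) : Ck k f -> Ck k g -> Ck k (fun x => f x + g x).
Proof.
elim: k f g => [|k IH] f g /= [cf hf] [cg hg]; split=> //.
- by move=> x; apply: continuousD; [exact: cf|exact: cg].
- by move=> x; apply: continuousD; [exact: cf|exact: cg].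
move=> i; have [df Cf] := hf i; have [dg Cg] := hg i; split.
  by move=> x; apply: derivableD.
by rewrite (pderivD df dg); exact: IH.
Qed.

Lemma CkM k n (f g : 'rV[R]_n -> R) : Ck k f -> Ck k g -> Ck k (fun x => f x * g x).
Proof.
elim: k f g => [|k IH] f g /= [cf hf] [cg hg].
  by split=> // x; apply: continuousM; [exact: cf|exact: cg].
split=> [x|i]; first by apply: continuousM; [exact: cf|exact: cg].
have [df Cf] := hf i; have [dg Cg] := hg i; split.
  by move=> x; apply: derivableM.
rewrite (pderivM df dg); apply: CkD; apply: IH => //; by apply: CkS; split.
Qed.

Lemma smooth_cst n c : smooth (fun _ : 'rV[R]_n => c).
Proof. by move=> k; exact: Ck_cst. Qed.
Lemma smoothD n (f g : 'rV[R]_n -> R) : smooth f -> smooth g -> smooth (fun x => f x + g x).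
Proof. by move=> sf sg k; exact: CkD. Qed.
Lemma smoothM n (f g : 'rV[R]_n -> R) : smooth f -> smooth g -> smooth (fun x => f x * g x).
Proof. by move=> sf sg k; exact: CkM. Qed.
Lemma smooth_pderiv n (f : 'rV[R]_n -> R) i : smooth f -> smooth (pderiv i f).
Proof. by move=> sf k; apply: Ck_pderiv; exact: sf. Qed.
Lemma smooth_derivable n (f : 'rV[R]_n -> R) i x : smooth f -> derivable f x (delta_mx 0 i).
Proof. by move=> sf; apply: (@Ck_derivable 0); exact: sf. Qed.
Lemma smooth_cont n (f : 'rV[R]_n -> R) : smooth f -> continuous f.
Proof. by move=> sf; apply: (@Ck_cont 0); exact: sf. Qed.

Lemma smooth_prod n (I : Type) (s : seq I) (F : I -> 'rV[R]_n -> R) :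
  (forall i, smooth (F i)) -> smooth (fun x => \prod_(i <- s) F i x).
Proof.
move=> sF; elim: s => [|i s IH].
  rewrite (_ : (fun _ => _) = fun=> 1); first exact: smooth_cst.
  by apply/funext => x; rewrite big_nil.
rewrite (_ : (fun _ => _) = fun x => F i x * \prod_(i <- s) F i x); first exact: smoothM.
by apply/funext => x; rewrite big_cons.
Qed.

Lemma smooth_sum n (I : Type) (s : seq I) (F : I -> 'rV[R]_n -> R) :
  (forall i, smooth (F i)) -> smooth (fun x => \sum_(i <- s) F i x).
Proof.
move=> sF; elim: s => [|i s IH].
  rewrite (_ : (fun _ => _) = fun=> 0); first exact: smooth_cst.
  by apply/funext => x; rewrite big_nil.
rewrite (_ : (fun _ => _) = fun x => F i x + \sum_(i <- s) F i x); first exact: smoothD.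
by apply/funext => x; rewrite big_cons.
Qed.

Lemma derivable_coord n (i j : 'I_n) (a : R -> R) (x : 'rV[R]_n) :
  derivable a (x 0 i) 1 ->
  derivable (fun x : 'rV[R]_n => a (x 0 i)) x (delta_mx 0 j) /\
  pderiv j (fun x : 'rV[R]_n => a (x 0 i)) x = (i == j)%:R * derive1 a (x 0 i).
Proof.
move=> da; rewrite /pderiv derive1E; have [ij|ij] := eqVneq i j; last first.
  have E : (fun h : R => h^-1 *: (((fun x : 'rV[R]_n => a (x 0 i)) \o shift x)
      (h *: delta_mx 0 j) - a (x 0 i))) = cst 0.
    apply/funext => h /=; rewrite !mxE eqxx (negbTE ij).
    by rewrite mulr0 add0r subrr scaler0.
  rewrite /derivable/derive E mul0r; split; first exact: is_cvg_cst.
  by rewrite lim_cst.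
subst i.
have E : (fun h : R => h^-1 *: (((fun x : 'rV[R]_n => a (x 0 j)) \o shift x)
      (h *: delta_mx 0 j) - a (x 0 j))) =
      fun h : R => h^-1 *: ((a \o shift (x 0 j)) (h *: 1) - a (x 0 j)).
  by apply/funext => h /=; rewrite !mxE !eqxx.
by rewrite /derivable/derive E mul1r; split.
Qed.

(** The whole sequence of successive derivatives is given, so that the induction on k can pass to
    the shifted sequence. *)
Lemma smooth_coord n (i : 'I_n) (a : nat -> R -> R) :
  (forall k (z : R), is_derive z (1 : R) (a k) (a k.+1 z)) ->
  smooth (fun x : 'rV[R]_n => a 0%N (x 0 i)).
Proof.
move=> da k; elim: k a da => [|k IH] a da.
  split=> // x; apply: continuous_comp; first exact: coord_continuous.
  by apply: differentiable_continuous; apply/derivable1_diffP; have [] := da 0%N (x 0 i).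
split; first exact: Ck_cont (IH a da).
move=> j; split=> [x|].
  by have [] := @derivable_coord n i j (a 0%N) x; have [] := da 0%N (x 0 i).
rewrite (_ : pderiv _ _ = fun x : 'rV[R]_n => (i == j)%:R * a 1%N (x 0 i)).
  apply: CkM; first exact: Ck_cst.
  by apply: (IH (fun k => a k.+1)) => l z; exact: da.
apply/funext => x.
have [h1 h2] := da 0%N (x 0 i).
by have [_ ->] := derivable_coord j h1; rewrite derive1E h2.
Qed.

Lemma pderiv_coord n (i j : 'I_n) (a a' : R -> R) :
  (forall z : R, is_derive z (1 : R) a (a' z)) ->
  pderiv j (fun x : 'rV[R]_n => a (x 0 i)) = fun x => (i == j)%:R * a' (x 0 i).
Proof.
move=> da; apply/funext => x; have [h1 h2] := da (x 0 i).
by have [_ ->] := derivable_coord j h1; rewrite derive1E h2.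
Qed.

Lemma smooth1_is_derive (a : R -> R) k (z : R) : smooth1 a ->
  is_derive z (1 : R) (derive1n k a) (derive1n k.+1 a z).
Proof. by move=> sa; apply: DeriveDef; [exact: sa|rewrite derive1nS derive1E]. Qed.

Lemma is_derive_affine (a a' : R -> R) (c d z : R) :
  (forall z : R, is_derive z (1 : R) a (a' z)) ->
  is_derive z (1 : R) (fun t => a (c * t + d)) (c * a' (c * z + d)).
Proof.
move=> da.
have h1 : is_derive z (1 : R) (fun t => c * t + d) c.
  apply: is_derive_eq; by rewrite /GRing.scale/= mulr1 addr0.
have := @is_derive1_comp R a (fun t => c * t + d) z.
by move=> /(_ _ _ (da _) h1); rewrite mulrC.
Qed.

Lemma smooth_affine n (i : 'I_n) (a : R -> R) (c d : R) : smooth1 a ->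
  smooth (fun x : 'rV[R]_n => a (c * x 0 i + d)).
Proof.
move=> sa; have := @smooth_coord n i (fun k t => c ^+ k * derive1n k a (c * t + d)).
rewrite (_ : (fun x : 'rV[R]_n => _ * _) = fun x : 'rV[R]_n => a (c * x 0 i + d)); last first.
  by apply/funext => x; rewrite expr0 mul1r.
apply=> k z; rewrite exprSr -mulrA; apply: is_deriveZ.
by apply: is_derive_affine => t; exact: smooth1_is_derive.
Qed.

Lemma continuous_smooth1 (a : R -> R) : smooth1 a -> continuous a.
Proof.
move=> sa z; have h := sa 0%N z; apply: differentiable_continuous.
by apply/derivable1_diffP; exact: h.
Qed.

Lemma smooth1_expR : smooth1 (@expR R).
Proof.
suff H k : derive1n k (@expR R) = @expR R by move=> k z; rewrite H.
by elim: k => // k IH; rewrite derive1nS IH; apply/funext => z; rewrite derive1E derive_val.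
Qed.

Lemma smooth1_family (a : nat -> R -> R) :
  (forall k (z : R), is_derive z (1 : R) (a k) (a k.+1 z)) -> smooth1 (a 0%N).
Proof.
move=> da; suff H k : derive1n k (a 0%N) = a k by move=> k z; rewrite H; have [] := da k z.
elim: k => // k IH; rewrite derive1nS IH; apply/funext => z.
by rewrite derive1E; have [] := da k z.
Qed.

(** The k-th derivative of cos is its translate by k pi / 2, which gives all derivatives in one
    formula. *)
Lemma smooth1_cos : smooth1 (@cos R).
Proof.
rewrite (_ : cos = fun t => cos (t + (pi / 2) *+ 0)); last by apply/funext => t; rewrite addr0.
apply: (@smooth1_family (fun k t => cos (t + (pi / 2) *+ k))) => k z; rewrite (mulrSr (pi / 2)) addrA cosDpihalf.
have := @is_derive_affine (@cos R) (fun t => - sin t) 1 (pi / 2 *+ k) z.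
rewrite (_ : (fun t => cos (1 * t + pi / 2 *+ k)) = fun t => cos (t + pi / 2 *+ k)); last first.
  by apply/funext => t; rewrite mul1r.
by rewrite !mul1r; apply=> t.
Qed.

Lemma smooth1_sin : smooth1 (@sin R).
Proof.
rewrite (_ : sin = fun t => sin (t + (pi / 2) *+ 0)); last by apply/funext => t; rewrite addr0.
apply: (@smooth1_family (fun k t => sin (t + (pi / 2) *+ k))) => k z; rewrite (mulrSr (pi / 2)) addrA sinDpihalf.
have := @is_derive_affine (@sin R) (@cos R) 1 (pi / 2 *+ k) z.
rewrite (_ : (fun t => sin (1 * t + pi / 2 *+ k)) = fun t => sin (t + pi / 2 *+ k)); last first.
  by apply/funext => t; rewrite mul1r.
by rewrite !mul1r; apply=> t.
Qed.
End smooth_calculus.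

(** * Integrable real functions and dominated convergence *)

Section real_integrals.
Context {d} {T : measurableType d} {R : realType} (mu : {measure set T -> \bar R}).
Implicit Types (D E : set T) (f g h : T -> R).

Definition L1 D f := mu.-integrable D (EFin \o f).

Lemma L1_measurable D f : L1 D f -> measurable_fun D f.
Proof. by move=> /measurable_int/measurable_EFinP. Qed.

Lemma L1_le D f g : measurable D -> measurable_fun D f ->
  (forall x, D x -> `|f x| <= g x) -> L1 D g -> L1 D f.
Proof.
move=> mD mf fg; apply: le_integrable => //; first exact/measurable_EFinP.
by move=> x Dx /=; rewrite lee_fin (le_trans (fg _ Dx))// ler_norm.
Qed.

Lemma L1D D f g : measurable D -> L1 D f -> L1 D g -> L1 D (fun x => f x + g x).
Proof. by move=> mD Lf Lg; have := integrableD mD Lf Lg; apply: eq_integrable. Qed.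

Lemma L1Z D (c : R) f : measurable D -> L1 D f -> L1 D (fun x => c * f x).
Proof. by move=> mD Lf; have := integrableZl mD c Lf; apply: eq_integrable. Qed.

Lemma L1N D f : measurable D -> L1 D f -> L1 D (fun x => - f x).
Proof. by move=> mD Lf; have := integrableN Lf; apply: eq_integrable. Qed.

Lemma L1B D f g : measurable D -> L1 D f -> L1 D g -> L1 D (fun x => f x - g x).
Proof. by move=> mD Lf Lg; apply: L1D => //; exact: L1N. Qed.

Lemma L1_eq D f g : measurable D -> (forall x, D x -> f x = g x) -> L1 D f -> L1 D g.
Proof. by move=> mD fg; apply: eq_integrable => // x /set_mem Dx /=; rewrite fg. Qed.

Lemma L1_0 D : measurable D -> L1 D (fun=> 0).
Proof. by move=> mD; exact: integrable0. Qed.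

Lemma L1_sum D (I : Type) (s : seq I) (F : I -> T -> R) : measurable D ->
  (forall i, L1 D (F i)) -> L1 D (fun x => \sum_(i <- s) F i x).
Proof.
move=> mD LF; elim: s => [|i s IH].
  by apply: (@L1_eq _ (fun=> 0)) => // [x _|]; [rewrite big_nil|exact: L1_0].
apply: (@L1_eq _ (fun x => F i x + \sum_(i <- s) F i x)) => // [x _|]; last exact: L1D.
by rewrite big_cons.
Qed.

Lemma L1_mulbdd D f h (M : R) : measurable D -> measurable_fun D h ->
  (forall x, D x -> `|h x| <= M) -> L1 D f -> L1 D (fun x => f x * h x).
Proof.
move=> mD mh hM Lf; have mf := L1_measurable Lf.
apply: (@L1_le _ _ (fun x => M * `|f x|)) => //.
- exact: measurable_funM.
- by move=> x Dx; rewrite normrM mulrC ler_wpM2r// hM.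
- by apply: L1Z => //; have := integrable_norm Lf; apply: eq_integrable.
Qed.

Lemma L1_norm D f : L1 D f -> L1 D (fun x => `|f x|).
Proof. exact: integrable_norm. Qed.

Lemma L1S D E f : measurable D -> measurable E -> D `<=` E -> L1 E f -> L1 D f.
Proof. by move=> mD mE; exact: integrableS. Qed.

Lemma Rint_ae D f g : measurable D -> measurable_fun D f -> measurable_fun D g ->
  {ae mu, forall x, D x -> f x = g x} ->
  \int[mu]_(x in D) f x = \int[mu]_(x in D) g x.
Proof.
move=> mD mf mg fg; congr fine; apply: ae_eq_integral => //.
- exact/measurable_EFinP.
- exact/measurable_EFinP.
- by apply: filterS fg => x fg Dx /=; rewrite fg.
Qed.

(** Extended by 0 outside their domains, both integrands are the same function. *)
Lemma Rint_support D E f : D `<=` E -> (forall x, E x -> ~ D x -> f x = 0) ->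
  \int[mu]_(x in E) f x = \int[mu]_(x in D) f x.
Proof.
move=> DE f0; rewrite [LHS]Rintegral_mkcond [RHS]Rintegral_mkcond; congr (Rintegral _ _ _).
apply/funext => x; rewrite !patchE; case: ifPn => [/set_mem Ex|].
  by case: ifPn => // /negP Dx; rewrite f0// => Dx'; apply: Dx; rewrite inE.
move=> /negP Ex; case: ifPn => // /set_mem /DE Ex'.
by exfalso; apply: Ex; rewrite inE.
Qed.

Lemma L1_support D E f : measurable D -> measurable E -> D `<=` E ->
  (forall x, E x -> ~ D x -> f x = 0) -> L1 D f -> L1 E f.
Proof.
move=> mD mE DE f0 /(integrable_mkcond _ mD) h; apply/(integrable_mkcond _ mE).
apply: eq_integrable h => // x _; rewrite !patchE; case: ifPn => [/set_mem Dx|/negP Dx].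
  by rewrite ifT// inE; exact: DE.
case: ifPn => // /set_mem Ex /=; rewrite f0// => Dx'; apply: Dx; rewrite inE//.
Qed.

Lemma Rint_eq D f g : (forall x, D x -> f x = g x) ->
  \int[mu]_(x in D) f x = \int[mu]_(x in D) g x.
Proof. by move=> fg; apply: eq_Rintegral => x /set_mem; exact: fg. Qed.

Lemma Rint_sum D (I : Type) (s : seq I) (F : I -> T -> R) : measurable D ->
  (forall i, L1 D (F i)) ->
  \int[mu]_(x in D) (\sum_(i <- s) F i x) = \sum_(i <- s) \int[mu]_(x in D) F i x.
Proof.
move=> mD LF; elim: s => [|i s IH].
  rewrite big_nil (@Rint_eq _ _ (fun=> 0)); last by move=> x _; rewrite big_nil.
  by rewrite Rintegral_cst// mul0r.
rewrite big_cons -IH -RintegralD//; [|exact: LF|exact: L1_sum].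
by apply: Rint_eq => x _; rewrite big_cons.
Qed.

Lemma Rint_0 D : measurable D -> \int[mu]_(x in D) (0 : R) = 0.
Proof. by move=> mD; rewrite Rintegral_cst// mul0r. Qed.

Lemma Rint_dct D (F : nat -> T -> R) f g : measurable D ->
  (forall k, measurable_fun D (F k)) ->
  (forall x, D x -> F k x @[k --> \oo] --> f x) -> L1 D g ->
  (forall k x, D x -> `|F k x| <= g x) ->
  \int[mu]_(x in D) F k x @[k --> \oo] --> \int[mu]_(x in D) f x.
Proof.
move=> mD mF cF Lg Fg.
have mf : measurable_fun D f by exact: (measurable_fun_cvg mF).
have [|||||Lf _ h] := @dominated_convergence _ _ _ mu _ mD (fun k => EFin \o F k) (EFin \o f) (EFin \o g).
- by move=> k; exact/measurable_EFinP.
- exact/measurable_EFinP.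
- by apply: aeW => x Dx; apply/fine_cvgP; split; [exact: nearW|exact: cF].
- exact: Lg.
- by apply: aeW => x k Dx; rewrite /= lee_fin Fg.
by apply: fine_cvg; rewrite fineK ?integrable_fin_num.
Qed.
End real_integrals.

Local Arguments leb : simpl never.

(** * Test functions and differentiation under the integral *)

Section test_functions.
Context {R : realType}.
Implicit Types n : nat.
Notation L n := (L1 (@leb R n)).

Lemma continuous_measurable_row n (f : 'rV[R]_n -> R) D : continuous f -> measurable D -> measurable_fun D f.
Proof.
move=> cf mD; apply: (@measurable_funS _ _ _ _ setT) => //.
apply: (measurability _ (RGenOpens.measurableE R)) => //.
move=> /= _ [_ [a [b ->]]] <-; rewrite setTI.
apply: open_measurable_row; move/continuousP : cf; apply.
exact: interval_open.
Qed.

Lemma L1_bounded n D (f : 'rV[R]_n -> R) (M : R) : measurable D -> (leb n D < +oo)%E ->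
  measurable_fun D f -> (forall x, D x -> `|f x| <= M) -> L n D f.
Proof.
move=> mD lD mf fM; apply: (L1_le mD mf fM).
apply/integrableP; split; first exact: measurable_cst.
rewrite (_ : integral _ _ _ = \int[leb n]_(x in D) (cst (`|M|%:E) x))%E//.
by rewrite integral_cst// lte_mul_pinfty// lee_fin.
Qed.

(** The change of variables is a pushforward by the translation, and [leb_shift] identifies the
    image measure with [leb n]. *)
Lemma Rint_shift n (a : 'rV[R]_n) (f : 'rV[R]_n -> R) : L n setT f ->
  L n setT (fun x => f (x + a)) /\
  \int[leb n]_(x in setT) f (x + a) = \int[leb n]_(x in setT) f x.
Proof.
move=> Lf; have mf := L1_measurable Lf.
have ms := measurable_shift a.
pose nu : {measure set 'rV[R]_n -> \bar R} :=
  measure_function_pushforward__canonical__measure_function_Measure (@leb R n) ms.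
have E (g : 'rV[R]_n -> \bar R) : (\int[leb n]_x g x = \int[nu]_x g x)%E.
  apply: eq_measure_integral => A mA _.
  by rewrite /nu/= /pushforward -(leb_shift a mA).
have Lfa : L n setT (fun x => f (x + a)).
  apply/integrableP; split.
    by apply/measurable_EFinP; apply: measurableT_comp mf _.
  case/integrableP: Lf => _; apply: le_lt_trans.
  rewrite [X in (_ <= X)%E]E.
  rewrite (@ge0_integral_pushforward _ _ _ _ _ _ ms (leb n) setT (fun x => `|(f x)%:E|%E)) //.
  by apply: measurableT_comp => //; apply/measurable_EFinP.
split=> //; congr fine.
rewrite [RHS]E.
by rewrite (@integral_pushforward _ _ _ _ _ _ ms (leb n) setT (EFin \o f))//; apply/measurable_EFinP.
Qed.

Lemma continuous_shiftl n (a : 'rV[R]_n) : continuous (fun y => a + y).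
Proof. by move=> y; apply: continuousD; [exact: cst_continuous|exact: cvg_id]. Qed.

(** Only the regular factor G moves with t, so [|V y| * M] dominates the derivative in t uniformly
    and V need only be integrable. This serves both the invariance argument of [int_pderiv0] and the
    differentiation of convolutions. *)
Lemma derive_int_shift n (D : set 'rV[R]_n) (V G : 'rV[R]_n -> R) (i : 'I_n) (M s : R) :
  measurable D -> L n D V -> Ck 1 G ->
  (forall x, `|G x| <= M) -> (forall x, `|pderiv i G x| <= M) ->
  is_derive s (1:R) (fun t : R => \int[leb n]_(y in D) (V y * G (t *: delta_mx 0 i + y)))
    (\int[leb n]_(y in D) (V y * pderiv i G (s *: delta_mx 0 i + y))).
Proof.
move=> mD LV cG GM dGM.
have M0 : 0 <= M by apply: le_trans (GM 0).
pose f (t : R) (y : 'rV[R]_n) := V y * G (t *: delta_mx 0 i + y).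
have df t y : is_derive t (1:R) (f^~ y) (V y * pderiv i G (t *: delta_mx 0 i + y)).
  have dG : derivable (fun s : R => G (s *: delta_mx 0 i + y)) t 1.
    by rewrite derivable_line; exact: Ck_derivable cG.
  have : is_derive t (1:R) (fun s : R => G (s *: delta_mx 0 i + y)) (pderiv i G (t *: delta_mx 0 i + y)).
    by apply: DeriveDef => //; rewrite -derive1E derive_line.
  by move=> h; apply: is_deriveZ.
have mG (F : 'rV[R]_n -> R) t : continuous F -> measurable_fun D (fun y => F (t *: delta_mx 0 i + y)).
  move=> cF; apply: continuous_measurable_row => // x.
  by apply: continuous_comp; [exact: continuous_shiftl|exact: cF].
have intf t : L n D (f t).
  apply: (@L1_mulbdd _ _ _ _ _ _ _ M) => //; exact: (mG G t (Ck_cont cG)).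
have E t y : partial1of2 f t y = V y * pderiv i G (t *: delta_mx 0 i + y).
  by rewrite partial1of2E; have [_ ->] := df t y.
have := @cvg_differentiation_under_integral R _ _ (leb n) f D mD s (s - 1) (s + 1).
move=> /(_ _ _ _ (fun y => `|V y| * M)).
have sI : `]s - 1, s + 1[%classic s by rewrite /= in_itv/=; lra.
move=> /(_ sI (fun t _ => intf t) (fun t y _ _ => (@ex_derive _ _ _ _ _ _ _ (df t y)))).
have G0 y : 0 <= `|V y| * M by rewrite mulr_ge0.
have LG : L n D (fun y => `|V y| * M).
  apply: (@L1_mulbdd _ _ _ _ _ _ _ M) => //; last exact: L1_norm.
  by move=> x _; rewrite ger0_norm.
move=> /(_ G0 LG).
have GM' (t : R) y : `]s - 1, s + 1[%classic t -> D y -> `|partial1of2 f t y| <= `|V y| * M.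
  by move=> _ _; rewrite E normrM ler_wpM2l.
move=> /(_ GM').
have -> : \int[leb n]_(y in D) partial1of2 f s y =
  \int[leb n]_(y in D) (V y * pderiv i G (s *: delta_mx 0 i + y)).
  by apply: Rint_eq => y _; exact: E.
move=> h.
have h' : h^-1 *: (((fun x' : R => \int[leb n]_(y in D) f x' y) \o shift s) (h *: 1) - \int[leb n]_(y in D) f s y) @[h --> 0^'] --> \int[leb n]_(y in D) (V y * pderiv i G (s *: delta_mx 0 i + y)).
  move: h; apply: cvg_trans; apply: near_eq_cvg; near=> k => /=.
  by rewrite [k%:A]mulr1.
by apply: DeriveDef; [apply/cvg_ex; eexists; exact: h'|apply: cvg_lim => //; exact: h'].
Unshelve. all: by end_near.
Qed.

Lemma compact_bounded_fun n (K : set 'rV[R]_n) (f : 'rV[R]_n -> R) : compact K ->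
  continuous f -> exists2 M, 0 < M & forall x, K x -> `|f x| <= M.
Proof.
move=> cK cf.
have : compact (f @` K) by apply: continuous_compact => //; exact: continuous_subspaceT.
move=> /compact_bounded/bounded_set_le[M M0 h]; exists M => // x Kx.
by apply: h; exists x.
Qed.

Lemma test_bounded n D (psi : 'rV[R]_n -> R) : test_function D psi ->
  exists2 M, 0 < M & forall x, `|psi x| <= M.
Proof.
move=> [spsi [K [cK KD Kpsi]]].
have [M M0 h] := compact_bounded_fun cK (smooth_cont spsi).
exists M => // x; have [/h//|/Kpsi ->] := pselect (K x).
by rewrite normr0 ltW.
Qed.

Lemma pderiv_out n (K : set 'rV[R]_n) (f : 'rV[R]_n -> R) i : closed K ->
  (forall x, ~ K x -> f x = 0) -> forall x, ~ K x -> pderiv i f x = 0.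
Proof.
move=> /closed_openC oK f0 x nKx; rewrite /pderiv -(derive_cst (0 : R) x (delta_mx 0 i)).
by apply: near_eq_derive; have : nbhs x (~` K) by [exact: open_nbhs_nbhs]; apply: filterS => y /f0.
Qed.

Lemma test_pderiv n D (psi : 'rV[R]_n -> R) i : test_function D psi -> test_function D (pderiv i psi).
Proof.
move=> [spsi [K [cK KD Kpsi]]]; split; first exact: smooth_pderiv.
by exists K; split=> //; apply: pderiv_out => //; exact: compact_closed.
Qed.

Lemma testM n D (psi f : 'rV[R]_n -> R) : test_function D psi -> smooth f ->
  test_function D (fun x => f x * psi x).
Proof.
move=> [spsi [K [cK KD Kpsi]]] sf; split; first exact: smoothM.
by exists K; split=> // x /Kpsi ->; rewrite mulr0.
Qed.

Lemma test_ball n D (psi : 'rV[R]_n -> R) : test_function D psi ->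
  exists2 r, 0 < r & forall x, ~ ball (0 : 'rV[R]_n) r x -> psi x = 0.
Proof.
move=> [_ [K [/compact_bounded/bounded_set_le[M M0 h] _ Kpsi]]].
exists (M + 1) => [|x hx]; first by rewrite addr_gt0.
by apply: Kpsi => Kx; apply: hx; rewrite ball0E/=; apply: le_lt_trans (h _ Kx) _; rewrite ltrDl.
Qed.

Definition loc_L1 n (h : 'rV[R]_n -> R) := forall r, L n (ball 0 r) h.

Lemma ball_shift n (r s : R) (i : 'I_n) (y : 'rV[R]_n) : `|s| < 1 ->
  ball (0 : 'rV[R]_n) r (s *: delta_mx 0 i + y) -> ball (0 : 'rV[R]_n) (r + 1) y.
Proof.
move=> s1; rewrite !ball0E/= => h.
have -> : y = (s *: delta_mx 0 i + y) - s *: delta_mx 0 i by rewrite addrC addrA addNr add0r.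
apply: le_lt_trans (ler_normB _ _) _; rewrite normrZ.
apply: ltr_leD => //.
suff : `|delta_mx 0 i : 'rV[R]_n| <= 1.
  by move=> h1; apply: le_trans (_ : `|s| * 1 <= 1); [rewrite ler_wpM2l|rewrite mulr1 ltW].
apply/ler_addgt0Pr => e e0.
have : ball (0 : 'rV[R]_n) (1 + e) (delta_mx 0 i).
  apply/ball_rowE; split; first by rewrite addr_gt0.
  move=> j; rewrite !mxE sub0r normrN eqxx /=; case: (j == i); rewrite ?normr1 ?normr0; lra.
by rewrite ball0E/= => /ltW.
Qed.

(* The derivative at 0 of the constant int h G(. + t e_i) vanishes. *)
Lemma int_pderiv0 n (i : 'I_n) (h G : 'rV[R]_n -> R) (D : set 'rV[R]_n) :
  (forall x t, h (t *: delta_mx 0 i + x) = h x) -> loc_L1 h -> test_function D G ->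
  \int[leb n]_(x in setT) (h x * pderiv i G x) = 0.
Proof.
move=> hi Lh tG.
have [r r0 Gr] := test_ball tG.
have [M M0 GM] := test_bounded tG.
have [M' M'0 GM'] := test_bounded (test_pderiv i tG).
(* The radius [r + 1] leaves room for a unit ball around x outside the support of G, and below for
   translations by [|t| < 1]. *)
have dGr x : ~ ball (0 : 'rV[R]_n) (r + 1) x -> pderiv i G x = 0.
  move=> hx; rewrite /pderiv -(derive_cst (0 : R) x (delta_mx 0 i)); apply: near_eq_derive.
  have : nbhs x (ball x 1) by apply: nbhsx_ballx.
  apply: filterS => y xy; apply: Gr => yr; apply: hx.
  rewrite ball0E/=; move: yr; rewrite ball0E/= => yr.
  move: xy; rewrite -ball_normE/= => xy.
  have -> : x = (x - y) + y by rewrite subrK.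
  by apply: le_lt_trans (ler_normD _ _) _; rewrite addrC ltrD.
pose B := ball (0 : 'rV[R]_n) (r + 1).
have mB : measurable B by exact: measurable_ball_row.
have bG x : `|G x| <= Num.max M M' by rewrite le_max GM.
have bG' x : `|pderiv i G x| <= Num.max M M' by rewrite le_max GM' orbT.
have cG : Ck 1 G by apply: tG.1.
have := derive_int_shift 0 mB (Lh (r + 1)) cG bG bG'.
set F := (fun t => _).
have F0 : {near (0 : R), cst (F 0) =1 F}.
  have : nbhs (0:R) (ball (0:R) 1) by apply: nbhsx_ballx.
  apply: filterS => t; rewrite /ball/= sub0r normrN => t1 /=.
  (* For [|s| < 1] the shifted function is still supported in B, so the integral extends to the
     whole space, where translation invariance applies. *)
  have E s : `|s| < 1 -> F s = \int[leb n]_(y in setT) (h y * G (s *: delta_mx 0 i + y)).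
    move=> s1; rewrite /F; symmetry; apply: Rint_support => // y _ nB.
    by rewrite Gr ?mulr0// => /(ball_shift s1).
  rewrite (E t t1) E ?normr0//.
  have LhG : L n setT (fun y => h y * G y).
    apply: (@L1_support _ _ _ _ B) => // [y _ nB|].
      by rewrite Gr ?mulr0// => yr; apply: nB; apply: le_ball yr; rewrite lerDl.
    apply: (@L1_mulbdd _ _ _ _ _ _ _ M) => //; last exact: Lh.
    by apply: continuous_measurable_row => //; apply: smooth_cont tG.1.
  have [_ S] := Rint_shift (t *: delta_mx 0 i) LhG.
  under [LHS]eq_Rintegral do rewrite scale0r add0r.
  rewrite -S; apply: eq_Rintegral => x _.
  by rewrite [in G _]addrC -[in h _]addrC hi.
move=> dF.
have : is_derive (0:R) (1:R) (cst (F 0)) (\int[leb n]_(y in B) (h y * pderiv i G (0 *: delta_mx 0 i + y))).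
  apply: near_eq_is_derive dF.
  by move: F0; apply: filterS => x /= ->.
move=> [_]; rewrite derive_cst => ->.
transitivity (\int[leb n]_(y in B) (h y * pderiv i G y)).
  by apply: Rint_support => // x _ nB; rewrite (dGr x nB) mulr0.
by apply: Rint_eq => y _; rewrite scale0r add0r.
Qed.
End test_functions.

(** * The du Bois-Reymond lemma *)

Section fundamental_lemma.
Context {R : realType}.
Implicit Types n : nat.
Notation L n := (L1 (@leb R n)).

Lemma cutoff_bounded (chi : R -> R) : cutoff chi -> exists2 M, 1 <= M & forall z, `|chi z| <= M.
Proof.
move=> hc; have cchi := continuous_smooth1 (cutoff_smooth hc).
have : compact (chi @` `[0, 1]).
  by apply: continuous_compact; [exact: continuous_subspaceT|exact: segment_compact].
move=> /compact_bounded/bounded_set_le[M M0 h]; exists (M + 1); first by rewrite lerDr ltW.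
move=> z; have [z0|z0] := leP z 0; first by rewrite (cutoff_zero hc)// normr0; lra.
have [z1|z1] := leP 1 z; first by rewrite (cutoff_one hc)// normr1; lra.
by apply: le_trans (h (chi z) _) _; [exists z => //=; rewrite in_itv/= !ltW|rewrite lerDl].
Qed.

Definition obox n (a b : 'I_n -> R) : set 'rV[R]_n := [set x | forall i, a i < x 0 i < b i].
Definition cbox n (a b : 'I_n -> R) : set 'rV[R]_n := [set x | forall i, a i <= x 0 i <= b i].

Lemma cbox_compact n (a b : 'I_n -> R) : compact (cbox a b).
Proof.
have := @rV_compact R n (fun i => `[a i, b i]%classic) (fun i => @segment_compact _ _ _).
rewrite (_ : [set _ | _] = cbox a b)//; apply/seteqP; split=> x /= h i; have := h i;
  by rewrite ?in_itv//= => ->.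
Qed.

Lemma measurable_obox n (a b : 'I_n -> R) : measurable (obox a b).
Proof.
have -> : obox a b = [set v : 'rV[R]_n | forall i, `]a i, b i[%classic (v 0 i)].
  by apply/seteqP; split=> x h i; have := h i; rewrite /= in_itv/=.
exact: (@measurable_box _ _ (fun i => `]a i, b i[%classic)).
Qed.

(** A smooth approximation of the indicator of the open box: the factor of index i vanishes outside
    the i-th side and is 1 at distance at least 1 / (k + 1) from its ends. The given cut-off
    supplies the smooth step, which is why [cutoff chi] is assumed up to the du Bois-Reymond lemma
    and its consequences. *)
Definition bump n (chi : R -> R) (a b : 'I_n -> R) (k : nat) (x : 'rV[R]_n) : R :=
  \prod_(i < n) (chi (k.+1%:R * (x 0 i - a i)) * chi (k.+1%:R * (b i - x 0 i))).

Lemma bump_test n (chi : R -> R) (a b : 'I_n -> R) k D : cutoff chi -> cbox a b `<=` D ->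
  test_function D (bump chi a b k).
Proof.
move=> hc hD; split.
  rewrite /bump; apply: smooth_prod => i; apply: smoothM.
    rewrite (_ : (fun _ => _) = fun x : 'rV[R]_n => chi (k.+1%:R * x 0 i + - (k.+1%:R * a i))).
      by apply: smooth_affine; exact: cutoff_smooth.
    by apply/funext => x; rewrite mulrBr.
  rewrite (_ : (fun _ => _) = fun x : 'rV[R]_n => chi (- k.+1%:R * x 0 i + (k.+1%:R * b i))).
    by apply: smooth_affine; exact: cutoff_smooth.
  by apply/funext => x; rewrite mulrBr mulNr addrC.
exists (cbox a b); split=> //; first exact: cbox_compact.
move=> x nx; have /existsNP[i /negP] : ~ forall i, a i <= x 0 i <= b i by [].
rewrite negb_and -!ltNge => h; rewrite /bump (bigD1 i)//=.
suff -> : chi (k.+1%:R * (x 0 i - a i)) * chi (k.+1%:R * (b i - x 0 i)) = 0 by rewrite mul0r.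
case/orP: h => h.
  by rewrite (cutoff_zero hc) ?mul0r// pmulr_rle0// subr_le0 ltW.
by rewrite mulrC (cutoff_zero hc) ?mul0r// pmulr_rle0// subr_le0 ltW.
Qed.

Lemma bump_bounded n (chi : R -> R) (a b : 'I_n -> R) M : cutoff chi -> 1 <= M ->
  (forall z, `|chi z| <= M) -> forall k x, `|bump chi a b k x| <= (M * M) ^+ n.
Proof.
move=> hc M1 hM k x; rewrite /bump normr_prod -[X in _ <= _ ^+ X]card_ord -prodr_const.
apply: ler_prod => i _; rewrite normr_ge0/= normrM ler_pM//.
Qed.

Lemma bump_cvg n (chi : R -> R) (a b : 'I_n -> R) x : cutoff chi ->
  bump chi a b k x @[k --> \oo] --> (\1_(obox a b) x : R).
Proof.
move=> hc; rewrite indicE; have [xb|xb] := boolP (x \in obox a b); last first.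
  apply: cvg_near_cst; apply: nearW => k.
  have /existsNP[i /negP] : ~ forall i, a i < x 0 i < b i by move=> h; move/negP: xb; apply; rewrite inE.
  rewrite negb_and -!leNgt => h; rewrite /bump (bigD1 i)//=.
  suff -> : chi (k.+1%:R * (x 0 i - a i)) * chi (k.+1%:R * (b i - x 0 i)) = 0 by rewrite mul0r.
  case/orP: h => h.
    by rewrite (cutoff_zero hc) ?mul0r// pmulr_rle0// subr_le0.
  by rewrite mulrC (cutoff_zero hc) ?mul0r// pmulr_rle0// subr_le0.
move: xb => /set_mem xb; apply: cvg_near_cst.
have H (c : R) : 0 < c -> \forall k \near \oo, 1 <= k.+1%:R * c.
  move=> c0; exists (Num.truncn c^-1) => // k /= hk.
  rewrite -ler_pdivrMr// div1r; apply: le_trans (ltW (truncnS_gt _)) _.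
  by rewrite ler_nat.
have H' i : \forall k \near \oo, chi (k.+1%:R * (x 0 i - a i)) * chi (k.+1%:R * (b i - x 0 i)) = 1.
  have /andP[h1 h2] := xb i.
  near=> k; rewrite !(cutoff_one hc) ?mulr1//; near: k; apply: H; rewrite subr_gt0//.
have : \forall k \near \oo, forall i, chi (k.+1%:R * (x 0 i - a i)) * chi (k.+1%:R * (b i - x 0 i)) = 1.
  exact: filter_forall.
by apply: filterS => k hk; rewrite /bump big1.
Unshelve. all: by end_near.
Qed.
 
(** The bumps are test functions, so f integrates to 0 against each of them. They converge to the
    indicator of the open box and are uniformly bounded: dominated convergence on the closed box. *)
Lemma int_obox0 n (chi : R -> R) (D : set 'rV[R]_n) (f : 'rV[R]_n -> R) (a b : 'I_n -> R) :
  cutoff chi -> measurable D -> cbox a b `<=` D -> L n (cbox a b) f ->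
  (forall psi, test_function D psi -> \int[leb n]_(x in D) (f x * psi x) = 0) ->
  \int[leb n]_(x in obox a b) f x = 0.
Proof.
move=> hc mD hD Lf h.
have [M M1 hM] := cutoff_bounded hc.
have mb : measurable (cbox a b).
  by apply: closed_measurable_row; apply: compact_closed => //; exact: cbox_compact.
have mf := L1_measurable Lf.
have : \int[leb n]_(x in cbox a b) (f x * bump chi a b k x) @[k --> \oo] -->
   \int[leb n]_(x in cbox a b) (f x * \1_(obox a b) x).
  apply: (@Rint_dct _ _ _ _ _ _ _ (fun x => (M * M) ^+ n * `|f x|)) => //.
  - move=> k; apply: measurable_funM => //; apply: continuous_measurable_row => //.
    by apply: smooth_cont; have [] := @bump_test n chi a b k D hc hD.
  - move=> x _; apply: cvgM; [exact: cvg_cst|exact: bump_cvg].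
  - by apply: L1Z => //; exact: L1_norm.
  - by move=> k x _; rewrite normrM mulrC ler_wpM2r//; exact: bump_bounded.
have -> : (fun k => \int[leb n]_(x in cbox a b) (f x * bump chi a b k x)) = cst 0.
  apply/funext => k; rewrite -(h (bump chi a b k)); last exact: bump_test.
  symmetry; apply: Rint_support => // x _ nx.
  have [_ [K [_ KD]]] := @bump_test n chi a b k (cbox a b) hc (fun x => id).
  by move=> ->; rewrite ?mulr0// => /KD.
move=> hlim; have := cvg_lim (@Rhausdorff R) hlim; rewrite lim_cst; last exact: Rhausdorff.
move=> E.
have <- : \int[leb n]_(x in cbox a b) (f x * \1_(obox a b) x) = \int[leb n]_(x in obox a b) f x.
  rewrite (@Rint_support _ _ _ _ (obox a b)).
  - by apply: Rint_eq => x xb; rewrite indicE mem_set// mulr1.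
  - by move=> x xb i; have := xb i => /andP[? ?]; rewrite !ltW.
  - by move=> x _ nx; rewrite indicE memNset// mulr0.
by rewrite -E.
Qed.

Lemma int0_of_Rint0 n (D : set 'rV[R]_n) (f : 'rV[R]_n -> R) : measurable D -> L n D f ->
  \int[leb n]_(x in D) f x = 0 -> (\int[leb n]_(x in D) (f x)%:E = 0)%E.
Proof.
by move=> mD Lf E0; rewrite -(fineK (integrable_fin_num mD Lf)); congr (_%:E).
Qed.

(** [setT] is added to the open rays because [measurable_boxes] requires it; the class remains
    closed under intersection. *)
Lemma gen_rays : (@measurable _ (measurableTypeR R)) =
  <<s [set A : set (measurableTypeR R) | A = setT \/ exists x, A = `]x, +oo[%classic] >>.
Proof.
rewrite RGenOInfty.measurableE; apply/seteqP; split.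
  apply: smallest_sub; first exact: smallest_sigma_algebra.
  by move=> A [x ->]; apply: sub_sigma_algebra; right; exists x.
apply: smallest_sub; first exact: smallest_sigma_algebra.
move=> A [->|[x ->]]; last by apply: sub_sigma_algebra; exists x.
exact: (@measurableT _ (g_sigma_algebraType (@RGenOInfty.G R))).
Qed.

(** Intersecting Q with a box of open rays only raises its lower corner from a to some c. Such boxes
    of rays generate the measurable sets, so a Dynkin argument makes f integrate to 0 over every
    measurable part of Q. *)
Lemma ae0_obox n (Q : set 'rV[R]_n) (f : 'rV[R]_n -> R) (a b : 'I_n -> R) :
  Q = obox a b -> L n Q f ->
  (forall c : 'I_n -> R, (forall i, a i <= c i) -> \int[leb n]_(x in obox c b) f x = 0) ->
  {ae leb n, forall x, Q x -> f x = 0}.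
Proof.
move=> QE Lf h; have mQ : measurable Q by rewrite QE; exact: measurable_obox.
have H E : measurable E -> \int[leb n]_(x in E `&` Q) f x = 0.
  pose P0 := [set A : set (measurableTypeR R) | A = setT \/ exists x, A = `]x, +oo[%classic].
  have PI : setI_closed P0.
    move=> A B [->|[x ->]] [->|[y ->]]; rewrite ?setIT ?setTI; [by left|by right; exists y|by right;exists x|].
    right; exists (Num.max x y); apply/seteqP; split=> z /=; rewrite !in_itv/= !andbT gt_max.
      by move=> [-> ->].
    by move/andP.
  have PT : P0 setT by left.
  have mE := measurable_boxes n gen_rays PT.
  have LE A : measurable A -> L n (A `&` Q) f.
    by move=> mA; apply: (L1S _ _ _ Lf) => //; exact: measurableI.
  have GP : @boxes R n P0 `<=` [set A | \int[leb n]_(x in A `&` Q) f x = 0].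
    move=> _ [A PA ->] /=.
    have [c cA] : exists c : 'I_n -> R, forall i, a i <= c i /\ forall t, (A i t /\ a i < t) <-> c i < t.
      suff H i : exists c : R, a i <= c /\ forall t : R, (A i t /\ a i < t) <-> c < t.
        by have [c cP] := choice H; exists c.
      have [->|[x ->]] := PA i.
        by exists (a i); split=> // t; split=> [[]//|].
      exists (Num.max x (a i)); split; first by rewrite le_max lexx orbT.
      move=> t /=; rewrite in_itv/= andbT gt_max; split=> [[-> ->]//|/andP[]//].
    rewrite -[RHS](h c) => [|i]; last by have [] := cA i.
    congr (Rintegral _ _ _); rewrite QE; apply/seteqP; split=> x /=.
      move=> [h1 h2] i; have [_ h3] := cA i; have /andP[h4 ->] := h2 i; rewrite andbT.
      by apply/h3; split.
    move=> hx; split=> i; have [_ h3] := cA i; have /andP[h4 h5] := hx i; have [h6 h7] := (h3 (x 0 i)).2 h4 => //.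
    by rewrite h7.
  rewrite -[measurable E]/(_ E) mE.
  apply: (@dynkin_induction _ _ _ [set A | \int[leb n]_(x in A `&` Q) f x = 0] mE) => //.
  - exact: setI_closed_boxes.
  - apply: GP; exists (fun=> setT) => // .
    by apply/seteqP; split.
  - move=> S mS /= S0.
    have : \int[leb n]_(x in Q) f x = 0.
      have := GP setT; rewrite /= setTI; apply.
      by exists (fun=> setT) => //; apply/seteqP; split.
    rewrite -[in X in X -> _](_ : (S `&` Q) `|` (~` S `&` Q) = Q); last by rewrite -setIUl setUv setTI.
    rewrite Rintegral_setU.
    + by rewrite S0 add0r.
    + exact: measurableI.
    + by apply: measurableI => //; exact: measurableC.
    + by rewrite -setIUl setUv setTI.
    + by apply/disj_setPS => x [[? _] []].
  - move=> F mF tF F0 /=; rewrite setI_bigcupl /Rintegral integral_bigcup.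
    + rewrite eseries0// => k _ _; apply: int0_of_Rint0; [exact: measurableI|exact: LE|exact: F0].
    + by apply: trivIset_setIr.
    + by move=> k; exact: measurableI.
    + by rewrite -setI_bigcupl; apply: LE; exact: bigcup_measurable.
have : ae_eq (leb n) Q (EFin \o f) (cst 0%E).
  apply: integral_ae_eq => // E EQ mE; rewrite integral0.
  have := H E mE; rewrite setIidl//.
  by apply: int0_of_Rint0 => //; exact: L1S Lf.
by apply: filterS => x h' /h' /= [].
Qed.

(** A small ball of the sup norm around a point of D is an open box whose closed version stays in D,
    so [ae0_obox] applies there; [ae_local] assembles the null sets. *)
Lemma du_Bois_Reymond n (chi : R -> R) (D : set 'rV[R]_n) (f : 'rV[R]_n -> R) :
  cutoff chi -> open D -> (forall r, L n (D `&` ball 0 r) f) ->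
  (forall psi, test_function D psi -> \int[leb n]_(x in D) (f x * psi x) = 0) ->
  {ae leb n, forall x, D x -> f x = 0}.
Proof.
move=> hc oD Lf h; apply: ae_local => p Dp.
have mD := open_measurable_row oD.
have [e e0 he] := open_ballP oD Dp.
exists (e / 2); first by rewrite divr_gt0.
pose a i := p 0 i - e / 2; pose b i := p 0 i + e / 2.
have abD : cbox a b `<=` D.
  move=> x hx; apply: he; apply/ball_rowE; split=> // i.
  by have := hx i; rewrite /a /b ltr_norml; move: e0; lra.
have Lab : L n (cbox a b) f.
  have mb : measurable (cbox a b).
    by apply: closed_measurable_row; apply: compact_closed => //; exact: cbox_compact.
  apply: (L1S _ _ _ (Lf (`|p| + e))) => //.
    by exact: measurable_setI_ball.
  move=> x hx; split; first exact: abD.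
  have xe : ball p e x.
    apply/ball_rowE; split=> // i.
    by have := hx i; rewrite /a /b ltr_norml; move: e0; lra.
  rewrite ball0E/=; move: xe; rewrite -ball_normE/= => xe.
  have -> : x = p - (p - x) by rewrite opprB addrC subrK.
  by apply: le_lt_trans (ler_normB _ _) _; rewrite ltrD2l.
apply: (@ae0_obox n _ f a b).
- apply/seteqP; split=> x.
    move/ball_rowE => [_ hx] i; have := hx i; rewrite /a /b ltr_norml; lra.
  move=> hx; apply/ball_rowE; split; first by rewrite divr_gt0.
  by move=> i; have := hx i; rewrite /a /b ltr_norml; lra.
- apply: L1S Lab => //.
  + exact: measurable_ball_row.
  + by apply: closed_measurable_row; apply: compact_closed => //; exact: cbox_compact.
  + by move=> x /ball_rowE [_ hx] i; have := hx i; rewrite /a /b ltr_norml; lra.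
- move=> c ac; apply: (int_obox0 hc mD) => //.
    move=> x hx; apply: abD => i; have /andP[h1 h2] := hx i; rewrite h2 andbT.
    exact: le_trans (ac i) h1.
  apply: (L1S _ _ _ Lab); try by apply: closed_measurable_row; apply: compact_closed => //; exact: cbox_compact.
  move=> x hx i; have /andP[h1 h2] := hx i; rewrite h2 andbT.
  exact: le_trans (ac i) h1.
Qed.
End fundamental_lemma.

(** * Unique continuation *)

Section taylor_bounds.
Context {R : realType}.

Lemma MVT_global (f f' : R -> R) (a b : R) : a < b ->
  (forall z : R, is_derive z (1:R) f (f' z)) ->
  exists2 c, a < c < b & f b - f a = f' c * (b - a).
Proof.
move=> ab df.
have cf : {within `[a, b], continuous f}.
  by apply: derivable_within_continuous => x _; have [] := df x.
have [c] := MVT ab (fun x _ => df x) cf.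
by rewrite in_itv/= => h1 h2; exists c.
Qed.

(** At the maximum [f' 0 = 0]. If d were positive, f' would be positive just to the right of 0, and
    the mean value theorem would give [f t > f 0] for some small t. *)
Lemma second_derivative_max (f f' : R -> R) (d e : R) : 0 < e ->
  (forall z : R, is_derive z (1:R) f (f' z)) -> is_derive (0:R) (1:R) f' d ->
  (forall t, `|t| < e -> f t <= f 0) -> d <= 0.
Proof.
move=> e0 df dd fmax; rewrite leNgt; apply/negP => d0.
have f'0 : f' 0 = 0.
  have h : is_derive (0:R) (1:R) f 0.
    apply: (@derive1_at_max R f (- e) e 0).
    - by lra.
    - by move=> t _; have [] := df t.
    - by rewrite in_itv/=; lra.
    - by move=> t; rewrite in_itv/= -ltr_norml => /fmax.
  by have [_ <-] := df 0; have [_ ->] := h.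
have [dd1 dd2] := dd.
have cv : h^-1 *: ((f' \o shift (0:R)) (h *: (1:R)) - f' 0) @[h --> 0^'] --> d.
  by rewrite -dd2; exact: dd1.
have : \forall h \near (0:R)^', 0 < h^-1 *: ((f' \o shift (0:R)) (h *: (1:R)) - f' 0).
  exact: (cvgr_gt _ cv).
rewrite /dnbhs /within/= => /nbhs_ballP[r /= r0 hr].
pose t := Num.min (r / 2) (e / 2).
have t0 : 0 < t by rewrite lt_min !divr_gt0.
have [c /andP[c0 ct]] := MVT_global t0 df.
have : 0 < f' c.
  have := hr c; rewrite /ball/= sub0r normrN gtr0_norm//.
  have -> : c < r by apply: lt_le_trans ct _; rewrite ge_min; apply/orP; left; lra.
  move=> /(_ isT (lt0r_neq0 c0)); rewrite f'0 subr0 addr0 [c%:A]mulr1 /GRing.scale/=.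
  by rewrite pmulr_rgt0// invr_gt0.
move=> f'c E.
have : f t <= f 0.
  apply: fmax; rewrite gtr0_norm// /t gt_min; apply/orP; right; lra.
have : 0 < f' c * (t - 0) by rewrite mulr_gt0// subr0.
by rewrite -E; lra.
Qed.

(** The mean value theorem for [B s^(j+1) / (j+1)! - sg * g s], with [sg] equal to 1 and to -1,
    plays the role of integrating the bound on g'. *)
Lemma taylor_step (g g' : R -> R) (B t : R) j : (forall z : R, is_derive z (1:R) g (g' z)) ->
  g 0 = 0 -> (forall s, 0 < s < t -> `|g' s| <= B * (s ^+ j / j`!%:R)) -> 0 <= t ->
  `|g t| <= B * (t ^+ j.+1 / j.+1`!%:R).
Proof.
move=> dg g0 hB; rewrite le_eqVlt => /predU1P[<-|t0].
  by rewrite g0 normr0 expr0n/= mul0r mulr0.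
have key (sg : R) : `|sg| = 1 -> sg * g t <= B * (t ^+ j.+1 / j.+1`!%:R).
  move=> sg1.
  have dF (z : R) : is_derive z (1:R) (fun s : R => B / j.+1`!%:R * s ^+ j.+1 - sg * g s)
     (B * (z ^+ j / j`!%:R) - sg * g' z).
    have d1 : is_derive z (1:R) (fun s : R => s ^+ j.+1) (j.+1%:R * z ^+ j).
      apply: DeriveDef; first exact: exprn_derivable.
      by rewrite exp_derive /GRing.scale/= mulr1.
    have d2 := is_deriveZ (B / j.+1`!%:R) d1.
    have d3 := is_deriveZ sg (dg z).
    have d4 := is_deriveB d2 d3.
    suff -> : B * (z ^+ j / j`!%:R) - sg * g' z =
      B / j.+1`!%:R *: (j.+1%:R * z ^+ j) - sg *: g' z by exact: d4.
    rewrite /GRing.scale/= factS natrM; congr (_ - _).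
    have h1 : j.+1%:R != 0 :> R by rewrite pnatr_eq0.
    have h2 : j`!%:R != 0 :> R by rewrite pnatr_eq0 -lt0n fact_gt0.
    by move: (j.+1%:R) (j`!%:R) (z ^+ j) h1 h2 => u v w h1 h2; field; rewrite h1 h2.
  have [c ct] := MVT_global t0 dF.
  rewrite g0 mulr0 !subr0 expr0n/= mulr0 subr0.
  have : 0 <= (B * (c ^+ j / j`!%:R) - sg * g' c) * t.
    apply: mulr_ge0; last exact: ltW.
    rewrite subr_ge0; apply: le_trans (ler_norm _) _.
    by rewrite normrM sg1 mul1r; exact: hB.
  move=> h E; move: h; rewrite -E subr_ge0 => /le_trans; apply.
  by rewrite mulrAC mulrA.
have := key 1; have := key (-1); rewrite normrN normr1 mul1r mulN1r => /(_ erefl) h1 /(_ erefl) h2.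
by rewrite ler_norml h2 andbT lerNl.
Qed.

Lemma taylor_bound (g : nat -> R -> R) (B c : R) N :
  (forall k (z : R), is_derive z (1:R) (g k) (g k.+1 z)) ->
  (forall k, g k 0 = 0) -> (forall s, 0 <= s < c -> `|g N s| <= B) ->
  forall t, 0 <= t < c -> `|g 0%N t| <= B * (t ^+ N / N`!%:R).
Proof.
move=> dg g0 hB.
have H j : (j <= N)%N -> forall t, 0 <= t < c -> `|g (N - j)%N t| <= B * (t ^+ j / j`!%:R).
  elim: j => [|j IH] jN t tc; first by rewrite subn0 expr0 fact0 divr1 mulr1; exact: hB.
  have /andP[t0 tc'] := tc.
  apply: (taylor_step (dg (N - j.+1)%N)) => // s /andP[s0 st].
  rewrite subnSK//; apply: IH; first exact: ltnW.
  by rewrite ltW//= (lt_trans st).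
by move=> t tc; have := H N (leqnn _) t tc; rewrite subnn.
Qed.

(** All derivatives vanish at 0, so Taylor's bound of order N is [M (C N t)^N / N!]. As [N^N / N!]
    is a term of the exponential series at N, it is at most e^N, and the bound is at most M / 2^N
    for every N. *)
Lemma vanish_pos (g : nat -> R -> R) (M C rho c : R) :
  (forall k (z : R), is_derive z (1:R) (g k) (g k.+1 z)) -> 0 < rho -> 0 <= C ->
  (forall z, `|z| < rho -> g 0%N z = 0) ->
  (forall k z, 0 <= z < c -> `|g k z| <= M * (C * k%:R) ^+ k) ->
  C * expR 1 * c <= 1 / 2 -> forall t, 0 <= t < c -> g 0%N t = 0.
Proof.
move=> dg rho0 C0 g00 hM hC t tc.
have gk k : forall z, `|z| < rho -> g k z = 0.
  elim: k => // k IH z zr.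
  have [_ <-] := dg k z; rewrite -(derive_cst (0 : R) z (1:R)); apply: near_eq_derive.
  have : nbhs z (ball (0:R) rho).
    apply: open_nbhs_nbhs; split; first exact: ball_open.
    by rewrite /ball/= sub0r normrN.
  by apply: filterS => y; rewrite /ball/= sub0r normrN => /IH.
have gk0 k : g k 0 = 0 by apply: gk; rewrite normr0.
have M0 : 0 <= M.
  by have := hM 0%N t tc; rewrite expr0 mulr1; apply: le_trans.
have B N : `|g 0%N t| <= M * (1 / 2) ^+ N.
  apply: le_trans (@taylor_bound g (M * (C * N%:R) ^+ N) c N dg gk0 _ t tc) _; first exact: hM.
  rewrite -mulrA ler_wpM2l//.
  have /andP[t0 tc'] := tc.
  have -> : (C * N%:R) ^+ N * (t ^+ N / N`!%:R) = (C * t) ^+ N * (N%:R ^+ N / N`!%:R).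
    by rewrite !exprMn !mulrA; congr (_ / _); rewrite -!mulrA; congr (_ * _); rewrite mulrC.
  have H : N%:R ^+ N / N`!%:R <= expR (1:R) ^+ N.
    rewrite -expRM_natl mulr1; case: N => [|N]; first by rewrite expr0 fact0 divr1 expR0.
    by apply: le_trans (expR_ge1Dxn N (ler0n R N.+1)); rewrite lerDr.
  apply: le_trans (_ : (C * t) ^+ N * expR 1 ^+ N <= _).
    by rewrite ler_wpM2l// exprn_ge0// mulr_ge0.
  rewrite -exprMn; apply: lerXn2r; rewrite ?nnegrE ?divr_ge0//.
    by rewrite !mulr_ge0 ?expR_ge0.
  apply: le_trans hC; rewrite mulrAC; apply: ler_wpM2l; last exact: ltW.
  by rewrite mulr_ge0 ?expR_ge0.
apply/eqP; rewrite -normr_eq0; apply/eqP/le_anti; rewrite normr_ge0 andbT leNgt; apply/negP => g0.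
pose N := Num.truncn (M / `|g 0%N t|).
have h1 : M < N.+1%:R * `|g 0%N t| by rewrite -ltr_pdivrMr// truncnS_gt.
have := B N.+1; rewrite leNgt => /negP; apply.
rewrite expr_div_n expr1n mulrA mulr1 ltr_pdivrMr ?exprn_gt0//.
apply: lt_le_trans h1 _; rewrite mulrC ler_wpM2l//.
by rewrite -natrX ler_nat ltnW// ltn_expl.
Qed.

Lemma vanish_sym (g : nat -> R -> R) (M C rho c : R) :
  (forall k (z : R), is_derive z (1:R) (g k) (g k.+1 z)) -> 0 < rho -> 0 <= C ->
  (forall z, `|z| < rho -> g 0%N z = 0) ->
  (forall k z, `|z| < c -> `|g k z| <= M * (C * k%:R) ^+ k) ->
  C * expR 1 * c <= 1 / 2 -> forall t, `|t| < c -> g 0%N t = 0.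
Proof.
move=> dg rho0 C0 g00 hM hC t tc.
have [t0|t0] := leP 0 t.
  apply: (@vanish_pos g M C rho c) => //; last by rewrite t0/= -[t]ger0_norm.
  by move=> k z /andP[z0 zc]; apply: hM; rewrite ger0_norm.
rewrite -[t]opprK.
have := @vanish_pos (fun k z => (-1) ^+ k * g k (- z)) M C rho c.
move=> H; rewrite -[LHS]mul1r -[in LHS](expr0 (-1)); apply: H => //.
- move=> k z; rewrite exprS mulN1r mulNr -mulrN.
  apply: is_deriveZ.
  have := @is_derive_affine R (g k) (g k.+1) (-1) 0 z (dg k).
  rewrite !mulN1r addr0 (_ : (fun t => g k (-1 * t + 0)) = fun t => g k (- t))//.
  by apply/funext => s; rewrite mulN1r addr0.
- by move=> z zr; rewrite expr0 mul1r g00// normrN.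
- move=> k z /andP[z0 zc]; rewrite normrM normrX normrN normr1 expr1n mul1r.
  by apply: hM; rewrite normrN ger0_norm.
- by rewrite oppr_ge0 ltW//= -ltr0_norm.
Qed.
End taylor_bounds.

(** * The maximum principle and Bernstein's estimate *)

Section maximum_principle.
Context {R : realType}.
Implicit Types n : nat.

Lemma is_derive_line n (f : 'rV[R]_n -> R) i x (t : R) : smooth f ->
  is_derive t (1:R) (fun s : R => f (s *: delta_mx 0 i + x)) (pderiv i f (t *: delta_mx 0 i + x)).
Proof.
move=> sf; apply: DeriveDef; first by rewrite derivable_line; exact: smooth_derivable.
by rewrite -derive1E derive_line.
Qed.

Lemma pderivMs n (f g : 'rV[R]_n -> R) i : smooth f -> smooth g ->
  pderiv i (fun x => f x * g x) = (fun x => pderiv i f x * g x + f x * pderiv i g x).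
Proof. by move=> sf sg; apply: pderivM => x; exact: smooth_derivable. Qed.

Lemma pderivDs n (f g : 'rV[R]_n -> R) i : smooth f -> smooth g ->
  pderiv i (fun x => f x + g x) = (fun x => pderiv i f x + pderiv i g x).
Proof. by move=> sf sg; apply: pderivD => x; exact: smooth_derivable. Qed.

Lemma pderivM2 n (f g : 'rV[R]_n -> R) i x : smooth f -> smooth g ->
  pderiv i (pderiv i (fun x => f x * g x)) x =
  pderiv i (pderiv i f) x * g x + 2 * pderiv i f x * pderiv i g x + f x * pderiv i (pderiv i g) x.
Proof.
move=> sf sg; have sf' := smooth_pderiv i sf; have sg' := smooth_pderiv i sg.
rewrite (pderivMs i sf sg) (pderivDs i (smoothM sf' sg) (smoothM sf sg')).
rewrite (pderivMs i sf' sg) (pderivMs i sf sg') /=.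
move: (pderiv i (pderiv i f) x) (pderiv i (pderiv i g) x) (pderiv i f x) (pderiv i g x) (f x) (g x).
by move=> *; ring.
Qed.

Lemma pderiv_cstM n (c : R) (f : 'rV[R]_n -> R) i : smooth f ->
  pderiv i (fun x => c * f x) = (fun x => c * pderiv i f x).
Proof.
move=> sf; rewrite pderivMs//; last exact: smooth_cst.
by apply/funext => x; rewrite pderiv_cst mul0r add0r.
Qed.

Lemma pderiv_sum n (I : Type) (s : seq I) (F : I -> 'rV[R]_n -> R) i :
  (forall j, smooth (F j)) ->
  pderiv i (fun x => \sum_(j <- s) F j x) = fun x => \sum_(j <- s) pderiv i (F j) x.
Proof.
move=> sF; elim: s => [|j s IH].
  rewrite (_ : (fun _ => _) = fun=> 0) ?pderiv_cst; apply/funext => x; by rewrite big_nil.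
rewrite (_ : (fun _ => _) = fun x => F j x + \sum_(i <- s) F i x); last by apply/funext => x; rewrite big_cons.
rewrite pderivDs//; last exact: smooth_sum.
by apply/funext => x; rewrite big_cons IH.
Qed.

Lemma laplace_max n (P : 'rV[R]_n -> R) (x : 'rV[R]_n) (e : R) i : smooth P -> 0 < e ->
  (forall y, ball x e y -> P y <= P x) -> pderiv i (pderiv i P) x <= 0.
Proof.
move=> sP e0 hmax.
have h1 t := is_derive_line i x t sP.
have h2 := is_derive_line i x 0 (smooth_pderiv i sP).
rewrite scale0r add0r in h2.
apply: (second_derivative_max e0 h1 h2) => t te; rewrite scale0r add0r; apply: hmax.
apply/ball_rowE; split=> // j; rewrite !mxE eqxx/=.
rewrite opprD addrCA subrr addr0 normrN.
by case: (j == i); rewrite ?mulr1// mulr0 normr0.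
Qed.

(* The square of the Euclidean distance, [`|x|] being the sup norm. *)
Definition dist2 n (p x : 'rV[R]_n) : R := \sum_(i < n) (x 0 i - p 0 i) ^+ 2.

Let smooth_c n (p : 'rV[R]_n) j : smooth (fun x : 'rV[R]_n => x 0 j - p 0 j).
Proof.
apply: smoothD; last exact: smooth_cst.
apply: (@smooth_coord R n j (fun k t => if k is 0%N then t else if k is 1%N then 1 else 0)).
case=> [|[|k]] z.
- exact: is_derive_id.
- exact: is_derive_cst.
- exact: is_derive_cst.
Qed.

Let pderiv_c n (p : 'rV[R]_n) i j :
  pderiv i (fun x : 'rV[R]_n => x 0 j - p 0 j) = fun=> (j == i)%:R.
Proof.
have H (z : R) : is_derive z (1:R) (fun t : R => t - p 0 j) 1.
  by apply: is_derive_eq; rewrite oppr0 addr0.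
have -> := @pderiv_coord R n j i (fun t => t - p 0 j) (fun=> 1) H.
by apply/funext => x; rewrite mulr1.
Qed.

Lemma smooth_dist2 n (p : 'rV[R]_n) : smooth (dist2 p).
Proof.
rewrite /dist2; apply: smooth_sum => j.
rewrite (_ : (fun _ => _) = fun x : 'rV[R]_n => (x 0 j - p 0 j) * (x 0 j - p 0 j)); last first.
  by apply/funext => x; rewrite expr2.
by apply: smoothM; exact: smooth_c.
Qed.

Lemma pderiv_dist2 n (p : 'rV[R]_n) i : pderiv i (dist2 p) = fun x => 2 * (x 0 i - p 0 i).
Proof.
have -> : dist2 p = fun x => \sum_(j < n) (x 0 j - p 0 j) * (x 0 j - p 0 j).
  by apply/funext => x; apply: eq_bigr => j _; rewrite expr2.
rewrite pderiv_sum; last by move=> j; apply: smoothM; exact: smooth_c.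
apply/funext => x; rewrite (bigD1 i)//= big1 ?addr0.
  by rewrite (pderivMs i (smooth_c p i) (smooth_c p i)) pderiv_c eqxx mul1r mulr1 mulr_natl.
by move=> j /negbTE ji; rewrite (pderivMs i (smooth_c p j) (smooth_c p j)) pderiv_c ji mul0r mulr0 addr0.
Qed.

Lemma pderiv2_dist2 n (p : 'rV[R]_n) i x : pderiv i (pderiv i (dist2 p)) x = 2.
Proof.
by rewrite pderiv_dist2 (pderiv_cstM 2 i (smooth_c p i)) pderiv_c eqxx mulr1.
Qed.

Lemma dist2_ge n (p x : 'rV[R]_n) i : (x 0 i - p 0 i) ^+ 2 <= dist2 p x.
Proof. by rewrite /dist2 (bigD1 i)//= lerDl sumr_ge0// => j _; exact: sqr_ge0. Qed.

Lemma ball_of_dist2 n (p x : 'rV[R]_n) h r : 0 < h -> h < r -> dist2 p x <= h ^+ 2 -> ball p r x.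
Proof.
move=> h0 hr hx; apply/ball_rowE; split; first exact: lt_trans hr.
move=> i; apply: le_lt_trans hr; rewrite distrC.
rewrite -(@ler_pXn2r _ 2)// ?nnegrE ?(ltW h0)// real_normK ?num_real//.
exact: le_trans (dist2_ge _ _ i) hx.
Qed.

Lemma bernstein_algebra n (z g f A lambda q : R) (d G F D : 'I_n -> R) j :
  (forall i, 2 * z * g ^+ 2 * (- q * 2) - 6 * (- q * (2 * d i)) ^+ 2 * g ^+ 2
   + 2 * z ^+ 2 * g * G i + 2 * A * f * F i + 2 * A * (D i) ^+ 2 <= 0) ->
  \sum_(i < n) G i = - lambda * g -> \sum_(i < n) F i = - lambda * f -> g = D j ->
  (\sum_(i < n) d i ^+ 2) * q <= 1 -> 0 <= z -> z <= 1 -> 0 <= q ->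
  A = lambda + 1 + (2 * n%:R + 12) * q -> 0 <= lambda ->
  g ^+ 2 <= A * lambda * f ^+ 2.
Proof.
move=> T SG SF gD Sd z0 z1 q0 EA l0.
have A0 : 0 <= A by rewrite EA !addr_ge0// mulr_ge0// addr_ge0// mulr_ge0.
have : \sum_(i < n) (2 * z * g ^+ 2 * (- q * 2) - 6 * (- q * (2 * d i)) ^+ 2 * g ^+ 2
   + 2 * z ^+ 2 * g * G i + 2 * A * f * F i + 2 * A * (D i) ^+ 2) <= 0.
  by apply: sumr_le0 => i _; exact: T.
have -> : \sum_(i < n) (2 * z * g ^+ 2 * (- q * 2) - 6 * (- q * (2 * d i)) ^+ 2 * g ^+ 2
   + 2 * z ^+ 2 * g * G i + 2 * A * f * F i + 2 * A * (D i) ^+ 2) =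
   - 4 * n%:R * q * z * g ^+ 2 - 24 * q ^+ 2 * g ^+ 2 * (\sum_(i < n) d i ^+ 2)
   + 2 * z ^+ 2 * g * (\sum_(i < n) G i) + 2 * A * f * (\sum_(i < n) F i)
   + 2 * A * (\sum_(i < n) D i ^+ 2).
  rewrite !big_split/= sumr_const card_ord -[_ *+ n]mulr_natr.
  rewrite -!mulr_sumr sumrN; congr (_ + _ + _ + _ + _); first by ring.
  by congr (- _); rewrite mulr_sumr; apply: eq_bigr => i _; ring.
have SD : g ^+ 2 <= \sum_(i < n) D i ^+ 2.
  by rewrite gD (bigD1 j)//= lerDl sumr_ge0// => i _; exact: sqr_ge0.
rewrite SG SF; move: (\sum_(i < n) d i ^+ 2) (\sum_(i < n) D i ^+ 2) Sd SD => s1 s2 Sd SD H.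
have g20 : 0 <= g ^+ 2 := sqr_ge0 g.
have h1 : 4 * n%:R * q * z * g ^+ 2 <= 4 * n%:R * q * g ^+ 2.
  by rewrite -!mulrA ler_wpM2l// ler_wpM2l// ler_wpM2l// ler_piMl.
have h2 : 24 * q ^+ 2 * g ^+ 2 * s1 <= 24 * q * g ^+ 2.
  have -> : 24 * q ^+ 2 * g ^+ 2 * s1 = (24 * q * g ^+ 2) * (s1 * q) by ring.
  by rewrite ler_piMr// mulr_ge0// mulr_ge0.
have h3 : 2 * z ^+ 2 * lambda * g ^+ 2 <= 2 * lambda * g ^+ 2.
  have -> : 2 * z ^+ 2 * lambda * g ^+ 2 = (2 * lambda * g ^+ 2) * z ^+ 2 by ring.
  by rewrite ler_piMr// ?exprn_ile1// mulr_ge0// mulr_ge0.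
have h4 : 2 * A * g ^+ 2 <= 2 * A * s2 by rewrite ler_wpM2l// mulr_ge0.
have h5 : 2 * A * g ^+ 2 = 2 * lambda * g ^+ 2 + 2 * g ^+ 2 + 4 * n%:R * q * g ^+ 2 + 24 * q * g ^+ 2.
  by rewrite EA; ring.
have h6 : 2 * z ^+ 2 * g * (- lambda * g) = - (2 * z ^+ 2 * lambda * g ^+ 2) by ring.
have h7 : 2 * A * f * (- lambda * f) = - 2 * (A * lambda * f ^+ 2) by ring.
move: H; rewrite h6 h7 !mulNr; lra.
Qed.

(* Bernstein: apply the maximum principle to zeta^2 g^2 + A f^2, where
   zeta = 1 - |x - p|^2 / h^2. *)
Lemma bernstein n (f : 'rV[R]_n -> R) (j : 'I_n) (p : 'rV[R]_n) (lambda h r M : R) :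
  smooth f -> 0 <= lambda -> 0 < h -> h < r ->
  (forall x, ball p r x -> \sum_(i < n) pderiv i (pderiv i f) x = - lambda * f x) ->
  (forall x, ball p r x -> \sum_(i < n) pderiv i (pderiv i (pderiv j f)) x = - lambda * pderiv j f x) ->
  (forall x, ball p r x -> `|f x| <= M) ->
  (pderiv j f p) ^+ 2 <= (lambda + 1 + (2 * n%:R + 12) / h ^+ 2) * (lambda + 1) * M ^+ 2.
Proof.
move=> sf l0 h0 hr hf hg hM.
pose g := pderiv j f; have sg : smooth g by exact: smooth_pderiv.
pose A := lambda + 1 + (2 * n%:R + 12) / h ^+ 2.
have h20 : 0 < h ^+ 2 by rewrite exprn_gt0.
have A0 : 0 < A.
  rewrite /A; apply: ltr_pwDl; first lra.
  by rewrite divr_ge0 ?ltW// addr_ge0// mulr_ge0.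
pose z x := 1 + - (h ^+ 2)^-1 * dist2 p x.
have sz : smooth z.
  apply: smoothD; first exact: smooth_cst.
  by apply: smoothM; [exact: smooth_cst|exact: smooth_dist2].
have dz i x : pderiv i z x = - (h ^+ 2)^-1 * (2 * (x 0 i - p 0 i)).
  rewrite /z pderivDs; [|exact: smooth_cst|by apply: smoothM; [exact: smooth_cst|exact: smooth_dist2]].
  by rewrite pderiv_cst add0r pderiv_cstM ?pderiv_dist2//; exact: smooth_dist2.
have ddz i x : pderiv i (pderiv i z) x = - (h ^+ 2)^-1 * 2.
  rewrite (_ : pderiv i z = fun x => - (h ^+ 2)^-1 * pderiv i (dist2 p) x).
    by rewrite pderiv_cstM ?pderiv2_dist2//; apply: smooth_pderiv; exact: smooth_dist2.
  by apply/funext => y; rewrite dz pderiv_dist2.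
pose w x := z x * g x.
have sw : smooth w by exact: smoothM.
pose P x := w x * w x + A * (f x * f x).
have sff : smooth (fun x => f x * f x) by exact: smoothM.
have sP : smooth P.
  by apply: smoothD; [exact: smoothM|apply: smoothM => //; exact: smooth_cst].
pose K := [set x | dist2 p x <= h ^+ 2].
have Kp : K p by rewrite /K/= /dist2 big1 ?ltW// => i _; rewrite subrr expr0n.
have cK : compact K.
  apply: bounded_closed_compact.
    exists (`|p| + r); split; first exact: num_real.
    move=> t pt x /= Kx; have := ball_of_dist2 h0 hr Kx; rewrite -ball_normE/= => xr.
    have -> : x = p - (p - x) by rewrite opprB addrC subrK.
    by apply: le_trans (ler_normB _ _) _; apply: le_trans (ltW pt); rewrite lerD2l ltW.
  apply: (@preimage_closed _ _ (dist2 p) [set t | t <= h ^+ 2]); last exact: closed_le.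
  by move=> x _; apply: smooth_cont; exact: smooth_dist2.
have [xm xmK xmP] := EVT_max_rV (ex_intro _ p Kp) cK (continuous_subspaceT (smooth_cont sP)).
move: xmK => /set_mem Kxm.
have zp : z p = 1.
  by rewrite /z /dist2 big1 ?mulr0 ?addr0// => i _; rewrite subrr expr0n.
have z0 x : K x -> 0 <= z x.
  by move=> Kx; rewrite /z mulNr subr_ge0 mulrC ler_pdivrMr// mul1r.
have z1 x : z x <= 1.
  rewrite /z mulNr lerBlDr lerDl; apply: mulr_ge0; first by rewrite invr_ge0 ltW.
  by rewrite /dist2 sumr_ge0// => i _; exact: sqr_ge0.
have fM : (f xm) ^+ 2 <= M ^+ 2.
  have h1 := hM _ (ball_of_dist2 h0 hr Kxm).
  by rewrite -[f xm ^+ 2]real_normK ?num_real// lerXn2r ?nnegrE// (le_trans _ h1).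
(* Since zeta is 1 at p, [P p] bounds the square of the derivative. The factor [lambda + 1] adds the
   term [A f^2] of P to the bound [A lambda f^2] obtained for g^2. *)
suff Pxm : P xm <= A * (lambda + 1) * M ^+ 2.
  apply: le_trans Pxm.
  apply: le_trans (xmP p (mem_set Kp)).
  rewrite /P /w zp mul1r -!expr2 lerDl mulr_ge0 ?sqr_ge0// ltW//.
(* On the boundary of K the factor zeta is 0, and only [A f^2] remains to be bounded. *)
have [Kb|Kb] := eqVneq (dist2 p xm) (h ^+ 2).
  have zm : z xm = 0 by rewrite /z Kb mulNr mulVf ?subrr// lt0r_neq0.
  rewrite /P /w zm !mul0r add0r -expr2 -mulrA; apply: (ler_wpM2l (ltW A0)).
  apply: le_trans fM _; rewrite ler_peMl ?sqr_ge0//; lra.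
have Ki : dist2 p xm < h ^+ 2 by rewrite lt_neqAle Kb.
have [e e0 he] : exists2 e, 0 < e & forall y, ball xm e y -> K y.
  have : nbhs xm [set y | dist2 p y < h ^+ 2].
    apply: open_nbhs_nbhs; split => //.
    apply: (@open_comp _ _ (dist2 p) [set t | t < h ^+ 2]); last exact: open_lt.
    by move=> x _; apply: smooth_cont; exact: smooth_dist2.
  move=> /nbhs_ballP[e /= e0 he]; exists e => // y /he /= /ltW; exact.
have lap i : pderiv i (pderiv i P) xm <= 0.
  apply: (laplace_max _ sP e0) => y /he Ky; exact: xmP (mem_set Ky).
have Ti i : 2 * z xm * g xm ^+ 2 * (- (h ^+ 2)^-1 * 2)
   - 6 * (- (h ^+ 2)^-1 * (2 * (xm 0 i - p 0 i))) ^+ 2 * g xm ^+ 2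
   + 2 * z xm ^+ 2 * g xm * pderiv i (pderiv i g) xm
   + 2 * A * f xm * pderiv i (pderiv i f) xm + 2 * A * (pderiv i f xm) ^+ 2 <= 0.
  apply: le_trans (lap i).
  rewrite /P pderivDs; [|exact: smoothM|by apply: smoothM => //; exact: smooth_cst].
  rewrite pderivDs; [|by apply: smooth_pderiv; exact: smoothM|
      by apply: smooth_pderiv; apply: smoothM => //; exact: smooth_cst].
  have -> := pderiv_cstM A i sff.
  have -> := pderiv_cstM A i (smooth_pderiv i sff).
  rewrite (pderivM2 i xm sw sw) (pderivM2 i xm sf sf).
  have -> : pderiv i (pderiv i w) xm = pderiv i (pderiv i z) xm * g xm +
     2 * pderiv i z xm * pderiv i g xm + z xm * pderiv i (pderiv i g) xm.
    exact: pderivM2.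
  have -> : pderiv i w xm = pderiv i z xm * g xm + z xm * pderiv i g xm.
    by rewrite /w (pderivMs i sz sg).
  rewrite /w ddz dz -subr_ge0.
  set a := pderiv i g xm; set z' := - (h ^+ 2)^-1 * (2 * _).
  (* The terms of the second derivative that contain [pderiv i g] to the first or second order are
     completed to this square, which [bernstein_algebra] drops; the completion is the origin of its
     coefficient -6. *)
  have H (X : R) : X = 2 * (z xm * a + 2 * z' * g xm) ^+ 2 -> 0 <= X.
    by move=> ->; rewrite mulr_ge0// sqr_ge0.
  move: H; move: a z' (pderiv i (pderiv i g) xm) (pderiv i (pderiv i f) xm) (pderiv i f xm) (g xm) (z xm) (f xm).
  by move=> a z' b c d e' f' k H; apply: H; ring.
have key : g xm ^+ 2 <= A * lambda * f xm ^+ 2.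
  apply: (bernstein_algebra Ti (hg _ _) (hf _ _) (erefl : g xm = pderiv j f xm)).
  - exact: ball_of_dist2 Kxm.
  - exact: ball_of_dist2 Kxm.
  - by rewrite ler_pdivrMr// mul1r.
  - exact: z0.
  - exact: z1.
  - by rewrite invr_ge0 ltW.
  - by [].
  - by [].
rewrite /P /w -!expr2 exprMn.
apply: le_trans (_ : g xm ^+ 2 + A * f xm ^+ 2 <= _).
  by rewrite lerD2r ler_piMl ?sqr_ge0// exprn_ile1//; exact: z0.
apply: le_trans (_ : A * (lambda + 1) * f xm ^+ 2 <= _).
  by apply: le_trans (lerD key (lexx _)) _; rewrite mulrDr mulr1 mulrDl.
by apply: ler_wpM2l fM; rewrite mulr_ge0 ?(ltW A0)// addr_ge0.
Qed.
End maximum_principle.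

(** * Analyticity bounds and local propagation of zeros *)

Section local_continuation.
Context {R : realType}.
Implicit Types n : nat.
Notation L n := (L1 (@leb R n)).

(** For [h <= 1] the constant in [bernstein] is at most [(ucp_const n lambda / h)^2]: one derivative
    costs a factor [ucp_const n lambda / h]. *)
Definition ucp_const n (lambda : R) : R := Num.sqrt ((lambda + 2 * n%:R + 13) * (lambda + 1)).

Lemma ucp_const_ge1 n lambda : 0 <= lambda -> 1 <= ucp_const n lambda.
Proof.
move=> l0; rewrite -sqrtr1 /ucp_const ler_sqrt.
  have : 0 <= n%:R :> R by [].
  move: (n%:R : R) => m m0.
  have : 0 <= (lambda + 2 * m + 12) * (lambda + 1) by rewrite mulr_ge0//; lra.
  by lra.
have : 0 <= n%:R :> R by [].
by move=> ?; rewrite mulr_ge0//; lra.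
Qed.

Lemma ball_triangle_sub n (p y x : 'rV[R]_n) a b c : a + b <= c -> ball p a y -> ball y b x -> ball p c x.
Proof. by move=> abc pa yb; apply: le_ball abc _ _; exact: ball_triangle yb. Qed.

(** Each derivative spends 2 h of the radius, because [bernstein] with the Euclidean radius h wants
    a ball of the sup norm of strictly larger radius, here 2 h. *)
Lemma iterated_bernstein n (F : nat -> 'rV[R]_n -> R) (i : 'I_n) (p : 'rV[R]_n) (lambda h r M : R) :
  0 <= lambda -> 0 < h -> h <= 1 ->
  (forall k, smooth (F k)) -> (forall k, F k.+1 = pderiv i (F k)) ->
  (forall k x, ball p r x -> \sum_(j < n) pderiv j (pderiv j (F k)) x = - lambda * F k x) ->
  (forall x, ball p r x -> `|F 0%N x| <= M) ->
  forall k x, ball p (r - 2 * h * k%:R) x -> `|F k x| <= (ucp_const n lambda / h) ^+ k * M.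
Proof.
move=> l0 h0 h1 sF FS hF hM.
have C1 := ucp_const_ge1 n l0.
elim=> [|k IH] x; first by rewrite mulr0 subr0 expr0 mul1r; exact: hM.
move=> px.
have sub y : ball x (2 * h) y -> ball p (r - 2 * h * k%:R) y.
  apply: ball_triangle_sub px; rewrite mulrSr; lra.
have sub' y : ball x (2 * h) y -> ball p r y.
  move=> /sub; apply: le_ball; rewrite gerBl mulr_ge0//; lra.
have h2 : h < 2 * h by lra.
have := @bernstein R n (F k) i x lambda h (2 * h) _ (sF k) l0 h0 h2 _ _ (fun y yx => IH y (sub y yx)).
rewrite -FS => /(_ (fun y yx => hF k y (sub' y yx)) (fun y yx => hF k.+1 y (sub' y yx))) B.
have M0 : 0 <= M.
  have := hM x; have : ball p r x by apply: sub'; apply: ballxx; lra.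
  by move=> /[swap] /[apply]; apply: le_trans.
have c0 : 0 <= ucp_const n lambda / h by rewrite divr_ge0 ?(ltW h0)//; lra.
rewrite -(@ler_pXn2r _ 2)// ?nnegrE ?mulr_ge0 ?exprn_ge0// real_normK ?num_real//.
apply: le_trans B _; rewrite [(_ / h) ^+ k.+1]exprS -[_ * _ * M]mulrA [X in _ <= X]exprMn.
apply: ler_wpM2r; first by rewrite sqr_ge0.
rewrite expr_div_n sqr_sqrtr; last by have ? : 0 <= n%:R :> R by []; rewrite mulr_ge0//; lra.
rewrite mulrAC; apply: ler_wpM2r; first by lra.
have h20 : 0 < h ^+ 2 by rewrite exprn_gt0.
rewrite ler_pdivlMr// mulrDl divfK ?lt0r_neq0//.
have : (lambda + 1) * h ^+ 2 <= (lambda + 1) by rewrite ler_piMr ?exprn_ile1 ?(ltW h0)//; lra.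
lra.
Qed.

(* The class P stands for the translates of one solution tested against the
   iterated derivatives of a bump function. *)
Lemma local_ucp n (P : ('rV[R]_n -> R) -> Prop) (p : 'rV[R]_n) (lambda r rho : R) :
  0 <= lambda -> 0 < r -> r <= 1 -> 0 < rho ->
  (forall f, P f -> smooth f) -> (forall f i, P f -> P (pderiv i f)) ->
  (forall f x, P f -> ball p r x -> \sum_(j < n) pderiv j (pderiv j f) x = - lambda * f x) ->
  (forall f, P f -> exists M : R, forall x, `|f x| <= M) ->
  forall f, P f -> (forall x, ball p rho x -> f x = 0) ->
  forall x, ball p (r / (8 * expR 1 * ucp_const n lambda)) x -> f x = 0.
Proof.
move=> l0 r0 r1 rho0 Ps Pd Ph Pb f Pf f0.
set c := r / _.
have C1 := ucp_const_ge1 n l0.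
have e1 : 1 <= expR 1 :> R by have := expR_ge1Dx (1:R); lra.
have eC : 1 <= expR 1 * ucp_const n lambda by apply: le_trans (ler_pM _ _ e1 C1); rewrite ?mulr1.
have c0 : 0 < c.
  by rewrite /c divr_gt0// -mulrA mulr_gt0//; lra.
have cr : c <= r / 2.
  rewrite /c ler_pM2l// lef_pV2 ?posrE//; last by rewrite -mulrA; lra.
  by rewrite -mulrA; lra.
(* The coordinates of index below m are free in the ball of radius c, the others remain within rho
   of p. Passing from m to m + 1 frees one coordinate by a Taylor argument along its axis. *)
suff H m : forall x, ball p c x -> (forall i : 'I_n, (m <= i)%N -> `|p 0 i - x 0 i| < rho) -> f x = 0.
  by move=> x px; apply: (H n x px) => i; rewrite leqNgt ltn_ord.
elim: m => [|m IH] x /ball_rowE[_ px] hx.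
  by apply: f0; apply/ball_rowE; split=> // i; exact: hx.
have [mn|mn] := ltnP m n; last first.
  by apply: IH => [|i mi]; [exact/ball_rowE|have := ltn_ord i; rewrite ltnNge (leq_trans mn)].
pose i0 := Ordinal mn.
(* The point x with the coordinate [i0] reset to that of p; [g k] below is the k-th derivative of f
   along the axis through it. *)
pose x0 : 'rV[R]_n := x + (p 0 i0 - x 0 i0) *: delta_mx 0 i0.
pose F k := iter k (pderiv i0) f.
have PF k : P (F k) by elim: k => //= k; exact: Pd.
have [M hM] := Pb f Pf.
pose g k (t : R) := F k (t *: delta_mx 0 i0 + x0).
have xE : x = (x 0 i0 - p 0 i0) *: delta_mx 0 i0 + x0.
  have E0 : (x 0 i0 - p 0 i0) + (p 0 i0 - x 0 i0) = 0 by ring.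
  by rewrite /x0 addrCA -scalerDl E0 scale0r addr0.
have coordE t (i : 'I_n) : (t *: delta_mx 0 i0 + x0) 0 i = if i == i0 then p 0 i0 + t else x 0 i.
  rewrite !mxE eqxx /=; case: eqP => [->|_]; last by rewrite !mulr0 add0r addr0.
  by rewrite !mulr1; ring.
have inball t : `|t| < c -> ball p c (t *: delta_mx 0 i0 + x0).
  move=> tc; apply/ball_rowE; split=> // i; rewrite coordE; case: eqP => [->|_]; last exact: px.
  by rewrite opprD addrA subrr add0r normrN.
rewrite xE -/(g 0%N (x 0 i0 - p 0 i0)).
(* With the constant [4 * ucp_const n lambda / r], the value of c gives exactly 1 / 2 in the
   smallness condition; this is the origin of the 8 in c. *)
apply: (@vanish_sym R g M (4 * ucp_const n lambda / r) (Num.min rho c) c).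
- by move=> k z; apply: is_derive_line; exact: Ps.
- by rewrite lt_min rho0.
- by rewrite divr_ge0 ?(ltW r0)//; lra.
- move=> t; rewrite lt_min => /andP[tr tc]; apply: IH; first exact: inball.
  move=> i mi; rewrite coordE; case: eqP => [->|/eqP ii0].
    by rewrite opprD addrA subrr add0r normrN.
  apply: hx; rewrite ltn_neqAle mi andbT; apply: contra ii0 => /eqP E.
  by apply/eqP/val_inj; rewrite /= E.
- move=> k t tc; case: k => [|k]; first by rewrite expr0 mulr1; exact: hM.
  (* The order is [k.+1]. With this h the derivatives spend r / 2 of the radius in all, so the bound
     holds on the ball of radius r / 2, which contains the ball of radius c. *)
  pose h := r / (4 * k.+1%:R).
  have k0 : 0 < k.+1%:R :> R by [].
  have k1 : 1 <= k.+1%:R :> R by rewrite ler1n.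
  have h0 : 0 < h by rewrite divr_gt0// mulr_gt0.
  have h1 : h <= 1 by rewrite /h ler_pdivrMr ?mulr_gt0// mul1r; lra.
  have := @iterated_bernstein n F i0 p lambda h r M l0 h0 h1 (fun k => Ps _ (PF k))
    (fun k => erefl) (fun k x => Ph _ x (PF k)) (fun x _ => hM x) k.+1 (t *: delta_mx 0 i0 + x0).
  have -> : r - 2 * h * k.+1%:R = r / 2.
    by rewrite /h; move: (k.+1%:R : R) k0 => u u0; field; rewrite lt0r_neq0.
  move=> /(_ (le_ball cr (inball t tc))); rewrite mulrC.
  have -> : 4 * ucp_const n lambda / r * k.+1%:R = ucp_const n lambda / h.
    rewrite /h; move: (k.+1%:R : R) (ucp_const n lambda) k0 => u v u0; field.
    by rewrite !lt0r_neq0.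
  by [].
- rewrite /c; move: (ucp_const n lambda) (expR (1:R)) C1 e1 => v e' v1 e'1.
  rewrite le_eqVlt; apply/orP; left; apply/eqP; field.
  by rewrite !lt0r_neq0//; lra.
- by rewrite -normrN opprB; exact: px.
Qed.
End local_continuation.

(** * Convolution and global unique continuation *)

Section continuation.
Context {R : realType}.
Implicit Types n : nat.
Notation L n := (L1 (@leb R n)).

Lemma Ck_shift k n (f : 'rV[R]_n -> R) (a : 'rV[R]_n) : Ck k f -> Ck k (fun y => f (a + y)) .
Proof.
have D (g : 'rV[R]_n -> R) x (v : 'rV[R]_n) :
    (fun h : R => h^-1 *: (((fun y => g (a + y)) \o shift x) (h *: v) - g (a + x))) =
    (fun h : R => h^-1 *: ((g \o shift (a + x)) (h *: v) - g (a + x))).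
  by apply/funext => h /=; rewrite addrCA.
elim: k f => [|k IH] f [cf hf].
  split=> // x; apply: continuous_comp; [exact: continuous_shiftl|exact: cf].
split; first by move=> x; apply: continuous_comp; [exact: continuous_shiftl|exact: cf].
move=> i; have [df Cf] := hf i; split.
  by move=> x; rewrite /derivable D; exact: df.
rewrite (_ : pderiv i _ = fun y => pderiv i f (a + y)); first exact: IH.
by apply/funext => x; rewrite /pderiv /derive D.
Qed.

Lemma pderiv_shift n (f : 'rV[R]_n -> R) (a : 'rV[R]_n) i :
  pderiv i (fun y => f (a + y)) = fun y => pderiv i f (a + y).
Proof.
apply/funext => x; rewrite /pderiv /derive.
set F := fun h : R => _; set G := fun h : R => _.
by suff -> : F = G by []; apply/funext => h; rewrite /F /G /= addrCA.
Qed.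

Lemma test_shift n (D D' : set 'rV[R]_n) psi a : test_function D psi ->
  (forall y, D (a + y) -> D' y) -> test_function D' (fun y => psi (a + y)).
Proof.
move=> [spsi [K [cK KD Kpsi]]] DD'; split; first by move=> k; apply: Ck_shift; exact: spsi.
exists ((fun y => - a + y) @` K); split.
- by apply: continuous_compact => //; apply: continuous_subspaceT; exact: continuous_shiftl.
- by move=> _ [y Ky <-]; apply: DD'; rewrite addrA subrr add0r; exact: KD.
- move=> x nx; apply: Kpsi => Kx; apply: nx; exists (a + x) => //.
  by rewrite addrA addNr add0r.
Qed.

Lemma testS n (D D' : set 'rV[R]_n) psi : D `<=` D' -> test_function D psi -> test_function D' psi.
Proof. by move=> DD' [spsi [K [cK KD Kpsi]]]; split=> //; exists K; split=> // x /KD /DD'. Qed.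

(** The mean value theorem, applied while one coordinate after the other is changed, makes f
    Lipschitz with constant n M. Convolutions get from it the continuity that [Ck] demands besides
    the partial derivatives. *)
Lemma bounded_pderiv_continuous n (f : 'rV[R]_n -> R) (M : R) :
  (forall i x, derivable f x (delta_mx 0 i)) -> (forall i x, `|pderiv i f x| <= M) ->
  continuous f.
Proof.
move=> df bf.
have step i x t : `|f (t *: delta_mx 0 i + x) - f x| <= M * `|t|.
  have dl s : is_derive s (1:R) (fun s : R => f (s *: delta_mx 0 i + x)) (pderiv i f (s *: delta_mx 0 i + x)).
    by apply: DeriveDef; [rewrite derivable_line; exact: df|rewrite -derive1E derive_line].
  have [t0|t0|->] := ltgtP t 0; last by rewrite scale0r add0r subrr !normr0 mulr0.
    have [c _] := MVT_global t0 dl; rewrite scale0r add0r sub0r -[X in `|X|]opprB normrN => ->.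
    by rewrite normrM normrN ler_wpM2r.
  have [c _] := MVT_global t0 dl; rewrite scale0r add0r subr0 => ->.
  by rewrite normrM ler_wpM2r.
have M0 : 0 <= n%:R * M.
  case: (n) f bf {df step} => [|m] f bf; first by rewrite mul0r.
  by rewrite mulr_ge0//; apply: le_trans (bf ord0 0).
have lip x y : `|f x - f y| <= n%:R * M * `|x - y|.
  (* A path from y to x: the first m coordinates are already those of x. *)
  pose z m : 'rV[R]_n := \row_i if (i < m)%N then x 0 i else y 0 i.
  have H m : (m <= n)%N -> `|f (z m) - f y| <= m%:R * M * `|x - y|.
    elim: m => [_|m IH mn].
      have -> : z 0%N = y by apply/rowP => i; rewrite mxE.
      by rewrite subrr normr0 !mul0r.
    pose i0 := Ordinal mn.
    have -> : z m.+1 = (x 0 i0 - y 0 i0) *: delta_mx 0 i0 + z m.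
      apply/rowP => i; rewrite !mxE eqxx /= ltnS.
      have [->|ii] := eqVneq i i0; first by rewrite /= leqnn ltnn mulr1 subrK.
      rewrite mulr0 add0r leq_eqVlt; case: eqP => //= E.
      by move/eqP: ii; case; apply/val_inj.
    apply: le_trans (ler_distD (f (z m)) _ _) _.
    rewrite mulrSr !mulrDl mul1r addrC; apply: lerD; first exact: IH (ltnW mn).
    apply: le_trans (step _ _ _) _; apply: ler_wpM2l.
      by apply: le_trans (bf i0 0).
    by have := coord_le_norm (x - y) i0; rewrite !mxE.
  have := H n (leqnn n).
  by have -> : z n = x by apply/rowP => i; rewrite mxE ltn_ord.
move=> x; apply/(@cvgrPdist_lt R R _ (nbhs x) _ f (f x)) => e e0.
have : nbhs x (ball x (e / (n%:R * M + 1))).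
  by apply: nbhsx_ballx; rewrite divr_gt0// ltr_wpDl.
apply: filterS => y; rewrite -ball_normE/= => xy.
apply: le_lt_trans (lip _ _) _.
apply: le_lt_trans (_ : (n%:R * M + 1) * `|x - y| < e).
  by rewrite ler_wpM2r// lerDl.
by rewrite mulrC -ltr_pdivlMr// ltr_wpDl.
Qed.

(** A convolution up to a reflection: with the sum [x + y] the kernel is a translate of psi, and the
    behaviour of U near p is read at points x near -p. *)
Definition conv n (D : set 'rV[R]_n) (U psi : 'rV[R]_n -> R) (x : 'rV[R]_n) : R :=
  \int[leb n]_(y in D) (U y * psi (x + y)).

Lemma conv_L1 n (D E : set 'rV[R]_n) (U psi : 'rV[R]_n -> R) x :
  measurable D -> L n D U -> test_function E psi -> L n D (fun y => U y * psi (x + y)).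
Proof.
move=> mD LU tpsi; have [M M0 hM] := test_bounded tpsi.
apply: (@L1_mulbdd _ _ _ _ _ _ _ M) => //.
by apply: continuous_measurable_row => //; apply: smooth_cont => k; apply: Ck_shift; exact: tpsi.1.
Qed.

Lemma conv_bounded n (D E : set 'rV[R]_n) (U psi : 'rV[R]_n -> R) :
  measurable D -> L n D U -> test_function E psi -> exists M : R, forall x, `|conv D U psi x| <= M.
Proof.
move=> mD LU tpsi; have [M M0 hM] := test_bounded tpsi.
exists (\int[leb n]_(y in D) (M * `|U y|)) => x.
have LUp := conv_L1 x mD LU tpsi.
apply: le_trans (le_normr_Rintegral mD LUp) _.
apply: le_Rintegral => //; first exact: L1_norm.
  by apply: L1Z => //; exact: L1_norm.
by move=> y Dy; rewrite normrM mulrC ler_wpM2r.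
Qed.

Lemma conv_derive n (D E : set 'rV[R]_n) (U psi : 'rV[R]_n -> R) i x :
  measurable D -> L n D U -> test_function E psi ->
  derivable (conv D U psi) x (delta_mx 0 i) /\
  pderiv i (conv D U psi) x = conv D U (pderiv i psi) x.
Proof.
move=> mD LU tpsi; have [M M0 hM] := test_bounded tpsi.
have [M' M'0 hM'] := test_bounded (test_pderiv i tpsi).
pose G y := psi (x + y).
have cG : Ck 1 G by apply: Ck_shift; exact: tpsi.1.
have := @derive_int_shift R n D U G i (Num.max M M') 0 mD LU cG.
rewrite pderiv_shift => H.
have [] := H.
- by move=> y; rewrite le_max hM.
- by move=> y; rewrite le_max hM' orbT.
have -> : (fun t : R => \int[leb n]_(y in D) (U y * psi (x + (t *: delta_mx 0 i + y)))) =
          (fun t : R => conv D U psi (t *: delta_mx 0 i + x)).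
  apply/funext => t; apply: Rint_eq => y _; by rewrite addrCA addrA.
move=> h1 h2; rewrite derivable_line scale0r add0r in h1; split; first exact: h1.
rewrite -derive1E derive_line scale0r add0r in h2.
by rewrite /pderiv h2; apply: Rint_eq => y _; rewrite add0r.
Qed.

Lemma conv_pderiv n (D E : set 'rV[R]_n) (U psi : 'rV[R]_n -> R) i :
  measurable D -> L n D U -> test_function E psi ->
  pderiv i (conv D U psi) = conv D U (pderiv i psi).
Proof. by move=> mD LU tp; apply/funext => x; have [] := conv_derive i x mD LU tp. Qed.

Lemma conv_smooth n (D E : set 'rV[R]_n) (U psi : 'rV[R]_n -> R) :
  measurable D -> L n D U -> test_function E psi -> smooth (conv D U psi).
Proof.
move=> mD LU tpsi k.
have cont phi : test_function E phi -> continuous (conv D U phi).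
  move=> tphi.
  have H i : exists M : R, forall x, `|pderiv i (conv D U phi) x| <= M.
    by rewrite (conv_pderiv i mD LU tphi); apply: conv_bounded (test_pderiv i tphi).
  have [M hM] := choice H.
  apply: (@bounded_pderiv_continuous _ _ (\sum_i `|M i|)).
    by move=> i x; have [] := conv_derive i x mD LU tphi.
  move=> i x; apply: le_trans (hM i x) _; apply: le_trans (ler_norm _) _.
  by rewrite (bigD1 i)//= lerDl sumr_ge0.
elim: k psi tpsi => [|k IH] psi tpsi; first by split=> //; exact: cont.
split; first exact: cont.
move=> i; split; first by move=> x; have [] := conv_derive i x mD LU tpsi.
by rewrite (conv_pderiv i mD LU tpsi); apply: IH; exact: test_pderiv.
Qed.

Definition laplacian n (f : 'rV[R]_n -> R) (x : 'rV[R]_n) : R := \sum_(i < n) pderiv i (pderiv i f) x.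

Lemma test_laplacian n D (psi : 'rV[R]_n -> R) : test_function D psi -> test_function D (laplacian psi).
Proof.
move=> [sp [K [cK KD Kp]]]; split.
  by apply: smooth_sum => i; exact: smooth_pderiv (smooth_pderiv i sp).
exists K; split=> // x nKx; rewrite /laplacian big1// => i _.
have clK : closed K by exact: compact_closed.
by apply: (pderiv_out i clK _ nKx); exact: (pderiv_out i clK Kp).
Qed.

(** The weak solution U is replaced by the smooth functions [conv D U ph], with ph supported in a
    small ball around 0. They solve the equation and vanish near -p, and the integral of [U psi] is
    the value at -q of one of them. As ph ranges over all such test functions, the class is stable
    under derivatives, as [local_ucp] requires. *)
Lemma ucp_step n (D : set 'rV[R]_n) (U : 'rV[R]_n -> R) (p : 'rV[R]_n) (lambda r rho : R) :
  measurable D -> L n D U -> 0 <= lambda -> 0 < r -> r <= 1 -> 0 < rho ->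
  (forall psi, test_function (ball p r) psi ->
     \int[leb n]_(y in D) (U y * laplacian psi y) = - lambda * \int[leb n]_(y in D) (U y * psi y)) ->
  (forall psi, test_function (ball p rho) psi -> \int[leb n]_(y in D) (U y * psi y) = 0) ->
  forall q, ball p (r / (16 * expR 1 * ucp_const n lambda)) q ->
  exists2 delta, 0 < delta & forall psi, test_function (ball q delta) psi ->
     \int[leb n]_(y in D) (U y * psi y) = 0.
Proof.
move=> mD LU l0 r0 r1 rho0 Hh Hz q pq.
pose delta := Num.min r rho / 2.
have m0 : 0 < Num.min r rho by rewrite lt_min r0.
have d0 : 0 < delta by rewrite divr_gt0.
exists delta => // psi tpsi.
pose phi y := psi (q + y).
have tphi : test_function (ball (0 : 'rV[R]_n) delta) phi.
  apply: test_shift tpsi _ => y; rewrite ball0E -ball_normE/= opprD addrA subrr add0r normrN//.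
pose P f := exists2 ph, test_function (ball (0 : 'rV[R]_n) delta) ph & f = conv D U ph.
have loc s x (ph : 'rV[R]_n -> R) : ball (- p) s x -> test_function (ball (0 : 'rV[R]_n) delta) ph ->
    test_function (ball p (s + delta)) (fun y => ph (x + y)).
  move=> px tph; apply: test_shift tph _ => y; rewrite ball0E/= => xy.
  move: px; rewrite -!ball_normE/= => px.
  have -> : p - y = - (- p - x) - (x + y) by apply/rowP => k; rewrite !mxE; ring.
  by apply: le_lt_trans (ler_normB _ _) _; rewrite normrN ltrD.
have -> : \int[leb n]_(y in D) (U y * psi y) = conv D U phi (- q).
  by apply: Rint_eq => y _; rewrite /phi addrA subrr add0r.
(* Half of r is kept as room for the support of ph, since [delta <= r / 2]; hence the constant 16
   where [local_ucp] has 8. In the same way [delta + delta <= rho]. *)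
apply: (@local_ucp R n P (- p) lambda (r / 2) delta) => //.
- by rewrite divr_gt0.
- lra.
- by move=> _ [ph tph ->]; exact: conv_smooth tph.
- by move=> _ i [ph tph ->]; exists (pderiv i ph); [exact: test_pderiv|exact: conv_pderiv tph].
- move=> _ x [ph tph ->] px.
  have tphx := loc _ _ _ px tph.
  have tphx' : test_function (ball p r) (fun y => ph (x + y)).
    apply: testS tphx; apply: le_ball; rewrite /delta.
    have : Num.min r rho <= r by rewrite ge_min lexx.
    lra.
  rewrite /conv -(Hh _ tphx').
  under eq_bigr do rewrite (conv_pderiv _ mD LU tph) (conv_pderiv _ mD LU (test_pderiv _ tph)).
  rewrite /conv -Rint_sum//; last first.
    by move=> i; apply: conv_L1 (test_pderiv i (test_pderiv i tph)).
  apply: Rint_eq => y _; rewrite /laplacian mulr_sumr.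
  by apply: eq_bigr => i _; rewrite !pderiv_shift.
- by move=> _ [ph tph ->]; exact: conv_bounded tph.
- by exists phi.
- move=> x px; apply: Hz; apply: testS (loc _ _ _ px tphi); apply: le_ball; rewrite /delta.
  have : Num.min r rho <= rho by rewrite ge_min lexx orbT.
  lra.
- have -> : r / 2 / (8 * expR 1 * ucp_const n lambda) = r / (16 * expR 1 * ucp_const n lambda).
    have C1 := ucp_const_ge1 n l0.
    have e1 : 1 <= expR 1 :> R by have := expR_ge1Dx (1:R); lra.
    by move: (ucp_const n lambda) (expR (1:R)) C1 e1 => v e' v1 e'1; field; rewrite !lt0r_neq0//; lra.
  by move: pq; rewrite -!ball_normE/= -opprB normrN opprK addrC.
Qed.

(** The points around which U integrates to 0 against all test functions form a set Z that is
    nonempty, open, and closed in Om. Closedness uses that the reach of [ucp_step] depends on r but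
    not on the size of the neighbourhood in which U is known to vanish. *)
Lemma unique_continuation n (chi : R -> R) (Om O : set 'rV[R]_n) (U : 'rV[R]_n -> R) (lambda : R) :
  cutoff chi -> open Om -> connected Om -> (forall r, L n (Om `&` ball 0 r) U) -> 0 <= lambda ->
  (forall psi, test_function Om psi ->
     \int[leb n]_(y in Om) (U y * laplacian psi y) = - lambda * \int[leb n]_(y in Om) (U y * psi y)) ->
  open O -> O !=set0 -> O `<=` Om -> {ae leb n, forall x, O x -> U x = 0} ->
  {ae leb n, forall x, Om x -> U x = 0}.
Proof.
move=> hc oOm cOm LU l0 HU oO [x0 Ox0] OOm U0.
have LB p r : ball p r `<=` Om -> L n (ball p r) U.
  move=> pr; apply: (L1S _ _ _ (LU (`|p| + r))).
  - exact: measurable_ball_row.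
  - by apply: measurableI; [exact: open_measurable_row|exact: measurable_ball_row].
  - move=> x px; split; first exact: pr.
    rewrite ball0E/=; move: px; rewrite -ball_normE/= => px.
    have -> : x = p - (p - x) by rewrite opprB addrC subrK.
    by apply: le_lt_trans (ler_normB _ _) _; rewrite ltrD2l.
pose zero x e := forall psi, test_function (ball x e) psi -> \int[leb n]_(y in Om) (U y * psi y) = 0.
pose Z := [set x | Om x /\ exists2 e, 0 < e & zero x e].
have supp D psi : D `<=` Om -> test_function D psi ->
    \int[leb n]_(y in Om) (U y * psi y) = \int[leb n]_(y in D) (U y * psi y).
  move=> DOm [_ [K [_ KD K0]]]; apply: Rint_support => // y _ nD.
  by rewrite K0 ?mulr0// => /KD.
suff ZE : Z = Om.
  apply: ae_local => x Omx.
  have [e e0 he] := open_ballP oOm Omx.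
  have [_ [d d0 hd]] : Z x by rewrite ZE.
  pose s := Num.min e d.
  have s0 : 0 < s by rewrite lt_min e0.
  have sOm : ball x s `<=` Om.
    by move=> y xy; apply: he; apply: le_ball xy; rewrite ge_min lexx.
  have os : open (ball x s) by exact: ball_open.
  exists s => //; apply: (@du_Bois_Reymond R n chi (ball x s) U hc os).
    move=> r; apply: (L1S _ _ _ (LB x s sOm)).
    - by apply: measurableI; exact: measurable_ball_row.
    - exact: measurable_ball_row.
    - by move=> y [].
  move=> psi tpsi; rewrite -(supp (ball x s))//; apply: hd; apply: testS tpsi.
  by apply: le_ball; rewrite ge_min lexx orbT.
apply: cOm.
- exists x0; split; first exact: OOm.
  have [e e0 he] := open_ballP oO Ox0.
  exists e => // psi tpsi.
  have eOm : ball x0 e `<=` Om by move=> y /he /OOm.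
  rewrite (supp (ball x0 e))// -(Rint_0 (leb n) (measurable_ball_row x0 e)).
  apply: Rint_ae => //; first exact: measurable_ball_row.
    apply: measurable_funM; first exact: L1_measurable (LB _ _ eOm).
    by apply: continuous_measurable_row; [apply: smooth_cont tpsi.1|exact: measurable_ball_row].
  by apply: filterS U0 => y hy ey; rewrite hy ?mul0r//; exact: he.
- exists [set x | exists2 e, 0 < e & zero x e]; last by [].
  rewrite openE => x [e e0 he] /=.
  apply/nbhs_ballP; exists (e / 2); first by rewrite /= divr_gt0.
  move=> y xy; exists (e / 2); first by rewrite divr_gt0.
  move=> psi tpsi; apply: he; apply: testS tpsi.
  by move=> z; apply: ball_triangle_sub xy; lra.
- exists (closure Z); first exact: closed_closure.
  apply/seteqP; split=> [x Zx|x [Omx cZx]]; first by split; [case: Zx|exact: subset_closure].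
  have [e e0 he] := open_ballP oOm Omx.
  pose r := Num.min (e / 2) 1.
  have r0 : 0 < r by rewrite lt_min ltr01 divr_gt0.
  have r1 : r <= 1 by rewrite ge_min lexx orbT.
  have re : r + r <= e.
    have : r <= e / 2 by rewrite ge_min lexx.
    lra.
  have C1 := ucp_const_ge1 n l0.
  have e1 : 1 <= expR 1 :> R by have := expR_ge1Dx (1:R); lra.
  have eC : 1 <= expR 1 * ucp_const n lambda by apply: le_trans (ler_pM _ _ e1 C1); rewrite ?mulr1.
  pose c := r / (16 * expR 1 * ucp_const n lambda).
  have c0 : 0 < c by rewrite divr_gt0// -mulrA; lra.
  have cr : c <= r / 2.
    rewrite /c ler_pdivrMr -?mulrA; last lra.
    by rewrite ler_peMr ?(ltW r0)//; lra.
  (* Since c is fixed before p is chosen, a point p of Z within c of x has x within its own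
     reach. *)
  have [p [[Omp [d d0 hd]] xp]] := cZx (ball x c) (nbhsx_ballx _ _ c0).
  have prOm : ball p r `<=` Om.
    by move=> y py; apply: he; apply: ball_triangle_sub xp py; lra.
  have m0 : 0 < Num.min r d by rewrite lt_min r0.
  have Hh psi : test_function (ball p r) psi -> \int[leb n]_(y in ball p r) (U y * laplacian psi y) =
      - lambda * \int[leb n]_(y in ball p r) (U y * psi y).
    move=> tpsi; rewrite -(supp _ _ prOm tpsi) -HU; last exact: testS tpsi.
    symmetry; apply: Rint_support => // y _ nD.
    have [_ [K [_ KD K0]]] := test_laplacian tpsi.
    by rewrite K0 ?mulr0// => /KD.
  have Hz psi : test_function (ball p (Num.min r d)) psi ->
      \int[leb n]_(y in ball p r) (U y * psi y) = 0.
    move=> tpsi; rewrite -(supp _ _ prOm); last first.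
      by apply: testS tpsi; apply: le_ball; rewrite ge_min lexx.
    by apply: hd; apply: testS tpsi; apply: le_ball; rewrite ge_min lexx orbT.
  have [delta dl0 hdelta] := ucp_step (measurable_ball_row p r) (LB _ _ prOm) l0 r0 r1 m0 Hh Hz (ball_sym xp).
  split=> //; exists (Num.min delta (r / 2)); first by rewrite lt_min dl0 divr_gt0.
  move=> psi tpsi; have tr : test_function (ball p r) psi.
    apply: testS tpsi => y xy; apply: (ball_triangle_sub _ (ball_sym xp) xy).
    have : Num.min delta (r / 2) <= r / 2 by rewrite ge_min lexx orbT.
    lra.
  rewrite (supp _ _ prOm tr); apply: hdelta; apply: testS tpsi.
  by apply: le_ball; rewrite ge_min lexx.
Qed.
End continuation.

(** * Null boundaries *)

Section boundary.
Context {R : realType}.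
Implicit Types n : nat.

Lemma continuous_row n (T : topologicalType) (f : T -> 'rV[R]_n) :
  (forall j, continuous (fun x => f x 0 j)) -> continuous f.
Proof.
move=> cf x; apply/(@cvgrPdist_lt R 'rV[R]_n _ (nbhs x) _ f (f x)) => e e0.
have H : \forall y \near x, forall j, `|f x 0 j - f y 0 j| < e.
  apply: filter_forall => j; have /cvgrPdist_lt := cf j x; exact.
apply: filterS H => y hy.
have : ball (f x) e (f y) by apply/ball_rowE; split.
by rewrite -ball_normE.
Qed.

Lemma continuous_bigsum (T : topologicalType) (I : Type) (s : seq I) (F : I -> T -> R) :
  (forall i, continuous (F i)) -> continuous (fun x => \sum_(i <- s) F i x).
Proof.
move=> cF; elim: s => [|i s IH].
  rewrite (_ : (fun x => _) = cst 0); first exact: cst_continuous.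
  by apply/funext => x; rewrite big_nil.
rewrite (_ : (fun x => _) = fun x => F i x + \sum_(i <- s) F i x).
  by move=> x; apply: continuousD; [exact: cF|exact: IH].
by apply/funext => x; rewrite big_cons.
Qed.

Lemma continuous_affine_mx m n (Q : 'M[R]_(m, n)) (p : 'rV[R]_m) :
  continuous (fun x : 'rV[R]_m => (x - p) *m Q).
Proof.
apply: continuous_row => j.
rewrite (_ : (fun x => _) = fun x : 'rV[R]_m => \sum_k (x 0 k - p 0 k) * Q k j); last first.
  by apply/funext => x; rewrite mxE; apply: eq_bigr => k _; rewrite !mxE.
apply: (@continuous_bigsum _ _ _ (fun k (x : 'rV[R]_m) => (x 0 k - p 0 k) * Q k j)) => k x; 
apply: (@continuousM _ _ (fun x : 'rV[R]_m => x 0 k - p 0 k) (cst (Q k j)) x); last exact: cst_continuous.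
apply: (@continuousB _ _ _ (fun x : 'rV[R]_m => x 0 k) (cst (p 0 k)) x); last exact: cst_continuous.
exact: coord_continuous.
Qed.

Lemma continuous_ycoord n : continuous (@ycoord R n).
Proof.
apply: continuous_row => j; rewrite (_ : (fun x => _) = fun x : 'rV[R]_n.+1 => x 0 (lift ord_max j)).
  exact: coord_continuous.
by apply/funext => x; rewrite mxE.
Qed.

Lemma continuous_zcoord n : continuous (@zcoord R n).
Proof. exact: coord_continuous. Qed.

(* Near a boundary point, the translates of the boundary along the axis of the
   local graph are disjoint, of the same measure, and inside a bounded set. *)
Lemma boundary_null n (O : set 'rV[R]_n.+1) (P : ('rV[R]_n -> R) -> Prop) :
  (forall f, P f -> continuous f) -> regular_boundary P O -> open O ->
  {ae leb n.+1, forall x, ~ (closure O `\` O) x}.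
Proof.
move=> Pc reg oO.
have mE : measurable (closure O `\` O).
  by apply: measurableD; [apply: closed_measurable_row; exact: closed_closure|exact: open_measurable_row].
suff : {ae leb n.+1, forall x, (closure O `\` O) x -> ~ (closure O `\` O) x}.
  by apply: filterS => x h Ex; exact: (h Ex).
apply: ae_local => p /reg[Q [gam [r [QQ /Pc cg r0 hr]]]].
pose zf x := zcoord ((x - p) *m Q); pose yf x := ycoord ((x - p) *m Q).
have QQ' : Q^T *m Q = 1%:M by exact: mulmx1C.
(* The axis of the local graph in the original coordinates, Q being orthogonal: moving along v
   changes only the last local coordinate. *)
pose v : 'rV[R]_n.+1 := delta_mx 0 ord_max *m Q^T.
have tv x t : (x + t *: v - p) *m Q = (x - p) *m Q + t *: delta_mx 0 ord_max.
  rewrite addrAC mulmxDl -scalemxAl /v -mulmxA QQ' mulmx1//.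
have zt x t : zf (x + t *: v) = zf x + t by rewrite /zf tv /zcoord !mxE !eqxx mulr1.
have yt x t : yf (x + t *: v) = yf x.
  rewrite /yf tv; apply/rowP => i; rewrite !mxE eqxx/= (_ : lift ord_max i == ord_max = false) ?mulr0 ?addr0//.
  by apply/negbTE; rewrite eq_sym neq_lift.
have graph x : (closure O `\` O) x -> ball p r x -> zf x = gam (yf x).
  move=> [cOx nOx] px; apply/le_anti/andP; split; last first.
    by rewrite leNgt; apply/negP => /(hr x px).2.
  rewrite leNgt; apply/negP => lt.
  (* A point of the closure lying strictly above the graph would have a neighbourhood above it,
     which contains no point of O. *)
  have cz : continuous (fun x => zf x - gam (yf x)).
    move=> y; apply: continuousB.
      by apply: continuous_comp; [exact: continuous_affine_mx|exact: continuous_zcoord].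
    apply: continuous_comp; last exact: cg.
    by apply: continuous_comp; [exact: continuous_affine_mx|exact: continuous_ycoord].
  have : nbhs x [set y | 0 < zf y - gam (yf y)].
    have /cvgr_gt := cz x; apply; rewrite subr_gt0//.
  have : nbhs x (ball p r) by apply: open_nbhs_nbhs; split => //; exact: ball_open.
  move=> n1 n2; have [y [Oy [py]]] := cOx _ (filterI n1 n2).
  by rewrite /= subr_gt0 => ly; have := (hr y py).1 Oy; rewrite ltNge (ltW ly).
pose E := (closure O `\` O) `&` ball p (r / 2).
have mE' : measurable E by exact: measurable_setI_ball.
exists (r / 2); first by rewrite divr_gt0.
suff E0 : leb n.+1 E = 0%E.
  exists E; split => //.
  by move=> x /= hx; apply: contrapT => nE; apply: hx => bx cx; apply: nE; split.
(* The distinct lengths [t k] are at most tau, so a translation by [t k *: v] moves points by at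
   most r / 2 and keeps the translates of E inside [ball p r]. The [+ 1] makes the denominator
   positive at once. *)
pose tau := r / 2 / (`|v| + 1).
have v1 : 0 < `|v| + 1 by rewrite ltr_wpDl.
have tau0 : 0 < tau by rewrite divr_gt0// divr_gt0.
pose t k := tau / k.+1%:R.
have t0 k : 0 < t k by rewrite divr_gt0.
have tinj k l : t k = t l -> k = l.
  move=> /(mulfI (lt0r_neq0 tau0))/invr_inj/eqP; rewrite eqr_nat eqSS; exact: eqP.
have tv_lt k : `|t k *: v| <= r / 2.
  rewrite normrZ gtr0_norm// /t; apply: le_trans (_ : tau * `|v| <= _).
    apply: ler_wpM2r => //; rewrite ler_pdivrMr// ler_peMr ?(ltW tau0)//.
    by rewrite ler1n.
  rewrite /tau mulrAC ler_pdivrMr// ler_wpM2l ?lerDl//.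
  by rewrite divr_ge0 ?(ltW r0).
pose F k := [set x | E (x + - (t k *: v))].
have mF k : measurable (F k).
  by have := measurable_shift (- (t k *: v)) measurableT mE'; rewrite setTI.
have FE k : leb n.+1 (F k) = leb n.+1 E by exact: leb_shift.
have tF : trivIset setT F.
  apply/trivIsetP => k l _ _ kl; rewrite -subset0 => x [[hk pk] [hl pl]].
  have sub2 : r / 2 <= r by lra.
  have gk := graph _ hk (le_ball sub2 pk); have gl := graph _ hl (le_ball sub2 pl).
  move/eqP: kl; apply; apply: tinj.
  move: gk gl; rewrite -(scaleNr (t k)) -(scaleNr (t l)) (zt x (- t k)) (zt x (- t l)).
  rewrite (yt x (- t k)) (yt x (- t l)); lra.
have Fb k : F k `<=` ball p r.
  move=> x [_ px]; rewrite -ball_normE/=; move: px; rewrite -ball_normE/= => px.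
  have -> : p - x = (p - (x - t k *: v)) - t k *: v.
    by rewrite opprB addrCA [t k *: v + _]addrC addrK.
  apply: le_lt_trans (ler_normB _ _) _.
  by rewrite [X in _ < X](_ : r = r / 2 + r / 2); [exact: ltr_leD|lra].
have fin := leb_ball_lt p r.
have lE : (leb n.+1 E < +oo)%E.
  apply: le_lt_trans fin; rewrite -(FE 0%N); apply: le_measure; rewrite ?inE//.
  exact: measurable_ball_row.
have Efin : leb n.+1 E \is a fin_num by rewrite ge0_fin_numE.
have bound N : (N%:R%:E * leb n.+1 E <= leb n.+1 (ball p r))%E.
  have -> : (N%:R%:E * leb n.+1 E = \sum_(i < N) leb n.+1 (F i))%E.
    under eq_bigr do rewrite FE.
    by rewrite -(fineK Efin) -EFinM sumEFin sumr_const card_ord mulr_natl.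
  rewrite -measure_bigsetU//.
  - apply: le_measure; rewrite ?inE.
    + exact: bigsetU_measurable.
    + exact: measurable_ball_row.
    + by rewrite -bigcup_mkord => x [k _]; exact: Fb.
have Bfin : leb n.+1 (ball p r) \is a fin_num by rewrite ge0_fin_numE.
rewrite -(fineK Efin); congr (_%:E); apply/le_anti/andP; split; last exact: fine_ge0.
rewrite leNgt; apply/negP => pos.
(* N disjoint translates of E would exceed the measure of the ball that contains them. *)
pose N := (Num.truncn (fine (leb n.+1 (ball p r)) / fine (leb n.+1 E))).+1.
have := bound N; rewrite -(fineK Efin) -(fineK Bfin) -EFinM lee_fin leNgt => /negP; apply.
by rewrite -ltr_pdivrMr// truncnS_gt.
Qed.
End boundary.

(** * Complex integrals and weak solutions *)

Section complex_parts.
Context {R : realType}.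
Local Notation C := R[i].
Local Notation Re := (@complex.Re R).
Local Notation Im := (@complex.Im R).

Lemma ReD (a b : C) : Re (a + b) = Re a + Re b. Proof. by case: a b => ? ? [? ?]. Qed.
Lemma ImD (a b : C) : Im (a + b) = Im a + Im b. Proof. by case: a b => ? ? [? ?]. Qed.
Lemma ReN (a : C) : Re (- a) = - Re a. Proof. by case: a. Qed.
Lemma ImN (a : C) : Im (- a) = - Im a. Proof. by case: a. Qed.
Lemma ReM (a b : C) : Re (a * b) = Re a * Re b - Im a * Im b. Proof. by case: a b => ? ? [? ?]. Qed.
Lemma ImM (a b : C) : Im (a * b) = Re a * Im b + Im a * Re b. Proof. by case: a b => ? ? [? ?]. Qed.
Lemma Re_conj (a : C) : Re (a^*) = Re a. Proof. by case: a. Qed.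
Lemma Im_conj (a : C) : Im (a^*) = - Im a. Proof. by case: a. Qed.
Lemma complex_ext (a b : C) : Re a = Re b -> Im a = Im b -> a = b.
Proof. by case: a b => ? ? [? ?] /= -> ->. Qed.
(** The integrand of [L2norm2], as an element of R; the norm of a complex number would itself live
    in [R[i]]. *)
Definition sqmod (a : C) : R := Re a ^+ 2 + Im a ^+ 2.
Lemma sqmod_ge0 a : 0 <= sqmod a. Proof. by rewrite addr_ge0// sqr_ge0. Qed.
Lemma sqmodM a b : sqmod (a * b) = sqmod a * sqmod b.
Proof. by rewrite /sqmod ReM ImM; ring. Qed.
Lemma sqmodD a b : sqmod (a + b) <= 2 * (sqmod a + sqmod b).
Proof.
rewrite /sqmod ReD ImD -subr_ge0.
set x := Re a; set y := Im a; set z := Re b; set t := Im b.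
have -> : 2 * (x ^+ 2 + y ^+ 2 + (z ^+ 2 + t ^+ 2)) - ((x + z) ^+ 2 + (y + t) ^+ 2)
  = (x - z) ^+ 2 + (y - t) ^+ 2 by ring.
by rewrite addr_ge0// sqr_ge0.
Qed.
Lemma Re_mul_le a b : `|Re (a * b)| <= sqmod a + sqmod b.
Proof.
rewrite ReM /sqmod; case: a b => x y [z t] /=.
rewrite ler_norml; apply/andP; split; rewrite -subr_ge0.
  have -> : x * z - y * t - - (x ^+ 2 + y ^+ 2 + (z ^+ 2 + t ^+ 2)) =
    ((x + z) ^+ 2 + (y - t) ^+ 2 + x ^+ 2 + y ^+ 2 + z ^+ 2 + t ^+ 2) / 2 by field.
  by rewrite divr_ge0// !addr_ge0// sqr_ge0.
have -> : x ^+ 2 + y ^+ 2 + (z ^+ 2 + t ^+ 2) - (x * z - y * t) =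
    ((x - z) ^+ 2 + (y + t) ^+ 2 + x ^+ 2 + y ^+ 2 + z ^+ 2 + t ^+ 2) / 2 by field.
by rewrite divr_ge0// !addr_ge0// sqr_ge0.
Qed.
Lemma Im_mul_le a b : `|Im (a * b)| <= sqmod a + sqmod b.
Proof.
have := Re_mul_le a (b * 'i%C); rewrite mulrA [in X in X -> _]ReM /= mulr0 mulr1 sub0r normrN.
by rewrite sqmodM /sqmod /= expr0n/= expr1n add0r mulr1.
Qed.
End complex_parts.

Section complex_integrals.
Context {R : realType} {n : nat}.
Local Notation C := R[i].
Local Notation Re := (@complex.Re R).
Local Notation Im := (@complex.Im R).
Local Notation mu := (@leb R n).
Local Notation L := (L1 mu).
Implicit Types (D E : set 'rV[R]_n) (f g h : 'rV[R]_n -> C).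

Definition cmeas D f := measurable_fun D (fun x => Re (f x)) /\ measurable_fun D (fun x => Im (f x)).
Definition cL1 D f := L D (fun x => Re (f x)) /\ L D (fun x => Im (f x)).

Lemma cmeasD D f g : cmeas D f -> cmeas D g -> cmeas D (fun x => f x + g x).
Proof.
move=> [a b] [c d]; split.
  by under eq_fun do rewrite ReD; exact: measurable_funD.
by under eq_fun do rewrite ImD; exact: measurable_funD.
Qed.

Lemma cmeasM D f g : cmeas D f -> cmeas D g -> cmeas D (fun x => f x * g x).
Proof.
move=> [a b] [c d]; split.
  by under eq_fun do rewrite ReM; apply: measurable_funB; exact: measurable_funM.
by under eq_fun do rewrite ImM; apply: measurable_funD; exact: measurable_funM.
Qed.

Lemma cmeas_cst D (c : C) : cmeas D (fun=> c).
Proof. by split; exact: measurable_cst. Qed.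

Lemma cmeasN D f : cmeas D f -> cmeas D (fun x => - f x).
Proof.
move=> mf; rewrite (_ : (fun x => _) = fun x => (-1) * f x).
  by apply: cmeasM => //; exact: cmeas_cst.
by apply/funext => x; rewrite mulN1r.
Qed.

Lemma cmeas_conj D f : cmeas D f -> cmeas D (fun x => (f x)^*).
Proof.
move=> [a b]; split; first by under eq_fun do rewrite Re_conj.
by under eq_fun do rewrite Im_conj; exact: measurable_funN.
Qed.

Lemma cmeas_real D (a : 'rV[R]_n -> R) : measurable_fun D a -> cmeas D (fun x => (a x)%:C).
Proof. by move=> ma; split => //=; exact: measurable_cst. Qed.

Lemma cmeas_sum D I (s : seq I) (F : I -> 'rV[R]_n -> C) : (forall i, cmeas D (F i)) ->
  cmeas D (fun x => \sum_(i <- s) F i x).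
Proof.
move=> mF; elim: s => [|i s IH].
  by under eq_fun do rewrite big_nil; exact: cmeas_cst.
by under eq_fun do rewrite big_cons; exact: cmeasD.
Qed.

Lemma cmeasS D E f : measurable E -> D `<=` E -> cmeas E f -> cmeas D f.
Proof. by move=> mE DE [a b]; split; exact: measurable_funS DE _. Qed.

Lemma cmeas_sqmod D f : cmeas D f -> measurable_fun D (fun x => sqmod (f x)).
Proof.
move=> [a b]; rewrite /sqmod; apply: measurable_funD.
  by under eq_fun do rewrite expr2; exact: measurable_funM.
by under eq_fun do rewrite expr2; exact: measurable_funM.
Qed.

Lemma L2P D f : measurable D -> L2 D f <-> (cmeas D f /\ L D (fun x => sqmod (f x))).
Proof.
move=> mD; split.
  move=> [a b c]; split; first by split.
  apply/integrableP; split; first by apply/measurable_EFinP; apply: cmeas_sqmod; split.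
  move: c; rewrite /L2norm2; apply: le_lt_trans; rewrite le_eqVlt; apply/orP; left; apply/eqP.
  by apply: eq_integral => x _ /=; rewrite ger0_norm// sqmod_ge0.
move=> [[a b] /integrableP[_ c]]; split=> //.
move: c; rewrite /L2norm2; apply: le_lt_trans; rewrite le_eqVlt; apply/orP; left; apply/eqP.
by apply: eq_integral => x _ /=; rewrite ger0_norm// sqmod_ge0.
Qed.

Lemma L2_cmeas D f : L2 D f -> cmeas D f. Proof. by case. Qed.

Lemma L2_le D f (b : 'rV[R]_n -> R) : measurable D -> cmeas D f -> L D b ->
  (forall x, D x -> sqmod (f x) <= b x) -> L2 D f.
Proof.
move=> mD mf Lb fb; apply/(L2P _ mD); split=> //.
apply: (L1_le mD (cmeas_sqmod mf) _ Lb) => x Dx.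
by rewrite ger0_norm ?sqmod_ge0//; exact: fb.
Qed.

Lemma L2D D f g : measurable D -> L2 D f -> L2 D g -> L2 D (fun x => f x + g x).
Proof.
move=> mD /(L2P _ mD)[mf Lf] /(L2P _ mD)[mg Lg].
apply: (L2_le mD (cmeasD mf mg) (L1Z 2 mD (L1D mD Lf Lg))) => x _; exact: sqmodD.
Qed.

Lemma L2M D f g (M : R) : measurable D -> cmeas D g -> (forall x, D x -> sqmod (g x) <= M) ->
  L2 D f -> L2 D (fun x => g x * f x).
Proof.
move=> mD mg gM /(L2P _ mD)[mf Lf].
apply: (L2_le mD (cmeasM mg mf) (L1Z M mD Lf)) => x Dx.
by rewrite sqmodM ler_wpM2r ?sqmod_ge0// gM.
Qed.

Lemma L2Z D (c : C) f : measurable D -> L2 D f -> L2 D (fun x => c * f x).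
Proof. by move=> mD Lf; apply: (L2M mD (cmeas_cst _ c) (M := sqmod c)). Qed.

Lemma L2N D f : measurable D -> L2 D f -> L2 D (fun x => - f x).
Proof.
move=> mD Lf; rewrite (_ : (fun x => _) = fun x => (-1) * f x); first exact: L2Z.
by apply/funext => x; rewrite mulN1r.
Qed.

Lemma L2B D f g : measurable D -> L2 D f -> L2 D g -> L2 D (fun x => f x - g x).
Proof. by move=> mD Lf Lg; apply: L2D => //; exact: L2N. Qed.

Lemma L2_0 D : measurable D -> L2 D (fun=> 0).
Proof.
move=> mD; apply: (L2_le mD (cmeas_cst _ 0) (L1_0 mu mD)) => x _.
by rewrite /sqmod /= expr0n /= addr0.
Qed.

Lemma L2_sum D I (s : seq I) (F : I -> 'rV[R]_n -> C) : measurable D -> (forall i, L2 D (F i)) ->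
  L2 D (fun x => \sum_(i <- s) F i x).
Proof.
move=> mD LF; elim: s => [|i s IH].
  rewrite (_ : (fun x => _) = fun=> 0); first exact: L2_0.
  by apply/funext => x; rewrite big_nil.
rewrite (_ : (fun x => _) = fun x => F i x + \sum_(i <- s) F i x); first exact: L2D.
by apply/funext => x; rewrite big_cons.
Qed.

Lemma L2_conj D f : L2 D f -> L2 D (fun x => (f x)^*).
Proof.
move=> [a b c]; have [a' b'] := cmeas_conj (conj a b); split=> //.
by move: c; rewrite /L2norm2; under eq_integral do rewrite -sqrrN; under [in X in _ -> X]eq_integral do rewrite Re_conj Im_conj sqrrN;
  under eq_integral do rewrite sqrrN.
Qed.

Lemma L2S D E f : measurable D -> measurable E -> D `<=` E -> L2 E f -> L2 D f.
Proof.
move=> mD mE DE /(L2P _ mE)[mf Lf]; apply/(L2P _ mD); split; first exact: cmeasS mf.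
exact: L1S Lf.
Qed.

Lemma cL1_mul D f g : measurable D -> L2 D f -> L2 D g -> cL1 D (fun x => f x * g x).
Proof.
move=> mD /(L2P _ mD)[mf Lf] /(L2P _ mD)[mg Lg].
have [a b] := cmeasM mf mg; have Ls := L1D mD Lf Lg.
split; first by apply: L1_le Ls => // x _; exact: Re_mul_le.
by apply: L1_le Ls => // x _; exact: Im_mul_le.
Qed.

Lemma cL1_meas D f : cL1 D f -> cmeas D f.
Proof. by move=> [a b]; split; [exact: L1_measurable a|exact: L1_measurable b]. Qed.

Lemma cL1D D f g : measurable D -> cL1 D f -> cL1 D g -> cL1 D (fun x => f x + g x).
Proof.
move=> mD [a b] [c d]; split.
  by under eq_fun do rewrite ReD; exact: L1D.
by under eq_fun do rewrite ImD; exact: L1D.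
Qed.

Lemma cL1Z D (c : C) f : measurable D -> cL1 D f -> cL1 D (fun x => c * f x).
Proof.
move=> mD [a b]; split.
  by under eq_fun do rewrite ReM; apply: L1B => //; exact: L1Z.
by under eq_fun do rewrite ImM; apply: L1D => //; exact: L1Z.
Qed.

Lemma cL1N D f : measurable D -> cL1 D f -> cL1 D (fun x => - f x).
Proof.
move=> mD Lf; rewrite (_ : (fun x => _) = fun x => (-1) * f x); first exact: cL1Z.
by apply/funext => x; rewrite mulN1r.
Qed.

Lemma cL1B D f g : measurable D -> cL1 D f -> cL1 D g -> cL1 D (fun x => f x - g x).
Proof. by move=> mD Lf Lg; apply: cL1D => //; exact: cL1N. Qed.

Lemma cL1_0 D : measurable D -> cL1 D (fun=> 0).
Proof. by move=> mD; split; exact: L1_0. Qed.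

Lemma cL1_sum D I (s : seq I) (F : I -> 'rV[R]_n -> C) : measurable D -> (forall i, cL1 D (F i)) ->
  cL1 D (fun x => \sum_(i <- s) F i x).
Proof.
move=> mD LF; elim: s => [|i s IH].
  rewrite (_ : (fun x => _) = fun=> 0); first exact: cL1_0.
  by apply/funext => x; rewrite big_nil.
rewrite (_ : (fun x => _) = fun x => F i x + \sum_(i <- s) F i x); first exact: cL1D.
by apply/funext => x; rewrite big_cons.
Qed.

Lemma cL1_mulr D f (a : 'rV[R]_n -> R) (M : R) : measurable D -> measurable_fun D a ->
  (forall x, D x -> `|a x| <= M) -> cL1 D f -> cL1 D (fun x => (a x)%:C * f x).
Proof.
move=> mD ma aM [b c]; split.
  under eq_fun do rewrite ReM /= mul0r subr0 mulrC; exact: L1_mulbdd ma aM b.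
under eq_fun do rewrite ImM /= mul0r addr0 mulrC; exact: L1_mulbdd ma aM c.
Qed.

Lemma cL1_eq D f g : measurable D -> (forall x, D x -> f x = g x) -> cL1 D f -> cL1 D g.
Proof. by move=> mD fg [a b]; split; [apply: L1_eq a|apply: L1_eq b] => // x Dx; rewrite fg. Qed.

Lemma cL1_support D E f : measurable D -> measurable E -> D `<=` E ->
  (forall x, E x -> ~ D x -> f x = 0) -> cL1 D f -> cL1 E f.
Proof.
move=> mD mE DE f0 [a b]; split; [apply: L1_support a|apply: L1_support b] => // x Ex nD;
  by rewrite f0.
Qed.

Lemma cint_eq D f g : (forall x, D x -> f x = g x) -> cint D f = cint D g.
Proof. by move=> fg; congr (_ +i* _); apply: Rint_eq => x Dx; rewrite fg. Qed.

Lemma cint_support D E f : D `<=` E -> (forall x, E x -> ~ D x -> f x = 0) -> cint E f = cint D f.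
Proof. by move=> DE f0; congr (_ +i* _); apply: Rint_support => // x Ex nD; rewrite f0. Qed.

Lemma cint_ae D f g : measurable D -> cmeas D f -> cmeas D g ->
  {ae mu, forall x, D x -> f x = g x} -> cint D f = cint D g.
Proof.
move=> mD [a b] [c d] fg; congr (_ +i* _); apply: Rint_ae => //;
  by apply: filterS fg => x h Dx; rewrite h.
Qed.

Lemma cintD D f g : measurable D -> cL1 D f -> cL1 D g ->
  cint D (fun x => f x + g x) = cint D f + cint D g.
Proof.
move=> mD [a b] [c d]; apply: complex_ext; rewrite ?ReD ?ImD /= -RintegralD//; apply: Rint_eq => x _.
  exact: ReD.
exact: ImD.
Qed.

Lemma cintZ D (c : C) f : measurable D -> cL1 D f -> cint D (fun x => c * f x) = c * cint D f.
Proof.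
move=> mD [a b]; apply: complex_ext; rewrite ?ReM ?ImM /=.
  rewrite -!RintegralZl// -RintegralB//; [|exact: L1Z|exact: L1Z].
  by apply: Rint_eq => x _; rewrite ReM.
rewrite -!RintegralZl// -RintegralD//; [|exact: L1Z|exact: L1Z].
by apply: Rint_eq => x _; rewrite ImM.
Qed.

Lemma cintN D f : measurable D -> cL1 D f -> cint D (fun x => - f x) = - cint D f.
Proof.
move=> mD Lf; rewrite -mulN1r -cintZ//; by apply: cint_eq => x _; rewrite mulN1r.
Qed.

Lemma cintB D f g : measurable D -> cL1 D f -> cL1 D g ->
  cint D (fun x => f x - g x) = cint D f - cint D g.
Proof. by move=> mD Lf Lg; rewrite cintD// ?cintN//; exact: cL1N. Qed.

Lemma cint0 D : measurable D -> cint D (fun=> 0) = 0.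
Proof. by move=> mD; apply: complex_ext => /=; rewrite Rint_0. Qed.

Lemma cint_sum D I (s : seq I) (F : I -> 'rV[R]_n -> C) : measurable D -> (forall i, cL1 D (F i)) ->
  cint D (fun x => \sum_(i <- s) F i x) = \sum_(i <- s) cint D (F i).
Proof.
move=> mD LF; elim: s => [|i s IH].
  rewrite big_nil; transitivity (cint D (fun=> 0)); last exact: cint0.
  by apply: cint_eq => x _; rewrite big_nil.
rewrite big_cons -IH -cintD//; last exact: cL1_sum.
by apply: cint_eq => x _; rewrite big_cons.
Qed.

(* No integrability is needed, since [fine] maps infinities to 0. *)
Lemma Rint_opp D (f : 'rV[R]_n -> R) :
  \int[mu]_(x in D) (- f x) = - \int[mu]_(x in D) f x.
Proof.
rewrite /Rintegral; have -> : (fun x => (- f x)%:E) = (\- (EFin \o f))%E by [].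
rewrite [in LHS]integralE [in RHS]integralE funeposN funenegN.
have : (0 <= \int[mu]_(x in D) (EFin \o f)^\+ x)%E by apply: integral_ge0.
have : (0 <= \int[mu]_(x in D) (EFin \o f)^\- x)%E by apply: integral_ge0.
case: (\int[mu]_(x in D) (EFin \o f)^\+ x)%E => [a||]; case: (\int[mu]_(x in D) (EFin \o f)^\- x)%E => [b||] //= _ _;
  rewrite ?oppr0// -?EFinN -?EFinD /=.
by rewrite opprB.
Qed.

Lemma cint_conj D f : cint D (fun x => (f x)^*) = (cint D f)^*.
Proof.
apply: complex_ext => /=; first by apply: Rint_eq => x _; rewrite Re_conj.
by rewrite -Rint_opp; apply: Rint_eq => x _; rewrite Im_conj.
Qed.
End complex_integrals.

(** * Fubini's theorem on cylinders *)

Section cylinder_integrals.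
Context {R : realType}.
Local Notation leb1 := (@lebesgue_measure R).

Definition cyl n (om : set 'rV[R]_n) (I : set (measurableTypeR R)) : set 'rV[R]_n.+1 :=
  [set x | om (ycoord x) /\ I (zcoord x)].

Lemma measurable_zcoord n : measurable_fun setT (@zcoord R n : _ -> measurableTypeR R).
Proof. exact: measurable_row_coord. Qed.

Lemma measurable_ycoord n : measurable_fun setT (@ycoord R n).
Proof.
apply: measurable_fun_row => i; under eq_fun do rewrite mxE.
exact: measurable_row_coord.
Qed.

Lemma measurable_cyl n (om : set 'rV[R]_n) I : measurable om -> measurable I -> measurable (cyl om I).
Proof.
move=> mo mI; apply: measurableI.
  by rewrite -[X in measurable X]setTI; exact: measurable_ycoord.
by rewrite -[X in measurable X]setTI; exact: measurable_zcoord.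
Qed.

(** [leb n.+1] is the image under [snoc] of a product measure. Both factors are extended by 0;
    Tonelli gives integrability on the product and Fubini the value, with [slebs] in place of
    [leb n]. *)
Lemma prod_int n (om : set 'rV[R]_n) (I : set (measurableTypeR R)) (A : 'rV[R]_n -> R)
    (s : measurableTypeR R -> R) :
  measurable om -> measurable I -> L1 (leb n) om A -> L1 leb1 I s ->
  L1 (leb n.+1) (cyl om I) (fun x => A (ycoord x) * s (zcoord x)) /\
  \int[leb n.+1]_(x in cyl om I) (A (ycoord x) * s (zcoord x)) =
  (\int[leb n]_(y in om) A y) * (\int[leb1]_(z in I) s z).
Proof.
move=> mo mI LA Ls; have mc := measurable_cyl mo mI.
pose A' := A \_ om; pose s' := s \_ I.
have LA' : L1 (leb n) setT A'.
  by move/(integrable_mkcond _ mo): LA; apply: eq_integrable => // x _; rewrite /A' restrict_EFin.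
have Ls' : L1 leb1 setT s'.
  by move/(integrable_mkcond _ mI): Ls; apply: eq_integrable => // x _; rewrite /s' restrict_EFin.
have mA' := L1_measurable LA'; have ms' := L1_measurable Ls'.
pose F (x : 'rV[R]_n.+1) := A' (ycoord x) * s' (zcoord x).
have mF : measurable_fun setT F.
  apply: measurable_funM.
    by apply: measurableT_comp mA' _; exact: measurable_ycoord.
  by apply: measurableT_comp ms' _; exact: measurable_zcoord.
pose G (p : 'rV[R]_n * measurableTypeR R) : \bar R := (A' p.1 * s' p.2)%:E.
have FG p : F (snoc p) = A' p.1 * s' p.2 by rewrite /F ycoord_snoc zcoord_snoc.
have mG : measurable_fun setT G.
  apply/measurable_EFinP; apply: measurable_funM.
    exact: measurableT_comp.
  exact: measurableT_comp.
have IA : ((\int[leb n]_y `|(A' y)%:E|) < +oo)%E by case/integrableP: LA'.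
have Is : ((\int[leb1]_z `|(s' z)%:E|) < +oo)%E by case/integrableP: Ls'.
have mnA : measurable_fun setT (fun y => `|(A' y)%:E|%E).
  exact: measurable_int (L1_norm LA').
have mns : measurable_fun setT (fun z => `|(s' z)%:E|%E).
  exact: measurable_int (L1_norm Ls').
have iG : (@slebs R n \x leb1)%E.-integrable setT G.
  apply/integrable12ltyP => //.
  have E y : (\int[leb1]_z `|G (y, z)| = `|(A' y)%:E| * \int[leb1]_z `|(s' z)%:E|)%E.
    rewrite -ge0_integralZl//=.
    by apply: eq_integral => z _; rewrite /G/= normrM.
  under eq_integral do rewrite E.
  rewrite ge0_integralZr//=.
  - by rewrite lte_mul_pinfty ?integral_ge0// ge0_fin_numE ?integral_ge0.
  - by apply: integral_ge0.
have LF : L1 (leb n.+1) setT F.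
  apply/integrableP; split; first exact/measurable_EFinP.
  rewrite (@ge0_integral_pushforward _ _ _ _ _ _ (@measurable_snoc R n) (leb n \x leb1)%E setT (fun x => `|(F x)%:E|%E))//; last first.
    by apply: measurableT_comp => //; exact/measurable_EFinP.
  case/integrableP: iG => _; apply: le_lt_trans.
  rewrite le_eqVlt; apply/orP; left; apply/eqP.
  by apply: eq_integral => p _ /=; rewrite FG.
have EF x : cyl om I x -> F x = A (ycoord x) * s (zcoord x).
  by move=> [ox Ix]; rewrite /F /A' /s' !patchE !mem_set.
have F0 x : ~ cyl om I x -> F x = 0.
  rewrite /F /A' /s' !patchE => nx; case: ifPn => [/set_mem ox|]; last by rewrite mul0r.
  case: ifPn => [/set_mem Ix|]; last by rewrite mulr0.
  by exfalso; apply: nx.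
split; first by apply: (L1_eq mc EF); apply: (L1S mc measurableT _ LF).
transitivity (\int[leb n.+1]_(x in setT) F x).
  rewrite (@Rint_support _ _ _ _ (cyl om I) setT F)//; last by move=> x _; exact: F0.
  by apply: Rint_eq => x cx; rewrite EF.
have -> : \int[leb n]_(y in om) A y = \int[leb n]_(y in setT) A' y by rewrite Rintegral_mkcond.
have -> : \int[leb1]_(z in I) s z = \int[leb1]_(z in setT) s' z by rewrite Rintegral_mkcond.
rewrite /Rintegral.
rewrite (@integral_pushforward _ _ _ _ _ _ (@measurable_snoc R n) (leb n \x leb1)%E setT (EFin \o F))//; last 2 first.
- exact/measurable_EFinP.
- by apply: eq_integrable iG => // p _ /=; rewrite FG.
transitivity (fine (\int[@slebs R n \x leb1]_p G p)).
  by congr fine; apply: eq_integral => p _ /=; rewrite FG.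
rewrite -integral12_prod_meas1// /fubini_F.
have E y : (\int[leb1]_z G (y, z) = (A' y)%:E * \int[leb1]_z (s' z)%:E)%E.
  by rewrite -integralZl.
have sfin : (\int[leb1]_z (s' z)%:E)%E \is a fin_num by apply: integrable_fin_num.
transitivity (fine (\int[leb n]_y ((A' y)%:E * (fine (\int[leb1]_z (s' z)%:E))%:E))%E).
  by congr fine; apply: eq_integral => y _; rewrite fineK//; exact: E.
rewrite integralZr// fineM//; exact: integrable_fin_num.
Qed.

Lemma L1_expR (b : R) : 0 < b -> L1 leb1 `]1, +oo[%classic (fun z => expR (- b * z)).
Proof.
move=> b0.
have cont : continuous (fun z => expR (- b * z)).
  move=> z; apply: continuous_comp; last exact: continuous_expR.
  by apply: continuousM; [exact: cst_continuous|exact: cvg_id].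
have dF (z : R) : is_derive z (1:R) (fun z => - b^-1 * expR (- b * z)) (expR (- b * z)).
  have h := @is_derive_affine R (@expR R) (@expR R) (- b) 0 z (fun t => is_derive_expR t).
  have h2 := is_deriveZ (- b^-1) h.
  have -> : expR (- b * z) = - b^-1 *: (- b * expR (- b * z + 0)).
    by rewrite addr0 /GRing.scale/= mulrA mulrNN mulVf ?mul1r// lt0r_neq0.
  rewrite (_ : (fun z => - b^-1 * expR (- b * z)) = - b^-1 \*: (fun t => expR (- b * t + 0))) //.
  by apply/funext => t /=; rewrite addr0.
have : L1 leb1 `[1, +oo[%classic (fun z => expR (- b * z)).
  apply/integrableP; split.
    apply/measurable_EFinP; apply: measurable_funTS; exact: continuous_measurable_fun.
  under eq_integral do rewrite /= ger0_norm ?expR_ge0//.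
  rewrite (@ge0_continuous_FTC2y R _ (fun z => - b^-1 * expR (- b * z)) 1 0).
  - by rewrite sub0e -EFinN ltry.
  - by move=> z _; exact: expR_ge0.
  - exact: continuous_subspaceT.
  - rewrite -(mulr0 (- b^-1)); apply: cvgM; first exact: cvg_cst.
    apply/cvgrPdist_lt => e e0.
    have := @cvgr_expR R; move/cvgrPdist_lt => /(_ e e0)[M [_ hM]].
    exists (M / b); split; first exact: num_real.
    move=> z; rewrite ltr_pdivrMr// => /hM /=; by rewrite mulrC -mulNr.
  - by move=> z _; have [] := dF z.
  - apply: cvg_at_right_filter; apply: cvgM; first exact: cvg_cst.
    exact: (cont 1).
  - by move=> z _; rewrite derive1E; have [_ ->] := dF z.
apply: L1S => // z /=; rewrite !in_itv/= !andbT; exact: ltW.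
Qed.
End cylinder_integrals.

Section conjugation.
Context {R : realType}.
Implicit Types a b : R[i].
Lemma cconjM a b : (a * b)^*%C = a^*%C * b^*%C. Proof. exact: rmorphM. Qed.
Lemma Num_conjE a : Num.conj a = a^*%C. Proof. by []. Qed.
Lemma cconjN a : (- a)^*%C = - a^*%C. Proof. exact: rmorphN. Qed.
Lemma cconjD a b : (a + b)^*%C = a^*%C + b^*%C. Proof. exact: rmorphD. Qed.
Lemma cconjR (t : R) : (t%:C)^*%C = t%:C. Proof. exact: conjc_real. Qed.
Lemma cconj_sum I (s : seq I) (F : I -> R[i]) : (\sum_(i <- s) F i)^*%C = \sum_(i <- s) (F i)^*%C.
Proof. exact: rmorph_sum. Qed.
End conjugation.

(** * Weak solutions and Green's formula *)

Section weak_solutions.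
Context {R : realType} {n : nat}.
Local Notation C := R[i].
Local Notation mu := (@leb R n).
Implicit Types (D E : set 'rV[R]_n) (u v f g : 'rV[R]_n -> C) (a : 'rV[R]_n -> R).

(** Boundedness of the support is relative to D: the axial cut-off [zcut] is not compactly supported
    in the whole space, but it vanishes far away in the waveguide. *)
Definition bsupp D a := exists r : R, forall x, D x -> r < `|x| -> a x = 0.

Lemma bsupp_ball D a : bsupp D a -> exists r : R, forall x, D x -> ~ (D `&` ball 0 r) x -> a x = 0.
Proof.
move=> [r h]; exists (r + 1) => x Dx nx; apply: h => //.
rewrite ltNge; apply/negP => xr; apply: nx; split=> //.
by rewrite ball0E/=; lra.
Qed.

Lemma test_bsupp D E a : test_function E a -> bsupp D a.
Proof.
move=> /test_ball[r r0 h]; exists r => x _ xr; apply: h; rewrite ball0E/= => /(lt_trans xr).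
by rewrite ltxx.
Qed.

Lemma continuous_bounded_ball a (r : R) : continuous a -> exists2 M, 0 < M & forall x, ball 0 r x -> `|a x| <= M.
Proof.
move=> ca; have [M M0 h] := compact_bounded_fun (@cbox_compact R n (fun=> - r) (fun=> r)) ca.
exists M => // x /ball_rowE[_ xr]; apply: h => i.
by have := xr i; rewrite mxE sub0r normrN ltr_norml => /andP[/ltW -> /ltW ->].
Qed.

Lemma L2_support D E f : measurable D -> measurable E -> D `<=` E ->
  (forall x, E x -> ~ D x -> f x = 0) -> L2 D f -> L2 E f.
Proof.
move=> mD mE DE f0 [a b c]; have EE : E = D `|` (E `\` D).
  by apply/seteqP; split=> x /= => [Ex|[/DE//|[]//]]; have [|] := pselect (D x); [left|right].
have ext (F : 'rV[R]_n -> R) : measurable_fun D F -> (forall x, E x -> ~ D x -> F x = 0) -> measurable_fun E F.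
  move=> mF F0; rewrite EE; apply/measurable_funU => //; first exact: measurableD.
  split=> //; have : measurable_fun (E `\` D) (fun=> 0 : R) by exact: measurable_cst.
  by apply: eq_measurable_fun => x /set_mem[Ex nD]; rewrite F0.
have ma : measurable_fun E (fun x => complex.Re (f x)) by apply: ext => // x Ex nD; rewrite f0.
have mb : measurable_fun E (fun x => complex.Im (f x)) by apply: ext => // x Ex nD; rewrite f0.
apply/(L2P _ mE); split; first by split.
apply: (L1_support mD mE DE).
  by move=> x Ex nD; rewrite f0// /sqmod /= expr0n/= addr0.
by have /(L2P _ mD)[] : L2 D f by split.
Qed.

Lemma cmeasR D a : measurable D -> continuous a -> cmeas D (fun x => (a x)%:C).
Proof. by move=> mD ca; apply: cmeas_real; exact: continuous_measurable_row. Qed.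

Lemma sqmod_real (t : R) : sqmod (t%:C) = t ^+ 2.
Proof. by rewrite /sqmod /= expr0n addr0. Qed.

Lemma L2_cont_ball D f a r : measurable D -> continuous a -> L2 (D `&` ball 0 r) f ->
  L2 (D `&` ball 0 r) (fun x => (a x)%:C * f x).
Proof.
move=> mD ca Lf; have [M M0 hM] := continuous_bounded_ball r ca.
have mB : measurable (D `&` ball 0 r) by exact: measurable_setI_ball.
apply: (L2M mB (cmeasR mB ca) (M := M ^+ 2)) => // x [_ xr].
by rewrite sqmod_real -[a x ^+ 2]real_normK ?num_real// lerXn2r ?nnegrE ?(ltW M0)// hM.
Qed.

Lemma L2loc_contM D f a : measurable D -> continuous a -> L2loc D f -> L2loc D (fun x => (a x)%:C * f x).
Proof. by move=> mD ca Lf r; exact: L2_cont_ball. Qed.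

Lemma L2locD D f g : measurable D -> L2loc D f -> L2loc D g -> L2loc D (fun x => f x + g x).
Proof. by move=> mD Lf Lg r; apply: L2D => //; exact: measurable_setI_ball. Qed.

Lemma L2loc_conj D f : L2loc D f -> L2loc D (fun x => (f x)^*).
Proof. by move=> Lf r; exact: L2_conj. Qed.

Lemma L2_L2loc D f : measurable D -> L2 D f -> L2loc D f.
Proof.
move=> mD Lf r; apply: L2S Lf => //.
by exact: measurable_setI_ball.
Qed.

Lemma L2loc_L2 D f a : measurable D -> continuous a -> bsupp D a -> L2loc D f ->
  L2 D (fun x => (a x)%:C * f x).
Proof.
move=> mD ca /bsupp_ball[r ar] Lf.
have mB : measurable (D `&` ball 0 r) by exact: measurable_setI_ball.
apply: (L2_support mB mD) => [x []//|x Dx nx|]; first by rewrite ar// mul0r.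
exact: L2_cont_ball.
Qed.

Lemma L2loc_mul_cL1 D f g a : measurable D -> continuous a -> bsupp D a -> L2loc D f -> L2loc D g ->
  cL1 D (fun x => (a x)%:C * (f x * g x)).
Proof.
move=> mD ca /bsupp_ball[r ar] Lf Lg.
have mB : measurable (D `&` ball 0 r) by exact: measurable_setI_ball.
apply: (cL1_support mB mD) => [x []//|x Dx nx|]; first by rewrite ar// mul0r.
apply: (cL1_eq mB (f := fun x => ((a x)%:C * f x) * g x)); first by move=> x _; rewrite mulrA.
by apply: cL1_mul => //; exact: L2_cont_ball.
Qed.

Lemma L2loc_cst D (c : C) : measurable D -> L2loc D (fun=> c).
Proof.
move=> mD r; have mB : measurable (D `&` ball 0 r) by exact: measurable_setI_ball.
apply: (L2_le mB (cmeas_cst _ c) (b := fun=> sqmod c)) => //.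
apply: (@L1_bounded _ _ _ _ (sqmod c)) => //; last by move=> x _; rewrite ger0_norm ?sqmod_ge0.
apply: le_lt_trans (leb_ball_lt (0 : 'rV[R]_n) r); apply: le_measure; rewrite ?inE//.
exact: measurable_ball_row.
Qed.

Lemma L2loc_cL1 D f a : measurable D -> continuous a -> bsupp D a -> L2loc D f ->
  cL1 D (fun x => (a x)%:C * f x).
Proof.
move=> mD ca ba Lf; apply: (cL1_eq mD (f := fun x => (a x)%:C * (f x * 1))).
  by move=> x _; rewrite mulr1.
by apply: L2loc_mul_cL1 => //; exact: L2loc_cst.
Qed.

Lemma cL1_testr D E f a : measurable D -> test_function E a -> L2loc D f ->
  cL1 D (fun x => f x * (a x)%:C).
Proof.
move=> mD ta Lf; apply: (cL1_eq mD (f := fun x => (a x)%:C * f x)); first by move=> x _; rewrite mulrC.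
apply: L2loc_cL1 => //; first exact: smooth_cont ta.1.
exact: test_bsupp ta.
Qed.

(** Leibniz' rule, obtained by testing the weak gradient of u against [a psi], which is again a test
    function. *)
Lemma weak_grad_smoothM D u (g : 'I_n -> 'rV[R]_n -> C) a : measurable D -> L2loc D u ->
  (forall i, L2loc D (g i)) -> weak_grad D u g -> smooth a ->
  weak_grad D (fun x => (a x)%:C * u x) (fun i x => (a x)%:C * g i x + (pderiv i a x)%:C * u x).
Proof.
move=> mD Lu Lg wg sa i psi tpsi.
have tap := testM tpsi sa.
have tdap := testM tpsi (smooth_pderiv i sa).
have L1' := cL1_testr mD (test_pderiv i tap) Lu.
have L2' := cL1_testr mD tdap Lu.
have L3' := cL1_testr mD tap (Lg i).
have E x : (a x)%:C * u x * (pderiv i psi x)%:C =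
   u x * (pderiv i (fun x => a x * psi x) x)%:C - u x * (pderiv i a x * psi x)%:C.
  rewrite (pderivMs i sa tpsi.1) /= !rmorphD !rmorphM /=.
  by move: ((a x)%:C) (u x) ((pderiv i psi x)%:C) ((pderiv i a x)%:C) ((psi x)%:C) => *; ring.
rewrite (cint_eq (fun x _ => E x)) cintB// wg// -cintN// -cintB//; last exact: cL1N.
rewrite -[in RHS]cintN//; last first.
  apply: (cL1_eq mD (f := fun x => g i x * (a x * psi x)%:C + u x * (pderiv i a x * psi x)%:C)).
    by move=> x _; rewrite !rmorphM /=; move: ((a x)%:C) (u x) (g i x) ((pderiv i a x)%:C) ((psi x)%:C) => *; ring.
  exact: cL1D.
apply: cint_eq => x _; rewrite !rmorphM /=.
by move: ((a x)%:C) (u x) (g i x) ((pderiv i a x)%:C) ((psi x)%:C) => *; ring.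
Qed.

Lemma weak_grad_conj D u (g : 'I_n -> 'rV[R]_n -> C) : weak_grad D u g ->
  weak_grad D (fun x => (u x)^*) (fun i x => (g i x)^*).
Proof.
move=> wg i psi tpsi.
have E v : cint D (fun x => (v x)^*%C * (psi x)%:C) = (cint D (fun x => v x * (psi x)%:C))^*.
  by rewrite -cint_conj; apply: cint_eq => x _; rewrite cconjM cconjR.
have E' v : cint D (fun x => (v x)^*%C * (pderiv i psi x)%:C) = (cint D (fun x => v x * (pderiv i psi x)%:C))^*.
  by rewrite -cint_conj; apply: cint_eq => x _; rewrite cconjM cconjR.
by rewrite E E' wg// cconjN.
Qed.

(** The content of [neumann_sol] with its gradient named, because the flux refers to that
    gradient. *)
Definition weak_sol D (k u : 'rV[R]_n -> C) (g : 'I_n -> 'rV[R]_n -> C) :=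
  H1loc D u g /\
    forall v h, H1 D v h -> (exists r : R, forall x, D x -> r < `|x| -> v x = 0) ->
      cint D (fun x => \sum_(i < n) g i x * h i x) = cint D (fun x => k x * u x * v x).

(** The variational formulation tested with [a v], which is in H^1 with bounded support although v
    is only locally in H^1. *)
Lemma weak_sol_test D k u (g : 'I_n -> 'rV[R]_n -> C) v (h : 'I_n -> 'rV[R]_n -> C) a : measurable D -> weak_sol D k u g -> H1loc D v h ->
  smooth a -> bsupp D a -> (forall i, bsupp D (pderiv i a)) ->
  cint D (fun x => \sum_(i < n) (a x)%:C * (g i x * h i x)) +
    cint D (fun x => \sum_(i < n) (pderiv i a x)%:C * (g i x * v x)) =
  cint D (fun x => (a x)%:C * (k x * u x * v x)).
Proof.
move=> mD [[Lu Lg wu] su] [Lv Lh wv] sa ba bda.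
have H1w : H1 D (fun x => (a x)%:C * v x) (fun i x => (a x)%:C * h i x + (pderiv i a x)%:C * v x).
  split.
  - by apply: L2loc_L2 => //; exact: smooth_cont.
  - move=> i; apply: L2D => //; apply: L2loc_L2 => //; [exact: smooth_cont|].
    by apply: smooth_cont; exact: smooth_pderiv.
  - exact: weak_grad_smoothM.
have [r ar] := ba.
have := su _ _ H1w; have -> : (exists r : R, forall x, D x -> r < `|x| -> (a x)%:C * v x = 0) = True.
  by apply/propeqP; split=> // _; exists r => x Dx xr; rewrite ar// mul0r.
move=> /(_ I) E.
rewrite -cintD//; last 2 first.
- by apply: cL1_sum => // i; apply: L2loc_mul_cL1 => //; exact: smooth_cont.
- apply: cL1_sum => // i; apply: L2loc_mul_cL1 => //; apply: smooth_cont; exact: smooth_pderiv.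
transitivity (cint D (fun x => k x * u x * ((a x)%:C * v x))); last first.
  by apply: cint_eq => x _; rewrite mulrCA.
rewrite -E; apply: cint_eq => x _; rewrite -big_split/=; apply: eq_bigr => i _.
by move: ((a x)%:C) (g i x) (h i x) (v x) ((pderiv i a x)%:C) => *; ring.
Qed.

(** The identities of [weak_sol_test] for (u, v) and for (v, u) are subtracted. The products of
    gradients cancel by symmetry, and the derivatives of a stand where a boundary term would. *)
Lemma green D k1 k2 u (g : 'I_n -> 'rV[R]_n -> C) v (h : 'I_n -> 'rV[R]_n -> C) a (M : R) : measurable D -> weak_sol D k1 u g -> weak_sol D k2 v h ->
  cmeas D k1 -> (forall x, D x -> sqmod (k1 x) <= M) ->
  cmeas D k2 -> (forall x, D x -> sqmod (k2 x) <= M) ->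
  smooth a -> bsupp D a -> (forall i, bsupp D (pderiv i a)) ->
  cint D (fun x => \sum_(i < n) (pderiv i a x)%:C * (g i x * v x - h i x * u x)) =
  cint D (fun x => (a x)%:C * ((k1 x - k2 x) * u x * v x)).
Proof.
move=> mD s1 s2 mk1 bk1 mk2 bk2 sa ba bda.
have [H1u _] := s1; have [H1v _] := s2.
have E1 := weak_sol_test mD s1 H1v sa ba bda; have E2 := weak_sol_test mD s2 H1u sa ba bda.
have [Lu Lg _] := H1u; have [Lv Lh _] := H1v.
have Lk k w : cmeas D k -> (forall x, D x -> sqmod (k x) <= M) -> L2loc D w -> L2loc D (fun x => k x * w x).
  move=> mk bk Lw r; have mB : measurable (D `&` ball 0 r) by exact: measurable_setI_ball.
  have DD : D `&` ball 0 r `<=` D by move=> x [].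
  by apply: (L2M mB (cmeasS mD DD mk) (M := M)) => // x [Dx _]; exact: bk.
have ca := smooth_cont sa; have cda i := smooth_cont (smooth_pderiv i sa).
have LR w1 w2 k : cmeas D k -> (forall x, D x -> sqmod (k x) <= M) -> L2loc D w1 -> L2loc D w2 ->
    cL1 D (fun x => (a x)%:C * (k x * w1 x * w2 x)).
  by move=> mk bk Lw1 Lw2; apply: L2loc_mul_cL1 => //; exact: Lk.
have -> : cint D (fun x => (a x)%:C * ((k1 x - k2 x) * u x * v x)) =
    cint D (fun x => (a x)%:C * (k1 x * u x * v x)) - cint D (fun x => (a x)%:C * (k2 x * v x * u x)).
  rewrite -cintB//; [|exact: LR|exact: LR]; apply: cint_eq => x _.
  by move: ((a x)%:C) (k1 x) (k2 x) (u x) (v x) => *; ring.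
rewrite -E1 -E2.
have -> : cint D (fun x => \sum_(i < n) (a x)%:C * (g i x * h i x)) =
    cint D (fun x => \sum_(i < n) (a x)%:C * (h i x * g i x)).
  by apply: cint_eq => x _; apply: eq_bigr => i _; rewrite [g i x * _]mulrC.
rewrite opprD addrACA subrr add0r -cintB//; last 2 first.
- by apply: cL1_sum => // i; exact: L2loc_mul_cL1.
- by apply: cL1_sum => // i; exact: L2loc_mul_cL1.
apply: cint_eq => x _; rewrite -sumrB; apply: eq_bigr => i _.
by rewrite mulrBr.
Qed.

Lemma H1_conj D v (h : 'I_n -> 'rV[R]_n -> C) : H1 D v h -> H1 D (fun x => (v x)^*) (fun i x => (h i x)^*).
Proof.
move=> [a b c]; split; [exact: L2_conj|by move=> i; exact: L2_conj|exact: weak_grad_conj].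
Qed.

Lemma weak_sol_conj D k u (g : 'I_n -> 'rV[R]_n -> C) : weak_sol D k u g ->
  weak_sol D (fun x => (k x)^*) (fun x => (u x)^*) (fun i x => (g i x)^*).
Proof.
move=> [[Lu Lg wg] su]; split.
  by split; [exact: L2loc_conj|move=> i; exact: L2loc_conj|exact: weak_grad_conj].
move=> v h H1v [r vr]; have := su _ _ (H1_conj H1v).
have -> : (exists r : R, forall x, D x -> r < `|x| -> (v x)^* = 0) = True.
  by apply/propeqP; split=> // _; exists r => x Dx xr; rewrite vr// conjc0.
move=> /(_ I) E; apply: (can_inj (@conjcK R)); rewrite -!cint_conj.
transitivity (cint D (fun x => \sum_(i < n) g i x * (h i x)^*%C)).
  by apply: cint_eq => x _; rewrite cconj_sum; apply: eq_bigr => i _; rewrite cconjM conjcK.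
by rewrite E; apply: cint_eq => x _; rewrite !cconjM !conjcK.
Qed.
End weak_solutions.

(** * Modes and flux in the half-cylinder *)

Section axial_cutoff.
Context {R : realType}.
Variables (chi : R -> R) (hc : cutoff chi).
Local Notation leb1 := (@lebesgue_measure R).

(* The derivative in z of [zcut], with support in L <= z <= L + 1. *)
Definition dcut (L z : R) : R := - derive1 chi (z - L).

Lemma continuous_dcut L : continuous (dcut L).
Proof.
have cd : continuous (derive1 chi).
  move=> z; have h := @cutoff_smooth _ _ hc 1%N z.
  by apply: differentiable_continuous; apply/derivable1_diffP.
move=> z; apply: (@continuousN _ _ _ (fun z => derive1 chi (z - L))).
apply: (@continuous_comp _ _ _ (fun z : R => z - L) (derive1 chi)); last exact: cd.
by apply: (@continuousB _ _ _ (@id R) (cst L)); [exact: cvg_id|exact: cst_continuous].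
Qed.

Lemma dcut0 L z : z < L \/ L + 1 < z -> dcut L z = 0.
Proof.
move=> h; rewrite /dcut derive1E.
suff [c hE] : exists c : R, \forall t \near z - L, chi t = c.
  by rewrite (@near_eq_derive _ _ _ chi (cst c) (z - L) 1 hE) derive_cst oppr0.
case: h => h.
  exists 0; have : nbhs (z - L) [set t : R | t < 0].
    by apply: open_nbhs_nbhs; split; [exact: open_lt|rewrite /= subr_lt0].
  by apply: filterS => t /= t0; apply: (cutoff_zero hc); exact: ltW.
exists 1; have : nbhs (z - L) [set t : R | 1 < t].
  by apply: open_nbhs_nbhs; split; [exact: open_gt|rewrite /=; lra].
by apply: filterS => t /= t0; apply: (cutoff_one hc); exact: ltW.
Qed.

Lemma dcut_bounded : exists2 M, 0 < M & forall L z, `|dcut L z| <= M.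
Proof.
have c0 : continuous (dcut 0) by exact: continuous_dcut.
have : compact (dcut 0 @` `[0, 1]).
  by apply: continuous_compact; [exact: continuous_subspaceT|exact: segment_compact].
move=> /compact_bounded/bounded_set_le[M M0 h]; exists M => // L z.
have -> : dcut L z = dcut 0 (z - L) by rewrite /dcut subr0.
have [z0|z0] := ltP (z - L) 0; first by rewrite dcut0; [rewrite normr0 ltW|left].
have [z1|z1] := ltP 1 (z - L); first by rewrite dcut0; [rewrite normr0 ltW|right; rewrite add0r].
by apply: h; exists (z - L) => //=; rewrite in_itv/= z0 z1.
Qed.

Lemma is_derive_cut (L z : R) : is_derive z (1:R) (fun z => 1 - chi (z - L)) (dcut L z).
Proof.
have h0 (t : R) : is_derive t (1:R) chi (derive1 chi t) := smooth1_is_derive 0 t (cutoff_smooth hc).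
have h1 := is_derive_affine 1 (- L) z h0.
rewrite !mul1r in h1.
have h2 := is_deriveB (is_derive_cst (1:R) z (1:R)) h1.
rewrite sub0r in h2; rewrite /dcut.
rewrite (_ : (fun z => 1 - chi (z - L)) = (cst 1 - (fun t => chi (1 * t - L)))) //.
by apply/funext => t; rewrite /= !fctE mul1r.
Qed.

Lemma L1_dcut L (I : set (measurableTypeR R)) : measurable I -> L1 leb1 I (dcut L).
Proof.
move=> mI; have [M M0 hM] := dcut_bounded.
have : L1 leb1 (setT : set (measurableTypeR R)) (dcut L).
  apply: (@L1_support _ _ _ leb1 (`[L, L + 1]%classic : set (measurableTypeR R)) setT (dcut L)) => //.
    move=> z _ /= nz; apply: dcut0; move/negP: nz; rewrite in_itv/= negb_and -!ltNge => /orP[]; by [left|right].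
  apply: continuous_compact_integrable; first exact: segment_compact.
  by apply: continuous_subspaceT; exact: continuous_dcut.
exact: L1S.
Qed.

(** [1 - chi (z - L)] falls from 1 to 0 between L and L + 1, and [1 < L] places this interval inside
    the domain of integration. *)
Lemma int_dcut L : 1 < L -> \int[leb1]_(z in `]1, +oo[) dcut L z = -1.
Proof.
move=> L1'; rewrite (@Rint_support _ _ _ leb1 (`[L, L + 1]%classic : set (measurableTypeR R)) `]1, +oo[%classic (dcut L)).
- rewrite /Rintegral (@continuous_FTC2 R _ (fun z => 1 - chi (z - L))).
  + rewrite (cutoff_one hc (z := L + 1 - L)) ?(cutoff_zero hc (z := L - L)) /=.
    * by rewrite subrr subr0 sub0r.
    * by rewrite subrr.
    * by rewrite addrAC subrr add0r.
  + by rewrite ltrDl.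
  + by apply: continuous_subspaceT; exact: continuous_dcut.
  + have cf : continuous (fun z => 1 - chi (z - L)).
      by move=> z; apply: differentiable_continuous; apply/derivable1_diffP; have [] := is_derive_cut L z.
    split=> [z _||].
    * by have [] := is_derive_cut L z.
    * by apply: cvg_at_right_filter; exact: cf.
    * by apply: cvg_at_left_filter; exact: cf.
  + by move=> z _; rewrite derive1E; have [_ ->] := is_derive_cut L z.
- by move=> z /=; rewrite !in_itv/= andbT => /andP[+ _]; exact: lt_le_trans.
- move=> z _ /= nz; apply: dcut0; move/negP: nz; rewrite in_itv/= negb_and -!ltNge => /orP[]; by [left|right].
Qed.

Definition zcut n (L : R) (x : 'rV[R]_n.+1) : R := 1 - chi (zcoord x - L).

Lemma smooth_zcut n L : smooth (@zcut n L).
Proof.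
apply: smoothD; first exact: smooth_cst.
rewrite (_ : (fun x => _) = fun x : 'rV[R]_n.+1 => (-1) * chi (1 * x 0 ord_max + - L)); last first.
  by apply/funext => x; rewrite mul1r mulN1r.
by apply: smoothM; [exact: smooth_cst|apply: smooth_affine; exact: cutoff_smooth].
Qed.

Lemma pderiv_zcut n L i : pderiv i (@zcut n L) = fun x => (ord_max == i)%:R * dcut L (zcoord x).
Proof. exact: (pderiv_coord ord_max i (is_derive_cut L)). Qed.
End axial_cutoff.

Section separated_integrals.
Context {R : realType}.
Local Notation C := R[i].
Local Notation leb1 := (@lebesgue_measure R).

Lemma cprod_int n (om : set 'rV[R]_n) (I : set (measurableTypeR R)) (A : 'rV[R]_n -> R)
    (T : measurableTypeR R -> C) :
  measurable om -> measurable I -> L1 (leb n) om A ->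
  L1 leb1 I (fun z => complex.Re (T z)) -> L1 leb1 I (fun z => complex.Im (T z)) ->
  cL1 (cyl om I) (fun x => (A (ycoord x))%:C * T (zcoord x)) /\
  cint (cyl om I) (fun x => (A (ycoord x))%:C * T (zcoord x)) =
  (\int[leb n]_(y in om) A y)%:C *
  ((\int[leb1]_(z in I) complex.Re (T z)) +i* (\int[leb1]_(z in I) complex.Im (T z))).
Proof.
move=> mo mI LA LR LI.
have [L1' E1] := prod_int mo mI LA LR; have [L2' E2] := prod_int mo mI LA LI.
have mc := measurable_cyl mo mI.
split; first split.
- by apply: L1_eq mc _ L1' => x _; rewrite ReM /= mul0r subr0.
- by apply: L1_eq mc _ L2' => x _; rewrite ImM /= mul0r addr0.
apply: complex_ext; rewrite ?ReM ?ImM /= !mul0r ?subr0 ?addr0.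
  by rewrite -E1; apply: Rint_eq => x _; rewrite ReM /= mul0r subr0.
by rewrite -E2; apply: Rint_eq => x _; rewrite ImM /= mul0r addr0.
Qed.

Lemma expiD (a b : R) : expi (a + b) = expi a * expi b.
Proof. by apply: complex_ext; rewrite ?ReM ?ImM /= ?cosD ?sinD 1?addrC// mulrC [X in _ + X]mulrC addrC. Qed.

Lemma expi0 : expi (0 : R) = 1.
Proof. by rewrite /expi cos0 sin0. Qed.

Lemma expi_conj (a : R) : (expi a)^*%C = expi (- a).
Proof. by rewrite /expi /= cosN sinN. Qed.

Lemma sqmod_expi (a : R) : sqmod (expi a) = 1.
Proof. by rewrite /sqmod /= cos2Dsin2. Qed.
End separated_integrals.

(** * Weak derivatives in one direction *)

Section weak_partial.
Context {R : realType} {n : nat}.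
Local Notation C := R[i].
Local Notation mu := (@leb R n).
Implicit Types (D E : set 'rV[R]_n) (u v g h : 'rV[R]_n -> C).

(** A single component of [weak_grad]: the flux involves only the axial derivative, and in that
    direction a separated function is differentiated without any regularity in y. *)
Definition weak_partial (i : 'I_n) D u g := [/\ L2loc D u, L2loc D g &
  forall psi, test_function D psi ->
    cint D (fun x => u x * (pderiv i psi x)%:C) = - cint D (fun x => g x * (psi x)%:C)].

Lemma weak_partialD i D u g v h : measurable D -> weak_partial i D u g -> weak_partial i D v h ->
  weak_partial i D (fun x => u x + v x) (fun x => g x + h x).
Proof.
move=> mD [Lu Lg wu] [Lv Lh wv]; split; [exact: L2locD|exact: L2locD|] => psi tp.
have tdp := test_pderiv i tp.
under eq_fun do rewrite mulrDl.
rewrite cintD//; [|exact: cL1_testr tdp Lu|exact: cL1_testr tdp Lv].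
under [in RHS]eq_fun do rewrite mulrDl.
rewrite [in RHS]cintD//; [|exact: cL1_testr tp Lg|exact: cL1_testr tp Lh].
by rewrite wu// wv// opprD.
Qed.

Lemma weak_partialZ i D (c : C) u g : measurable D -> weak_partial i D u g ->
  weak_partial i D (fun x => c * u x) (fun x => c * g x).
Proof.
move=> mD [Lu Lg wu].
have Z f : L2loc D f -> L2loc D (fun x => c * f x).
  by move=> Lf r; apply: L2Z => //; exact: measurable_setI_ball.
split; [exact: Z|exact: Z|] => psi tp.
have tdp := test_pderiv i tp.
under eq_fun do rewrite -mulrA.
rewrite cintZ//; last exact: cL1_testr tdp Lu.
under [in RHS]eq_fun do rewrite -mulrA.
by rewrite cintZ//; [rewrite wu// mulrN|exact: cL1_testr tp Lg].
Qed.

Lemma L2loc0 D : measurable D -> L2loc D (fun=> 0).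
Proof. by move=> mD; exact: L2loc_cst. Qed.

Lemma weak_partial0 i D : measurable D -> weak_partial i D (fun=> 0) (fun=> 0).
Proof.
move=> mD; split; [exact: L2loc0|exact: L2loc0|] => psi _.
have E a : cint D (fun x => 0 * (a x)%:C) = 0.
  by rewrite -[RHS](cint0 mD); apply: cint_eq => x _; rewrite mul0r.
by rewrite !E oppr0.
Qed.

Lemma weak_partial_sum i D I (s : seq I) (F G : I -> 'rV[R]_n -> C) : measurable D ->
  (forall k, weak_partial i D (F k) (G k)) ->
  weak_partial i D (fun x => \sum_(k <- s) F k x) (fun x => \sum_(k <- s) G k x).
Proof.
move=> mD h; elim: s => [|k s IH].
  by under eq_fun do rewrite big_nil; under [X in weak_partial _ _ _ X]eq_fun do rewrite big_nil; exact: weak_partial0.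
under eq_fun do rewrite big_cons; under [X in weak_partial _ _ _ X]eq_fun do rewrite big_cons.
exact: weak_partialD.
Qed.

Lemma L2loc_S D E f : measurable D -> measurable E -> D `<=` E -> L2loc E f -> L2loc D f.
Proof.
move=> mD mE DE Lf r; apply: L2S (Lf r); try (exact: measurable_setI_ball).
by move=> x [/DE].
Qed.

Lemma L2loc_eq D u v : measurable D -> (forall x, D x -> u x = v x) -> L2loc D u -> L2loc D v.
Proof.
move=> mD uv Lu r; have mB : measurable (D `&` ball 0 r) by exact: measurable_setI_ball.
have /(L2P _ mB)[[a b] c] := Lu r.
apply/(L2P _ mB); split; last by apply: L1_eq mB _ c => x [Dx _]; rewrite uv.
split; first by apply: eq_measurable_fun a => x /set_mem[Dx _]; rewrite uv.
by apply: eq_measurable_fun b => x /set_mem[Dx _]; rewrite uv.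
Qed.

Lemma weak_partial_eq i D u v g h : measurable D -> (forall x, D x -> u x = v x) ->
  (forall x, D x -> g x = h x) -> weak_partial i D u g -> weak_partial i D v h.
Proof.
move=> mD uv gh [Lu Lg wu]; split; [exact: L2loc_eq Lu|exact: L2loc_eq Lg|] => psi tp.
rewrite -(cint_eq (f := fun x => u x * (pderiv i psi x)%:C)); last by move=> x Dx; rewrite uv.
by rewrite wu//; congr (- _); apply: cint_eq => x Dx; rewrite gh.
Qed.

Lemma test_out D E psi : test_function D psi -> forall x, E x -> ~ D x -> psi x = 0.
Proof. by move=> [_ [K [_ KD Kpsi]]] x _ nD; apply: Kpsi => /KD. Qed.

Lemma weak_partialS i D E u g : measurable D -> measurable E -> D `<=` E ->
  weak_partial i E u g -> weak_partial i D u g.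
Proof.
move=> mD mE DE [Lu Lg wu]; split; [exact: L2loc_S Lu|exact: L2loc_S Lg|] => psi tp.
rewrite -(@cint_support _ _ D E); [|exact: DE|by move=> x Ex nD; rewrite (test_out (test_pderiv i tp) Ex nD) mulr0].
rewrite -(@cint_support _ _ D E); [|exact: DE|by move=> x Ex nD; rewrite (test_out tp Ex nD) mulr0].
by apply: wu; exact: testS tp.
Qed.

Lemma weak_grad_partial i D u (g : 'I_n -> 'rV[R]_n -> C) : H1loc D u g -> weak_partial i D u (g i).
Proof. by move=> [Lu Lg wu]; split=> // psi; exact: wu. Qed.

(** The du Bois-Reymond lemma for the real and imaginary parts of g - h. It identifies the axial
    component of a given weak gradient with the derivative computed from an expansion. *)
Lemma weak_partial_uniq (chi : R -> R) i D u v g h : cutoff chi -> open D ->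
  {ae mu, forall x, D x -> u x = v x} ->
  weak_partial i D u g -> weak_partial i D v h -> {ae mu, forall x, D x -> g x = h x}.
Proof.
move=> hc oD uv [Lu Lg wu] [Lv Lh wv]; have mD := open_measurable_row oD.
pose w x := g x - h x.
have Lw : L2loc D w by move=> r; apply: L2B => //; exact: measurable_setI_ball.
have cw r : cL1 (D `&` ball 0 r) w.
  have mB : measurable (D `&` ball 0 r) by exact: measurable_setI_ball.
  apply: (cL1_eq mB (f := fun x => w x * 1)); first by move=> x _; rewrite mulr1.
  by apply: cL1_mul => //; exact: (L2loc_cst 1 mD r).
have w0 psi : test_function D psi -> cint D (fun x => w x * (psi x)%:C) = 0.
  move=> tp; have tdp := test_pderiv i tp.
  rewrite (cint_eq (g := fun x => g x * (psi x)%:C - h x * (psi x)%:C)); last by move=> x _; rewrite mulrBl.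
  rewrite cintB//; [|exact: cL1_testr tp Lg|exact: cL1_testr tp Lh].
  apply/eqP; rewrite subr_eq0 -eqr_opp -wu// -wv//; apply/eqP.
  apply: cint_ae => //; [exact: cL1_meas (cL1_testr mD tdp Lu)|exact: cL1_meas (cL1_testr mD tdp Lv)|].
  by apply: filterS uv => x h' Dx; rewrite h'.
have aR := @du_Bois_Reymond R n chi D (fun x => complex.Re (w x)) hc oD (fun r => (cw r).1).
have aI := @du_Bois_Reymond R n chi D (fun x => complex.Im (w x)) hc oD (fun r => (cw r).2).
have {}aR := aR _; have {}aI := aI _.
have : {ae mu, forall x, D x -> complex.Re (w x) = 0}.
  apply: aR => psi tp; have := congr1 (@complex.Re R) (w0 _ tp) => /= <-.
  by apply: Rint_eq => x _; rewrite ReM /= mulr0 subr0.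
have : {ae mu, forall x, D x -> complex.Im (w x) = 0}.
  apply: aI => psi tp; have := congr1 (@complex.Im R) (w0 _ tp) => /= <-.
  by apply: Rint_eq => x _; rewrite ImM /= mulr0 add0r.
apply: filterS2 => x hI hR Dx; apply/eqP; rewrite -subr_eq0; apply/eqP.
by apply: complex_ext; [exact: hR|exact: hI].
Qed.
End weak_partial.

(** * Separated functions on cylinders *)

Section cylinder.
Context {R : realType} {n : nat}.
Local Notation C := R[i].
Local Notation leb1 := (@lebesgue_measure R).
Variables (om : set 'rV[R]_n) (I : set (measurableTypeR R)).
Hypotheses (mo : measurable om) (mI : measurable I).
Implicit Type phi : 'rV[R]_n -> R.

Lemma cmeas_phi phi : L2 om (fun y => (phi y)%:C) ->
  cmeas (cyl om I) (fun x => (phi (ycoord x))%:C).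
Proof.
move=> [mp _ _]; apply: cmeas_real.
apply: (measurable_comp mo _ mp); first by move=> _ [x [ox _] <-].
by apply: measurable_funTS; exact: measurable_ycoord.
Qed.

Lemma L1_sqr phi : L2 om (fun y => (phi y)%:C) -> L1 (leb n) om (fun y => phi y ^+ 2).
Proof.
move=> /(L2P _ mo)[_ h]; apply: L1_eq mo _ h => y _; exact: sqmod_real.
Qed.

Lemma L2_cyl phi (s : measurableTypeR R -> R) (F : 'rV[R]_n.+1 -> C) : L2 om (fun y => (phi y)%:C) ->
  L1 leb1 I s -> cmeas (cyl om I) F ->
  (forall x, cyl om I x -> sqmod (F x) <= phi (ycoord x) ^+ 2 * s (zcoord x)) -> L2 (cyl om I) F.
Proof.
move=> Lp Ls mF hF; have mc := measurable_cyl mo mI.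
exact: (L2_le mc mF (prod_int mo mI (L1_sqr Lp) Ls).1 hF).
Qed.
End cylinder.

Section cylinder_fields.
Context {R : realType} {n : nat}.
Local Notation C := R[i].
Local Notation leb1 := (@lebesgue_measure R).
Variables (om : set 'rV[R]_n) (I : set (measurableTypeR R)).
Hypotheses (mo : measurable om) (mI : measurable I) (lo : (leb n om < +oo)%E).
Variable phi : 'rV[R]_n -> R.
Hypothesis Lp : L2 om (fun y => (phi y)%:C).
Let mc := measurable_cyl mo mI.

Lemma L1_seg (r : R) : L1 leb1 (`[- r, r]%classic : set (measurableTypeR R)) (fun=> 1 : R).
Proof.
apply: continuous_compact_integrable; first exact: segment_compact.
by apply: continuous_subspaceT => x; exact: cst_continuous.
Qed.

Lemma ball_cyl (r : R) : cyl om I `&` ball 0 r `<=` cyl om `[- r, r]%classic.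
Proof.
move=> x [[ox _] xr]; split=> //=; rewrite in_itv/= -ler_norml.
by move: xr; rewrite ball0E/= => /ltW; apply: le_trans; exact: coord_le_norm.
Qed.

Lemma L2loc_phi : L2loc (cyl om I) (fun x => (phi (ycoord x))%:C).
Proof.
move=> r; have mB : measurable (cyl om I `&` ball 0 r) by exact: measurable_setI_ball.
have mS : measurable (`[- r, r]%classic : set (measurableTypeR R)) by exact: measurable_itv.
apply: L2S (@ball_cyl r) _ => //; first exact: measurable_cyl.
apply: (L2_cyl mo mS Lp (L1_seg r)); first exact: cmeas_phi.
by move=> x _; rewrite sqmod_real mulr1.
Qed.

Lemma L1_phi : L1 (leb n) om phi.
Proof.
have c1 : L2 om (fun=> 1 : C).
  apply: (L2_le mo (cmeas_cst _ 1) (b := fun=> sqmod (1 : C))) => //.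
  by apply: (@L1_bounded _ _ _ _ (sqmod (1 : C))) => // x _; rewrite ger0_norm ?sqmod_ge0.
have [h _] := cL1_mul mo Lp c1.
by apply: L1_eq mo _ h => x _; rewrite mulr1.
Qed.

Lemma loc_L1_phi : loc_L1 (fun x : 'rV[R]_n.+1 => (phi \_ om) (ycoord x)).
Proof.
move=> r.
have Lp' : L1 (leb n) setT (phi \_ om).
  by move/(integrable_mkcond _ mo): L1_phi; apply: eq_integrable => // x _; rewrite restrict_EFin.
have mS : measurable (`[- r, r]%classic : set (measurableTypeR R)) by exact: measurable_itv.
have [h _] := prod_int measurableT mS Lp' (L1_seg r).
apply: (L1_eq (f := fun x => (phi \_ om) (ycoord x) * 1)); first exact: measurable_ball_row.
  by move=> x _; rewrite mulr1.
apply: L1S h; [exact: measurable_ball_row|exact: measurable_cyl|].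
move=> x; rewrite ball0E/= => xr; split=> //=; rewrite in_itv/= -ler_norml.
by apply: le_trans (ltW xr); exact: coord_le_norm.
Qed.

(** Extended by 0 outside omega, phi depends on y only and is thus invariant under axial
    translations, which is the situation of [int_pderiv0]. *)
Lemma cyl_ibp0 G : test_function (cyl om I) G ->
  \int[leb n.+1]_(x in cyl om I) (phi (ycoord x) * pderiv ord_max G x) = 0.
Proof.
move=> tG.
have inv (x : 'rV[R]_n.+1) (t : R) : (phi \_ om) (ycoord (t *: delta_mx 0 ord_max + x)) = (phi \_ om) (ycoord x).
  congr (_ _); apply/rowP => j; rewrite !mxE eqxx/= (_ : lift ord_max j == ord_max = false) ?mulr0 ?add0r//.
  by apply/negbTE; rewrite eq_sym neq_lift.
rewrite -[RHS](int_pderiv0 inv loc_L1_phi tG).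
rewrite [RHS](@Rint_support _ _ _ _ (cyl om I))//; last first.
  by move=> x _ nx; rewrite (test_out (test_pderiv ord_max tG) (E := setT))// mulr0.
by apply: Rint_eq => x [ox _]; rewrite patchE mem_set.
Qed.

(** Integration by parts is [cyl_ibp0] for the test function [A psi]. *)
Lemma weak_partial_phi (A : 'rV[R]_n.+1 -> R) : smooth A ->
  weak_partial ord_max (cyl om I) (fun x => (phi (ycoord x))%:C * (A x)%:C)
    (fun x => (phi (ycoord x))%:C * (pderiv ord_max A x)%:C).
Proof.
move=> sA; have LA (a : 'rV[R]_n.+1 -> R) : continuous a -> L2loc (cyl om I) (fun x => (phi (ycoord x))%:C * (a x)%:C).
  move=> ca; apply: L2loc_eq mc _ (L2loc_contM mc ca L2loc_phi) => x _; exact: mulrC.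
have cA := smooth_cont sA; have cdA := smooth_cont (smooth_pderiv ord_max sA).
split; [exact: LA|exact: LA|] => psi tp.
have tAp := testM tp sA; have tdAp := testM tp (smooth_pderiv ord_max sA); have tdp := test_pderiv ord_max tp.
have c1 := cL1_testr mc tdp (LA _ cA); have c2 := cL1_testr mc tp (LA _ cdA).
apply/eqP; rewrite -addr_eq0 -cintD//; apply/eqP.
rewrite (cint_eq (g := fun x => (phi (ycoord x) * pderiv ord_max (fun x => A x * psi x) x)%:C)); last first.
  move=> x _; rewrite (pderivMs ord_max sA tp.1) !rmorphM/= rmorphD/= !rmorphM/=.
  by move: ((A x)%:C) ((pderiv ord_max psi x)%:C) ((psi x)%:C) ((pderiv ord_max A x)%:C) ((phi _)%:C) => *; ring.
apply: complex_ext => /=; first exact: cyl_ibp0.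
exact: Rint_0.
Qed.
End cylinder_fields.

Section axial_fields.
Context {R : realType}.
Local Notation C := R[i].
Local Notation leb1 := (@lebesgue_measure R).

Definition ccont (T : R -> C) :=
  continuous (fun z => complex.Re (T z)) /\ continuous (fun z => complex.Im (T z)).

Lemma ccontM T U : ccont T -> ccont U -> ccont (fun z => T z * U z).
Proof.
move=> [a b] [c d]; split.
  under eq_fun do rewrite ReM; move=> z.
  apply: (@continuousB _ _ _ (fun z => complex.Re (T z) * complex.Re (U z)) (fun z => complex.Im (T z) * complex.Im (U z))).
    by apply: (@continuousM _ _ (fun z => complex.Re (T z)) (fun z => complex.Re (U z))); [exact: a|exact: c].
  by apply: (@continuousM _ _ (fun z => complex.Im (T z)) (fun z => complex.Im (U z))); [exact: b|exact: d].
under eq_fun do rewrite ImM; move=> z.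
apply: (@continuousD _ _ _ (fun z => complex.Re (T z) * complex.Im (U z)) (fun z => complex.Im (T z) * complex.Re (U z))).
  by apply: (@continuousM _ _ (fun z => complex.Re (T z)) (fun z => complex.Im (U z))); [exact: a|exact: d].
by apply: (@continuousM _ _ (fun z => complex.Im (T z)) (fun z => complex.Re (U z))); [exact: b|exact: c].
Qed.

Lemma ccontD T U : ccont T -> ccont U -> ccont (fun z => T z + U z).
Proof.
move=> [a b] [c d]; split.
  under eq_fun do rewrite ReD; move=> z.
  by apply: (@continuousD _ _ _ (fun z => complex.Re (T z)) (fun z => complex.Re (U z))); [exact: a|exact: c].
under eq_fun do rewrite ImD; move=> z.
by apply: (@continuousD _ _ _ (fun z => complex.Im (T z)) (fun z => complex.Im (U z))); [exact: b|exact: d].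
Qed.

Lemma ccont_cst (c : C) : ccont (fun=> c).
Proof. by split=> z; exact: cst_continuous. Qed.

Lemma ccontB T U : ccont T -> ccont U -> ccont (fun z => T z - U z).
Proof.
move=> cT cU; have := ccontD cT (ccontM (ccont_cst (-1)) cU).
by under eq_fun do rewrite mulN1r.
Qed.

Lemma ccont_expi (s a : R) : ccont (fun z => expi (s * a * z)).
Proof.
have c : continuous (fun z : R => s * a * z).
  by move=> z; apply: (@continuousM _ _ (cst (s * a)) (@id R)); [exact: cst_continuous|exact: cvg_id].
split=> z /=.
  by apply: (@continuous_comp _ _ _ (fun z => s * a * z) (@cos R)); [exact: c|exact: continuous_cos].
by apply: (@continuous_comp _ _ _ (fun z => s * a * z) (@sin R)); [exact: c|exact: continuous_sin].
Qed.

Lemma L1_dcutM (chi : R -> R) (hc : cutoff chi) L (I : set (measurableTypeR R)) (a : R -> R) :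
  continuous a -> measurable I -> L1 leb1 I (fun z => dcut chi L z * a z).
Proof.
move=> ca mI.
have : L1 leb1 (setT : set (measurableTypeR R)) (fun z => dcut chi L z * a z).
  apply: (@L1_support _ _ _ leb1 (`[L, L + 1]%classic : set (measurableTypeR R)) setT) => //.
    move=> z _ /= nz; rewrite (dcut0 hc) ?mul0r//; move/negP: nz; rewrite in_itv/= negb_and -!ltNge => /orP[]; by [left|right].
  apply: continuous_compact_integrable; first exact: segment_compact.
  apply: continuous_subspaceT => z; apply: (@continuousM _ _ (dcut chi L) a); last exact: ca.
  exact: continuous_dcut.
exact: L1S.
Qed.

Lemma cmeas_zcoord n (D : set 'rV[R]_n.+1) T : measurable D -> ccont T -> cmeas D (fun x => T (zcoord x)).
Proof.
move=> mD [a b]; split.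
  apply: continuous_measurable_row => // x.
  by apply: (@continuous_comp _ _ _ (@zcoord R n) (fun z => complex.Re (T z))); [exact: continuous_zcoord|exact: a].
apply: continuous_measurable_row => // x.
by apply: (@continuous_comp _ _ _ (@zcoord R n) (fun z => complex.Im (T z))); [exact: continuous_zcoord|exact: b].
Qed.

Section separated_fields.
Variables (n : nat) (om : set 'rV[R]_n) (J : nat) (phi : 'I_J -> 'rV[R]_n -> R).
Hypotheses (mo : measurable om) (Lp : forall m, L2 om (fun y => (phi m y)%:C)).
Hypothesis ortho : forall m l, \int[leb n]_(y in om) (phi m y * phi l y) = (m == l)%:R.

Definition sep (F : 'I_J -> R -> C) (x : 'rV[R]_n.+1) : C :=
  \sum_(m < J) (phi m (ycoord x))%:C * F m (zcoord x).

Lemma sepM F G x : sep F x * sep G x =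
  \sum_(m < J) \sum_(l < J) (phi m (ycoord x) * phi l (ycoord x))%:C * (F m (zcoord x) * G l (zcoord x)).
Proof.
rewrite /sep mulr_suml; apply: eq_bigr => m _; rewrite mulr_sumr; apply: eq_bigr => l _.
rewrite rmorphM/=.
by move: ((phi m _)%:C) ((phi l _)%:C) (F m _) (G l _) => *; ring.
Qed.

(** Bounded amplitudes do not decay in z, so square integrability comes from the weight [- beta];
    [weighted_cL1] balances it against the weight [beta] of the remainders. *)
Lemma L2_sep (beta : R) F (M : R) : 0 < beta -> (forall m, ccont (F m)) ->
  (forall m z, sqmod (F m z) <= M) -> L2 (cyl om `]1, +oo[%classic) (weighted (- beta) (sep F)).
Proof.
move=> b0 cF FM; have mI : measurable (`]1, +oo[%classic : set (measurableTypeR R)) by exact: measurable_itv.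
have mc := measurable_cyl mo mI.
rewrite (_ : weighted _ _ = fun x => \sum_(m < J)
    (expR (- beta * zcoord x))%:C * ((phi m (ycoord x))%:C * F m (zcoord x))); last first.
  by apply/funext => x; rewrite /weighted /sep mulr_sumr.
apply: L2_sum => // m.
have b2 : 0 < beta + beta by rewrite addr_gt0.
apply: (L2_cyl mo mI (Lp m) (L1Z M (mI) (L1_expR b2))).
  apply: cmeasM; last by apply: cmeasM; [exact: cmeas_phi|exact: cmeas_zcoord].
  apply: (@cmeas_zcoord _ _ (fun z => (expR (- beta * z))%:C)) => //; split => z /=; last exact: cst_continuous.
  apply: (@continuous_comp _ _ _ (fun z => - beta * z) (@expR R)); last exact: continuous_expR.
  by apply: (@continuousM _ _ (cst (- beta)) (@id R)); [exact: cst_continuous|exact: cvg_id].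
move=> x _; rewrite !sqmodM !sqmod_real.
have -> : expR (- (beta + beta) * zcoord x) = expR (- beta * zcoord x) ^+ 2.
  by rewrite expr2 -expRD; congr expR; ring.
rewrite mulrCA; apply: ler_wpM2l; first exact: sqr_ge0.
by rewrite mulrC; apply: ler_wpM2r; [exact: sqr_ge0|exact: FM].
Qed.

(** Orthonormality of the [phi m] removes the terms with distinct indices. On the diagonal the
    factor in z is the constant [c m] times [dcut], whose integral is -1. *)
Lemma sep_int (chi : R -> R) L F G F' G' (c : 'I_J -> C) : cutoff chi -> 1 < L ->
  (forall m, ccont (F m)) -> (forall m, ccont (G m)) ->
  (forall m, ccont (F' m)) -> (forall m, ccont (G' m)) ->
  (forall m z, F m z * G m z - F' m z * G' m z = c m) ->
  cL1 (cyl om `]1, +oo[%classic)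
    (fun x => (dcut chi L (zcoord x))%:C * (sep F x * sep G x - sep F' x * sep G' x)) /\
  cint (cyl om `]1, +oo[%classic)
    (fun x => (dcut chi L (zcoord x))%:C * (sep F x * sep G x - sep F' x * sep G' x)) =
  - \sum_m c m.
Proof.
move=> hc L1' cF cG cF' cG' hFG.
have mI : measurable (`]1, +oo[%classic : set (measurableTypeR R)) by exact: measurable_itv.
have mc := measurable_cyl mo mI.
pose T m l z := (dcut chi L z)%:C * (F m z * G l z - F' m z * G' l z).
have E x : (dcut chi L (zcoord x))%:C * (sep F x * sep G x - sep F' x * sep G' x) =
    \sum_(m < J) \sum_(l < J) (phi m (ycoord x) * phi l (ycoord x))%:C * T m l (zcoord x).
  rewrite !sepM -sumrB mulr_sumr; apply: eq_bigr => m _; rewrite -sumrB mulr_sumr; apply: eq_bigr => l _.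
  rewrite /T; move: ((phi m _ * _)%:C) ((dcut _ _ _)%:C) (F m _) (G l _) (F' m _) (G' l _) => *; ring.
have LT m l : ccont (fun z => F m z * G l z - F' m z * G' l z).
  by apply: ccontB; exact: ccontM.
have LR m l : L1 leb1 `]1, +oo[%classic (fun z => complex.Re (T m l z)).
  apply: L1_eq mI _ (L1_dcutM hc L (LT m l).1 mI) => z _.
  by rewrite /T [in RHS]ReM /= mul0r subr0.
have LI m l : L1 leb1 `]1, +oo[%classic (fun z => complex.Im (T m l z)).
  apply: L1_eq mI _ (L1_dcutM hc L (LT m l).2 mI) => z _.
  by rewrite /T [in RHS]ImM /= mul0r addr0.
have Lpp m l : L1 (leb n) om (fun y => phi m y * phi l y).
  have [h _] := cL1_mul mo (Lp m) (Lp l).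
  by apply: L1_eq mo _ h => y _; rewrite ReM /= mulr0 subr0.
have H m l := cprod_int mo mI (Lpp m l) (LR m l) (LI m l).
have H1 m l := (H m l).1; have H2 m l := (H m l).2.
split.
  apply: (cL1_eq mc (fun x _ => esym (E x))).
  by apply: cL1_sum => // m; apply: cL1_sum => // l; exact: H1.
rewrite (cint_eq (fun x _ => E x)) cint_sum//; last by move=> m; apply: cL1_sum => // l; exact: H1.
rewrite -sumrN; apply: eq_bigr => m _.
rewrite cint_sum//.
rewrite (bigD1 m)//= big1 ?addr0; last first.
  by move=> l lm; rewrite H2 ortho eq_sym (negbTE lm) mul0r.
rewrite H2 ortho eqxx mul1r.
have ID := L1_dcut hc L mI.
have K (r : R) (f : R -> R) : (forall z, f z = dcut chi L z * r) -> \int[leb1]_(z in `]1, +oo[) f z = - r.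
  move=> hf; rewrite (_ : \int[leb1]_(z in `]1, +oo[) f z = \int[leb1]_(z in `]1, +oo[) (r * dcut chi L z)); last first.
    by apply: Rint_eq => z _; rewrite hf mulrC.
  by rewrite RintegralZl// int_dcut// mulrN1.
rewrite (K (complex.Re (c m))); last by move=> z; rewrite /T hFG ReM /= mul0r subr0.
rewrite (K (complex.Im (c m))); last by move=> z; rewrite /T hFG ImM /= mul0r addr0.
by case: (c m).
Qed.
End separated_fields.
End axial_fields.

(** * Exponential weights *)

Section weighted.
Context {R : realType} {n : nat}.
Local Notation C := R[i].
Implicit Types (D : set 'rV[R]_n.+1) (f g : 'rV[R]_n.+1 -> C).

Lemma weightedD (a b : R) f x : weighted a (weighted b f) x = weighted (a + b) f x.
Proof. by rewrite /weighted mulrA -rmorphM/= -expRD mulrDl. Qed.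

Lemma weighted0 f x : weighted 0 f x = f x.
Proof. by rewrite /weighted mul0r expR0 mul1r. Qed.

Lemma smooth_expz (b : R) : smooth (fun x : 'rV[R]_n.+1 => expR (b * zcoord x)).
Proof.
rewrite (_ : (fun x => _) = fun x : 'rV[R]_n.+1 => expR (b * x 0 ord_max + 0)).
  exact: (smooth_affine _ b 0 (@smooth1_expR R)).
by apply/funext => x; rewrite addr0.
Qed.

Lemma pderiv_expz (b : R) i (x : 'rV[R]_n.+1) :
  pderiv i (fun x : 'rV[R]_n.+1 => expR (b * zcoord x)) x = (ord_max == i)%:R * (b * expR (b * zcoord x)).
Proof.
have h := pderiv_coord ord_max i (fun z => is_derive_affine b 0 z (@is_derive_expR R)).
rewrite (_ : (fun x : 'rV[R]_n.+1 => _) = fun x : 'rV[R]_n.+1 => expR (b * x 0 ord_max + 0)); last first.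
  by apply/funext => y; rewrite addr0.
by rewrite h addr0.
Qed.

Lemma L2_weighted_cmeas D (a : R) f : measurable D -> L2 D (weighted a f) -> cmeas D f.
Proof.
move=> mD /L2_cmeas mf; rewrite (_ : f = fun x => (expR (- a * zcoord x))%:C * weighted a f x).
  by apply: cmeasM => //; apply: cmeasR => //; apply: smooth_cont; exact: smooth_expz.
by apply/funext => x; rewrite -[RHS]/(weighted (- a) (weighted a f) x) weightedD addNr weighted0.
Qed.

Lemma weighted_cL1 D (beta : R) f g : measurable D ->
  L2 D (weighted (- beta) f) -> L2 D (weighted beta g) -> cL1 D (fun x => f x * g x).
Proof.
move=> mD Lf Lg; apply: cL1_eq mD _ (cL1_mul mD Lf Lg) => x _.
rewrite /weighted mulrACA -rmorphM/= -expRD mulNr addNr expR0 rmorph1.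
by rewrite mul1r.
Qed.

Lemma weighted_neg D (beta : R) f : 0 <= beta -> measurable D -> (forall x, D x -> 0 <= zcoord x) ->
  L2 D (weighted beta f) -> L2 D (weighted (- beta) f).
Proof.
move=> b0 mD D0 Lf.
have -> : weighted (- beta) f = fun x => (expR (- (beta + beta) * zcoord x))%:C * weighted beta f x.
  apply/funext => x; rewrite -[RHS]/(weighted (- (beta + beta)) (weighted beta f) x) weightedD.
  by rewrite opprD addrNK.
apply: (L2M mD _ (M := 1)) => //.
  by apply: cmeasR => //; apply: smooth_cont; exact: smooth_expz.
move=> x /D0 x0; rewrite sqmod_real expr_le1 ?expR_ge0// -expR0 ler_expR.
by rewrite mulNr oppr_le0 mulr_ge0// addr_ge0.
Qed.
End weighted.

(** * Propagating waves and their flux *)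

Section waves.
Context {R : realType} {n : nat}.
Local Notation C := R[i].
Variables (om : set 'rV[R]_n) (J : nat) (lam : nat -> R) (phi : nat -> 'rV[R]_n -> R) (lambda : R).
Hypotheses (oo : open om) (lo : (leb n om < +oo)%E).
Hypothesis Lp : forall m, L2 om (fun y => (phi m y)%:C).
Hypothesis ortho : forall m l, \int[leb n]_(y in om) (phi m y * phi l y) = (m == l)%:R.
Hypothesis lamJ : forall m : 'I_J, lam m < lambda.
Let mo : measurable om := open_measurable_row oo.
Let al (m : nat) := Num.sqrt (lambda - lam m).
Let ka (m : nat) := (Num.sqrt (2 * al m))^-1.
Implicit Types p q : 'I_J -> C.

Let al0 (m : 'I_J) : 0 < al m.
Proof. by rewrite sqrtr_gt0 subr_gt0. Qed.

Let phiJ (m : 'I_J) := phi m.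

Let cplxE (a b : R) : (a +i* b : C) = a%:C + 'i%C * b%:C.
Proof. by apply: complex_ext; rewrite ?(ReD, ImD, ReM, ImM) /= !(mul0r, mulr0, mul1r, subr0, addr0, add0r). Qed.

Definition amp p q (m : 'I_J) (z : R) : C :=
  (ka m)%:C * (p m * expi (- 1 * al m * z) + q m * expi (1 * al m * z)).

Definition wave p q (x : 'rV[R]_n.+1) : C :=
  \sum_(m < J) (p m * mode lambda lam phi (- 1) m x + q m * mode lambda lam phi 1 m x).

(* The axial derivative of [wave p q] is [wave (dzm p) (dzp q)]. *)
Definition dzm p (m : 'I_J) : C := - (0 +i* al m) * p m.
Definition dzp q (m : 'I_J) : C := (0 +i* al m) * q m.

Lemma waveE p q x : wave p q x = sep phiJ (amp p q) x.
Proof.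
apply: eq_bigr => m _; rewrite /mode /amp /phiJ -/(al m) -/(ka m).
by move: ((ka m)%:C) (expi _) (expi _) ((phi m _)%:C) (p m) (q m) => *; ring.
Qed.

Lemma ccont_amp p q m : ccont (amp p q m).
Proof.
apply: ccontM; first exact: ccont_cst.
by apply: ccontD; apply: ccontM; solve [exact: ccont_cst|exact: ccont_expi].
Qed.

Lemma amp_bounded p q : exists M, forall m z, sqmod (amp p q m z) <= M.
Proof.
pose B (m : 'I_J) := sqmod ((ka m)%:C) * (2 * (sqmod (p m) + sqmod (q m))).
have B0 m : 0 <= B m by apply: mulr_ge0; [exact: sqmod_ge0|apply: mulr_ge0 => //; apply: addr_ge0; exact: sqmod_ge0].
exists (\sum_m B m) => m z.
apply: (@le_trans _ _ (B m)); last by rewrite (bigD1 m)//= lerDl; apply: sumr_ge0 => l _; exact: B0.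
rewrite sqmodM; apply: ler_wpM2l; first exact: sqmod_ge0.
by apply: le_trans (sqmodD _ _) _; rewrite !sqmodM !sqmod_expi !mulr1.
Qed.

(** Products of equal exponentials cancel, products of opposite ones are 1, and the normalization
    [2 * al m * ka m ^ 2 = 1] leaves a bare factor i, independently of z. *)
Lemma wronskian p q p' q' m z :
  amp (dzm p) (dzp q) m z * amp p' q' m z - amp (dzm p') (dzp q') m z * amp p q m z =
  'i%C * (q m * p' m - p m * q' m).
Proof.
have HE : expi (- 1 * al m * z) * expi (1 * al m * z) = 1.
  by rewrite -expiD -expi0; congr expi; ring.
have Hk : (ka m)%:C * (ka m)%:C * (0 +i* al m) * 2%:R = 'i%C.
  have k2 : ka m * ka m * al m * 2 = 1.
    rewrite -expr2 /ka exprVn sqr_sqrtr; last by rewrite mulr_ge0 ?ltW.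
    by rewrite -mulrA [al m * 2]mulrC mulVf// mulf_neq0// lt0r_neq0.
  have i2 : (2%:R : C) = (2 : R)%:C by rewrite rmorph_nat.
  by rewrite i2; apply: complex_ext; rewrite !(ReM, ImM) /= !(mul0r, mulr0, subr0, addr0, sub0r, add0r, oppr0).
rewrite -[RHS]mul1r -{1}HE -Hk /amp /dzm /dzp.
move: ((ka m)%:C) (0 +i* al m) (expi _) (expi _) (p m) (q m) (p' m) (q' m) => *; ring.
Qed.

(** [weak_partial_phi] takes real smooth factors, hence cosines and sines in place of exponentials:
    the cosine carries [p m + q m] and the sine [i (q m - p m)]. *)
Lemma wave_partial (I : set (measurableTypeR R)) p q : measurable I ->
  weak_partial ord_max (cyl om I) (wave p q) (wave (dzm p) (dzp q)).
Proof.
move=> mI; have mc := measurable_cyl mo mI.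
(* The [+ 0] gives the arguments the shape of [smooth_affine] and [is_derive_affine]. *)
pose cz m (x : 'rV[R]_n.+1) := cos (al m * x 0 ord_max + 0).
pose sz m (x : 'rV[R]_n.+1) := sin (al m * x 0 ord_max + 0).
have scz m : smooth (cz m) by exact: (smooth_affine _ (al m) 0 (@smooth1_cos R)).
have ssz m : smooth (sz m) by exact: (smooth_affine _ (al m) 0 (@smooth1_sin R)).
have dcz m x : pderiv ord_max (cz m) x = - (al m * sz m x).
  by rewrite (pderiv_coord ord_max ord_max (fun z => is_derive_affine (al m) 0 z (@is_derive_cos R)))// eqxx mul1r mulrN.
have dsz m x : pderiv ord_max (sz m) x = al m * cz m x.
  by rewrite (pderiv_coord ord_max ord_max (fun z => is_derive_affine (al m) 0 z (@is_derive_sin R)))// eqxx mul1r.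
have H (m : 'I_J) := weak_partialD mc
  (weak_partialZ ((ka m)%:C * (p m + q m)) mc (weak_partial_phi mo mI lo (Lp m) (scz m)))
  (weak_partialZ ((ka m)%:C * 'i%C * (q m - p m)) mc (weak_partial_phi mo mI lo (Lp m) (ssz m))).
apply: (weak_partial_eq mc _ _ (weak_partial_sum (index_enum 'I_J) mc H)) => x _.
  rewrite waveE; apply: eq_bigr => m _; rewrite /amp /phiJ /expi.
  rewrite !mulN1r !mulNr cosN sinN !mul1r /cz /sz !addr0 -/(zcoord x).
  set t := al m * zcoord x; rewrite (cplxE (cos t) (- sin t)) (cplxE (cos t) (sin t)) rmorphN /=.
  by move: ('i%C : C) ((ka m)%:C) ((cos _)%:C) ((sin _)%:C) (p m) (q m) ((phi m _)%:C) => *; ring.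
rewrite waveE; apply: eq_bigr => m _; rewrite dcz dsz /amp /phiJ /expi /dzm /dzp.
rewrite !mulN1r !mulNr cosN sinN !mul1r /cz /sz !addr0 -/(zcoord x).
set t := al m * zcoord x; rewrite (cplxE (cos t) (- sin t)) (cplxE (cos t) (sin t)) (cplxE 0 (al m)).
have i2 : ('i%C : C) * 'i%C = -1 by rewrite -expr2 sqr_i.
rewrite add0r !rmorphN !rmorphM /=.
move: i2; move: ('i%C : C) ((ka m)%:C) ((cos _)%:C) ((sin _)%:C) (p m) (q m) ((phi m _)%:C) ((al m)%:C) => i k c s P Q f a hi.
have -> : f * (k * (- (i * a * P * (c + i * - s)) + i * a * Q * (c + i * s))) =
    f * k * a * (i * c * (Q - P) + (i * i) * s * (P + Q)) by ring.
by rewrite hi; ring.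
Qed.

(** Where z > 1 the cut-off of the expansion is identically 1, and the cylinder is open, as the du
    Bois-Reymond lemma requires. *)
Let I1 : set (measurableTypeR R) := `]1, +oo[%classic.
Let D1 := cyl om I1.
Let mI1 : measurable I1. Proof. exact: measurable_itv. Qed.
Let mD1 : measurable D1. Proof. exact: measurable_cyl. Qed.

Lemma cyl1_gt1 x : D1 x -> 1 < zcoord x.
Proof. by move=> [_]; rewrite /I1 /= in_itv/= andbT. Qed.

Let D1_ge0 x : D1 x -> 0 <= zcoord x.
Proof. by move/cyl1_gt1 => /(lt_trans ltr01)/ltW. Qed.

Lemma open_cyl1 : open D1.
Proof.
rewrite (_ : D1 = (@ycoord R n @^-1` om) `&` (@zcoord R n @^-1` [set z | 1 < z])).
  apply: openI; first by apply: open_comp => // x _; exact: continuous_ycoord.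
  by apply: open_comp; [move=> x _; exact: continuous_zcoord|exact: open_gt].
by apply/seteqP; split=> x; rewrite /D1 /cyl /I1 /= in_itv/= andbT.
Qed.

Lemma L2_wave beta p q : 0 < beta -> L2 D1 (weighted (- beta) (wave p q)).
Proof.
move=> b0; have [M hM] := amp_bounded p q.
rewrite (_ : wave p q = sep phiJ (amp p q)); last by apply/funext => x; exact: waveE.
by apply: (L2_sep mo (fun m => Lp m) b0) hM => m; exact: ccont_amp.
Qed.

(** At a fixed x the factor [dcut] is 0 as soon as L exceeds [zcoord x], and it is bounded uniformly
    in L. The integrals therefore tend to 0 by dominated convergence; being constant, they are 0. *)
Lemma dcut_cint_lim (chi : R -> R) (F : 'rV[R]_n.+1 -> C) (e : C) : cutoff chi -> cL1 D1 F ->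
  (forall L : nat, cint D1 (fun x => (dcut chi (L%:R + 2) (zcoord x))%:C * F x) = e) -> e = 0.
Proof.
move=> hc [LR LI] he; have [M M0 hM] := dcut_bounded hc.
have H (f : 'rV[R]_n.+1 -> R) (r : R) : L1 (leb n.+1) D1 f ->
    (forall L : nat, \int[leb n.+1]_(x in D1) (dcut chi (L%:R + 2) (zcoord x) * f x) = r) -> r = 0.
  move=> Lf hr; have mf := L1_measurable Lf.
  have cv : \int[leb n.+1]_(x in D1) (dcut chi (L%:R + 2) (zcoord x) * f x) @[L --> \oo] -->
      \int[leb n.+1]_(x in D1) (0 : R).
    apply: (Rint_dct mD1 _ _ (L1Z M mD1 (L1_norm Lf))).
    - move=> L; apply: measurable_funM => //; apply: continuous_measurable_row => //.
      move=> x; apply: (@continuous_comp _ _ _ (@zcoord R n) (dcut chi (L%:R + 2))).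
        exact: continuous_zcoord.
      exact: continuous_dcut.
    - move=> x _; apply: (@cvg_near_cst _ _ _ _ _ _).
      near=> L; rewrite dcut0 ?mul0r//; left.
      have : zcoord x < L%:R by near: L; exact: nbhs_infty_gtr.
      by move=> h; apply: lt_le_trans h _; rewrite lerDl.
    - by move=> L x _; rewrite normrM ler_wpM2r.
  rewrite Rint_0// in cv; apply: (cvg_unique _ _ cv) => //.
  rewrite (_ : (fun L : nat => _) = fun=> r); first exact: cvg_cst.
  by apply/funext => L; exact: hr.
apply: complex_ext; apply: H; [exact: LR| |exact: LI|] => L.
  rewrite -(he L) /=; apply: Rint_eq => x _; by rewrite ReM /= mul0r subr0.
rewrite -(he L) /=; apply: Rint_eq => x _; by rewrite ImM /= mul0r addr0.
Unshelve. all: by end_near.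
Qed.

(** The flux density is the sum of a modal part Y, with the same integral for every L by [sep_int],
    and of X, each term of which contains a remainder. The weight of that remainder compensates the
    growth allowed to the other factor, so X is integrable and [dcut_cint_lim] applies to it. The
    shift [L + 2] keeps every slab beyond z = 1. *)
Lemma flux_limit (chi : R -> R) beta p q p' q' r rz r' rz' (c : C) : cutoff chi -> 0 < beta ->
  L2 D1 (weighted beta r) -> L2 D1 (weighted beta rz) ->
  L2 D1 (weighted beta r') -> L2 D1 (weighted beta rz') ->
  (forall L : nat, cint D1 (fun x => (dcut chi (L%:R + 2) (zcoord x))%:C *
     ((wave (dzm p) (dzp q) x + rz x) * (wave p' q' x + r' x) -
      (wave (dzm p') (dzp q') x + rz' x) * (wave p q x + r x))) = c) ->
  c = - \sum_m 'i%C * (q m * p' m - p m * q' m).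
Proof.
move=> hc b0 Lr Lrz Lr' Lrz' H.
have neg f : L2 D1 (weighted beta f) -> L2 D1 (weighted (- beta) f).
  exact: (weighted_neg (ltW b0) mD1 D1_ge0).
have LDn a f : L2 D1 (weighted (- beta) a) -> L2 D1 (weighted beta f) -> L2 D1 (weighted (- beta) (fun x => a x + f x)).
  move=> La /neg Lf; have := L2D mD1 La Lf.
  by rewrite (_ : (fun x => _ + _) = weighted (- beta) (fun x => a x + f x))//; apply/funext => x; rewrite /weighted mulrDr.
set w := wave p q in H *; set wz := wave (dzm p) (dzp q) in H *.
set w' := wave p' q' in H *; set wz' := wave (dzm p') (dzp q') in H *.
have Lw : L2 D1 (weighted (- beta) w) by exact: L2_wave.
have Lwz : L2 D1 (weighted (- beta) wz) by exact: L2_wave.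
have Lw' : L2 D1 (weighted (- beta) w') by exact: L2_wave.
have Lwz' : L2 D1 (weighted (- beta) wz') by exact: L2_wave.
pose X x := (wz x + rz x) * r' x + w' x * rz x - ((wz' x + rz' x) * r x + w x * rz' x).
have LX : cL1 D1 X.
  apply: cL1B => //; apply: cL1D => //; by [exact: weighted_cL1 (LDn _ _ _ _) _|exact: weighted_cL1 Lw' _|exact: weighted_cL1 Lw _].
pose Y x := wz x * w' x - wz' x * w x.
have [M M0 hM] := dcut_bounded hc.
have modal (L : nat) : cL1 D1 (fun x => (dcut chi (L%:R + 2) (zcoord x))%:C * Y x) /\
    cint D1 (fun x => (dcut chi (L%:R + 2) (zcoord x))%:C * Y x) = - \sum_m 'i%C * (q m * p' m - p m * q' m).
  have L2' : 1 < L%:R + 2 :> R by rewrite ltr_wpDl// ltr1n.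
  have := @sep_int R n om J phiJ mo (fun m => Lp m) (fun m l => ortho m l) chi _ _ _ _ _ _ hc L2'
    (fun m => ccont_amp (dzm p) (dzp q) m) (fun m => ccont_amp p' q' m) (fun m => ccont_amp (dzm p') (dzp q') m)
    (fun m => ccont_amp p q m) (fun m z => wronskian p q p' q' m z).
  have E : sep phiJ (amp (dzm p) (dzp q)) = wz by apply/funext => x; rewrite -waveE.
  have E' : sep phiJ (amp p' q') = w' by apply/funext => x; rewrite -waveE.
  have Ez : sep phiJ (amp (dzm p') (dzp q')) = wz' by apply/funext => x; rewrite -waveE.
  have Ew : sep phiJ (amp p q) = w by apply/funext => x; rewrite -waveE.
  by rewrite E E' Ez Ew.
suff : c - (- \sum_m 'i%C * (q m * p' m - p m * q' m)) = 0 by move/eqP; rewrite subr_eq0 => /eqP.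
apply: (dcut_cint_lim hc LX) => L; have [m1 m2] := modal L.
have LdX : cL1 D1 (fun x => (dcut chi (L%:R + 2) (zcoord x))%:C * X x).
  apply: (cL1_mulr mD1 _ (M := M)) LX => [|x _]; last exact: hM.
  apply: continuous_measurable_row => // x.
  apply: (@continuous_comp _ _ _ (@zcoord R n) (dcut chi (L%:R + 2))); first exact: continuous_zcoord.
  exact: continuous_dcut.
rewrite -(H L) -m2 -cintB//; last first.
  apply: cL1_eq mD1 _ (cL1D mD1 m1 LdX) => x _; rewrite /X /Y.
  by move: ((dcut _ _ _)%:C) (w x) (wz x) (w' x) (wz' x) (r x) (rz x) (r' x) (rz' x) => *; ring.
apply: cint_eq => x _; rewrite /X /Y.
by move: ((dcut _ _ _)%:C) (w x) (wz x) (w' x) (wz' x) (r x) (rz x) (r' x) (rz' x) => *; ring.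
Qed.

(** The weighted space gives a gradient to [e^(beta z) ut]. Leibniz' rule after multiplication by
    [e^(- beta z)] yields the axial derivative of [ut], and uniqueness of weak derivatives
    identifies the sum with [gz]. *)
Lemma axial_derivative (chi : R -> R) beta p q u gz ut (gt : 'I_n.+1 -> 'rV[R]_n.+1 -> C) : cutoff chi ->
  weak_partial ord_max D1 u gz -> H1loc D1 (weighted beta ut) gt ->
  (forall x, D1 x -> u x = wave p q x + ut x) ->
  {ae leb n.+1, forall x, D1 x ->
     gz x = wave (dzm p) (dzp q) x + (weighted (- beta) (gt ord_max) x - beta%:C * ut x)}.
Proof.
move=> hc wu [Lut Lgt wt] uE.
have wg := weak_grad_smoothM mD1 Lut Lgt wt (smooth_expz (- beta)).
have ca := smooth_cont (@smooth_expz R n (- beta)).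
have cda := smooth_cont (smooth_pderiv ord_max (@smooth_expz R n (- beta))).
have w1 : weak_partial ord_max D1 ut (fun x => weighted (- beta) (gt ord_max) x - beta%:C * ut x).
  have E x : (expR (- beta * zcoord x))%:C * weighted beta ut x = ut x.
    by rewrite -[LHS]/(weighted (- beta) (weighted beta ut) x) weightedD addNr weighted0.
  apply: (weak_partial_eq mD1 (fun x _ => E x) _ (And3 _ _ (fun psi => wg ord_max psi))).
  - by move=> x _; rewrite pderiv_expz eqxx mul1r rmorphM/= -mulrA E rmorphN/= (mulNr (beta%:C)).
  - exact: L2loc_contM.
  - by apply: L2locD => //; exact: L2loc_contM.
have w2 := weak_partialD mD1 (wave_partial p q mI1) w1.
apply: (weak_partial_uniq hc open_cyl1 _ wu w2).
by apply: aeW => x; exact: uE.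
Qed.

Lemma L2_axial_remainder beta ut gz : L2 D1 (weighted beta ut) -> L2 D1 gz ->
  L2 D1 (weighted beta (fun x => weighted (- beta) gz x - beta%:C * ut x)).
Proof.
move=> Lu Lg; rewrite (_ : weighted _ _ = fun x => gz x - beta%:C * weighted beta ut x).
  by apply: L2B => //; exact: L2Z.
apply/funext => x; rewrite -{1}(weighted0 gz) -(subrr beta) -weightedD /weighted mulrBr.
by congr (_ - _); rewrite mulrCA.
Qed.
End waves.

(** * Expansions at infinity *)

Section asymptotics.
Context {R : realType} {n : nat}.
Local Notation C := R[i].
Variables (om : set 'rV[R]_n) (J : nat) (lam : nat -> R) (phi : nat -> 'rV[R]_n -> R) (lambda beta : R).
Hypotheses (oo : open om) (lo : (leb n om < +oo)%E).
Hypothesis Lp : forall m, L2 om (fun y => (phi m y)%:C).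
Hypothesis ortho : forall m l, \int[leb n]_(y in om) (phi m y * phi l y) = (m == l)%:R.
Hypothesis lamJ : forall m : 'I_J, lam m < lambda.
Hypothesis beta0 : 0 < beta.
Let mo : measurable om := open_measurable_row oo.
Let D1 := cyl om (`]1, +oo[%classic : set (measurableTypeR R)).
Let mI1 : measurable (`]1, +oo[%classic : set (measurableTypeR R)). Proof. exact: measurable_itv. Qed.
Let mD1 : measurable D1. Proof. exact: measurable_cyl. Qed.
Implicit Types p q : 'I_J -> C.
Local Notation wave := (wave lam phi lambda).
Local Notation dzm := (dzm lam lambda).
Local Notation dzp := (dzp lam lambda).

(** The expansion of u holds at every point, as in [scattering_solution]; that of uz holds almost
    everywhere, a weak derivative being determined only up to null sets. *)
Definition asym p q (u uz : 'rV[R]_n.+1 -> C) := exists r rz,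
  [/\ L2 D1 (weighted beta r), L2 D1 (weighted beta rz),
      forall x, D1 x -> u x = wave p q x + r x &
      {ae leb n.+1, forall x, D1 x -> uz x = wave (dzm p) (dzp q) x + rz x}].

Lemma weighted_0 : L2 D1 (weighted beta (fun=> 0)).
Proof. by rewrite (_ : weighted _ _ = fun=> 0); [exact: L2_0|apply/funext => x; rewrite /weighted mulr0]. Qed.

Lemma asym_wave p q : asym p q (wave p q) (wave (dzm p) (dzp q)).
Proof.
exists (fun=> 0), (fun=> 0); split; [exact: weighted_0|exact: weighted_0|by move=> x _; rewrite addr0|].
by apply: aeW => x _; rewrite addr0.
Qed.

Lemma asym_solution (chi : R -> R) p q u gz ut (gt : 'I_n.+1 -> 'rV[R]_n.+1 -> C) : cutoff chi ->
  weak_partial ord_max D1 u gz -> H1 D1 (weighted beta ut) gt ->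
  (forall x, D1 x -> u x = wave p q x + ut x) -> asym p q u gz.
Proof.
move=> hc wu [Lu Lg wt] uE.
have Ht : H1loc D1 (weighted beta ut) gt by split=> // [|i]; exact: L2_L2loc.
exists ut, (fun x => weighted (- beta) (gt ord_max) x - beta%:C * ut x); split=> //.
  by apply: L2_axial_remainder => //.
exact: (axial_derivative oo lo Lp hc wu Ht uE).
Qed.

Lemma mode_conj (s : R) j (x : 'rV[R]_n.+1) : (mode lambda lam phi s j x)^*%C = mode lambda lam phi (- s) j x.
Proof. by rewrite /mode !cconjM expi_conj cconjR conjc_real !mulNr. Qed.

(** The [phi m] being real, conjugation exchanges w_m^- and w_m^+, hence the roles of p and q. *)
Lemma wave_conj p q x : (wave p q x)^*%C = wave (fun m => (q m)^*%C) (fun m => (p m)^*%C) x.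
Proof.
rewrite /wave cconj_sum; apply: eq_bigr => m _.
by rewrite cconjD (cconjM (p m)) (cconjM (q m)) !mode_conj opprK addrC.
Qed.

Lemma weighted_conj (a : R) (f : 'rV[R]_n.+1 -> C) : weighted a (fun x => (f x)^*%C) = fun x => (weighted a f x)^*%C.
Proof. by apply/funext => x; rewrite /weighted cconjM cconjR. Qed.

Lemma asym_conj p q u uz : asym p q u uz ->
  asym (fun m => (q m)^*%C) (fun m => (p m)^*%C) (fun x => (u x)^*%C) (fun x => (uz x)^*%C).
Proof.
move=> [r [rz [Lr Lrz uE uzE]]]; exists (fun x => (r x)^*%C), (fun x => (rz x)^*%C); split.
- by rewrite weighted_conj; exact: L2_conj.
- by rewrite weighted_conj; exact: L2_conj.
- by move=> x Dx; rewrite uE// cconjD wave_conj.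
apply: filterS uzE => x h Dx; rewrite h// cconjD wave_conj; congr (wave _ _ _ + _).
  by apply/funext => m; rewrite /dzp /dzm cconjM; congr (_ * _); apply: complex_ext; rewrite ?ReN ?ImN /= ?oppr0.
by apply/funext => m; rewrite /dzp /dzm cconjM; congr (_ * _); apply: complex_ext; rewrite ?Re_conj ?Im_conj ?ReN ?ImN /= ?oppr0 ?opprK.
Qed.

Lemma wave_sum I (s : seq I) (c : I -> C) (p q : I -> 'I_J -> C) x :
  wave (fun m => \sum_(k <- s) c k * p k m) (fun m => \sum_(k <- s) c k * q k m) x =
  \sum_(k <- s) c k * wave (p k) (q k) x.
Proof.
rewrite /wave; under [in RHS]eq_bigr do rewrite mulr_sumr; rewrite exchange_big; apply: eq_bigr => m _ /=.
by rewrite !mulr_suml -big_split; apply: eq_bigr => k _ /=; rewrite mulrDr !mulrA.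
Qed.

Lemma asym_sum K (c : 'I_K -> C) (p q : 'I_K -> 'I_J -> C) (u uz : 'I_K -> 'rV[R]_n.+1 -> C) :
  (forall k, asym (p k) (q k) (u k) (uz k)) ->
  asym (fun m => \sum_k c k * p k m) (fun m => \sum_k c k * q k m)
       (fun x => \sum_k c k * u k x) (fun x => \sum_k c k * uz k x).
Proof.
move=> /choice[r /choice[rz h]].
have Lw (f : 'I_K -> 'rV[R]_n.+1 -> C) : (forall k, L2 D1 (weighted beta (f k))) ->
    L2 D1 (weighted beta (fun x => \sum_k c k * f k x)).
  move=> Lf; rewrite (_ : weighted _ _ = fun x => \sum_k c k * weighted beta (f k) x).
    by apply: L2_sum => // k; exact: L2Z.
  by apply/funext => x; rewrite /weighted mulr_sumr; apply: eq_bigr => k _; rewrite mulrCA.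
exists (fun x => \sum_k c k * r k x), (fun x => \sum_k c k * rz k x); split.
- by apply: Lw => k; have [] := h k.
- by apply: Lw => k; have [] := h k.
- move=> x Dx; rewrite wave_sum -big_split; apply: eq_bigr => k _ /=.
  by have [_ _ uE _] := h k; rewrite uE// mulrDr.
have H : {ae leb n.+1, forall x k, D1 x -> uz k x = wave (dzm (p k)) (dzp (q k)) x + rz k x}.
  by apply: filter_forall => k; have [] := h k.
apply: filterS H => x H Dx.
have -> : dzm (fun m => \sum_k c k * p k m) = fun m => \sum_k c k * dzm (p k) m.
  by apply/funext => m; rewrite /dzm mulr_sumr; apply: eq_bigr => k _; rewrite mulrCA.
have -> : dzp (fun m => \sum_k c k * q k m) = fun m => \sum_k c k * dzp (q k) m.
  by apply/funext => m; rewrite /dzp mulr_sumr; apply: eq_bigr => k _; rewrite mulrCA.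
rewrite wave_sum -big_split; apply: eq_bigr => k _ /=.
by rewrite H// mulrDr.
Qed.

Lemma asym_flux (chi : R -> R) p q p' q' u uz v vz (c : C) : cutoff chi ->
  asym p q u uz -> asym p' q' v vz ->
  cmeas D1 u -> cmeas D1 uz -> cmeas D1 v -> cmeas D1 vz ->
  (forall L : nat, cint D1 (fun x => (dcut chi (L%:R + 2) (zcoord x))%:C * (uz x * v x - vz x * u x)) = c) ->
  c = - \sum_m 'i%C * (q m * p' m - p m * q' m).
Proof.
move=> hc [r [rz [Lr Lrz uE uzE]]] [r' [rz' [Lr' Lrz' vE vzE]]] mu muz mv mvz H.
apply: (flux_limit oo Lp ortho lamJ hc beta0 Lr Lrz Lr' Lrz') => L; rewrite -(H L).
have md : cmeas D1 (fun x => (dcut chi (L%:R + 2) (zcoord x))%:C).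
  apply: cmeasR => // x; apply: (@continuous_comp _ _ _ (@zcoord R n) (dcut chi (L%:R + 2))); first exact: continuous_zcoord.
  exact: continuous_dcut.
have ms f g : L2 D1 (weighted (- beta) f) -> L2 D1 (weighted beta g) -> cmeas D1 (fun x => f x + g x).
  by move=> /(L2_weighted_cmeas mD1) mf /(L2_weighted_cmeas mD1) mg; exact: cmeasD.
have Lw (P Q : 'I_J -> C) : L2 D1 (weighted (- beta) (wave P Q)) by exact: L2_wave.
apply: cint_ae => //.
- by apply: cmeasM => //; apply: cmeasD; [|apply: cmeasN]; apply: cmeasM; exact: ms.
- by apply: cmeasM => //; apply: cmeasD; [|apply: cmeasN]; apply: cmeasM.
apply: filterS2 uzE vzE => x h h' Dx.
by rewrite h// h'// uE// vE.
Qed.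
End asymptotics.

(** * The equation in the sense of distributions *)

Section helmholtz.
Context {R : realType} {n : nat}.
Local Notation C := R[i].
Implicit Types (D : set 'rV[R]_n) (k u : 'rV[R]_n -> C).

(** A test function is an admissible argument of the variational formulation: its integration by
    parts is [int_pderiv0] for the constant 1 and a product of test functions. *)
Lemma weak_grad_test D psi : measurable D -> test_function D psi ->
  H1 D (fun x => (psi x)%:C) (fun i x => (pderiv i psi x)%:C).
Proof.
move=> mD tp.
have L f : test_function D f -> L2 D (fun x => (f x)%:C).
  move=> tf; have := L2loc_L2 mD (smooth_cont tf.1) (@test_bsupp _ _ D D _ tf) (L2loc_cst 1 mD).
  by under eq_fun do rewrite mulr1.
split; [exact: L|by move=> i; apply: L; exact: test_pderiv|] => i f tf.
have tfp := testM tf tp.1; have tdf := test_pderiv i tf; have tdp := test_pderiv i tp.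
have L1' : cL1 D (fun x => (psi x)%:C * (pderiv i f x)%:C) := cL1_testr mD tdf (L2_L2loc mD (L _ tp)).
have L2' : cL1 D (fun x => (pderiv i psi x)%:C * (f x)%:C) := cL1_testr mD tf (L2_L2loc mD (L _ tdp)).
apply/eqP; rewrite -addr_eq0 -cintD//; apply/eqP.
have L1c : loc_L1 (fun _ : 'rV[R]_n => 1 : R).
  move=> r; apply: (@L1_bounded _ _ _ _ 1) => //; [exact: measurable_ball_row|exact: leb_ball_lt|].
  by move=> x _; rewrite normr1.
have E := @int_pderiv0 R n i (fun=> 1) _ D (fun _ _ => erefl) L1c tfp.
rewrite (cint_eq (g := fun x => (pderiv i (fun x => psi x * f x) x)%:C)); last first.
  by move=> x _; rewrite (pderivMs i tp.1 tf.1) rmorphD/= !rmorphM/= addrC.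
apply: complex_ext => /=; last exact: Rint_0.
rewrite -[RHS]E [RHS](@Rint_support _ _ _ _ D)//; last first.
  by move=> x _ nx; rewrite (test_out (test_pderiv i tfp) (E := setT))// mulr0.
by apply: Rint_eq => x _; rewrite mul1r.
Qed.

(** The variational formulation is tested with psi, then the weak gradient of u with each
    [pderiv i psi]. This is the form of the equation used in [unique_continuation]. *)
Lemma helmholtz_test D k u (g : 'I_n -> 'rV[R]_n -> C) psi : measurable D -> weak_sol D k u g ->
  test_function D psi ->
  cint D (fun x => u x * (laplacian psi x)%:C) = - cint D (fun x => k x * u x * (psi x)%:C).
Proof.
move=> mD [[Lu Lg wu] su] tp.
have := su _ _ (weak_grad_test mD tp).
have [r hr] := @test_bsupp _ _ D D _ tp.
have -> : (exists r : R, forall x, D x -> r < `|x| -> (psi x)%:C = 0) = True.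
  by apply/propeqP; split=> // _; exists r => x Dx xr; rewrite hr.
move=> /(_ I) <-.
have tdp i := test_pderiv i tp; have tddp i := test_pderiv i (tdp i).
rewrite cint_sum//; last by move=> i; exact: cL1_testr (tdp i) (Lg i).
rewrite -sumrN (cint_eq (g := fun x => \sum_i u x * (pderiv i (pderiv i psi) x)%:C)); last first.
  by move=> x _; rewrite /laplacian rmorph_sum mulr_sumr.
rewrite cint_sum//; last by move=> i; exact: cL1_testr (tddp i) Lu.
by apply: eq_bigr => i _; rewrite wu// opprK.
Qed.
End helmholtz.
Lemma L2loc_cmeas (R : realType) n (D : set 'rV[R]_n) f : measurable D -> L2loc D f -> cmeas D f.
Proof.
move=> mD Lf; have E : D = \bigcup_k (D `&` ball 0 k%:R).
  apply/seteqP; split=> x; last by case=> k _ [].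
  move=> Dx; exists (Num.truncn `|x|).+1 => //; split=> //.
  by rewrite ball0E/=; exact: truncnS_gt.
have mB k : measurable (D `&` ball 0 k%:R) by exact: measurable_setI_ball.
have c k := L2_cmeas (Lf k%:R).
by rewrite E; split; apply/measurable_fun_bigcup => // k; have [] := c k.
Qed.

(** * The scattering matrix *)

Section geometry.
Context {R : realType} {n : nat}.
Local Notation C := R[i].
Variables (Res Omega O : set 'rV[R]_n.+1) (omega : set 'rV[R]_n) (b : 'rV[R]_n.+1 -> R).
Hypotheses (hW : waveguide Res omega Omega) (hO : dissipative_part Res O) (hb : absorption Omega O b).
Local Notation D1 := (cyl omega (`]1, +oo[%classic : set (measurableTypeR R))).

Let oOm : open Omega := wg_open hW.
Let mOm : measurable Omega := open_measurable_row oOm.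

(** omega is the slice of Omega at z = 2, a height which only the half-cylinder reaches. *)
Lemma open_cross_section : open omega.
Proof.
pose s (y : 'rV[R]_n) : 'rV[R]_n.+1 := snoc (y, 2 : measurableTypeR R).
rewrite (_ : omega = s @^-1` Omega).
  apply: open_comp => // y _; apply: continuous_row => j x.
  case: (unliftP ord_max j) => [k|] ->.
    rewrite (_ : (fun x => _) = fun x : 'rV[R]_n => x 0 k); first exact: coord_continuous.
    by apply/funext => z; rewrite mxE liftK.
  rewrite (_ : (fun x => _) = cst (2 : R)); first exact: cst_continuous.
  by apply/funext => z; rewrite mxE unlift_none.
apply/seteqP; split=> y; rewrite /s (wg_decomp hW) /=.
  by move=> oy; right; split; rewrite ?ycoord_snoc ?zcoord_snoc.
case=> [/(wg_neg hW)|[]]; rewrite /= ?ycoord_snoc ?zcoord_snoc//=.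
by rewrite ltrn0.
Qed.

Lemma leb_cross_section : (leb n omega < +oo)%E.
Proof. by apply: leb_bounded_lt (wg_omega_bounded hW); apply: open_measurable_row; exact: open_cross_section. Qed.

Lemma sub_cyl1 : D1 `<=` Omega.
Proof.
move=> x [ox]; rewrite /= in_itv/= andbT => x1; rewrite (wg_decomp hW); right; split=> //=.
by rewrite ltW// (lt_trans ltr01).
Qed.

Lemma out_cyl1 x : Omega x -> ~ D1 x -> zcoord x <= 1.
Proof.
rewrite (wg_decomp hW) => -[/(wg_neg hW) /= x0 _|[ox x0] nD]; first by rewrite ltW// (lt_trans x0).
by rewrite leNgt; apply/negP => x1; apply: nD; split=> //=; rewrite in_itv/= andbT.
Qed.

Lemma truncated_bounded (L : R) : exists r : R, forall x, Omega x -> zcoord x <= L -> `|x| <= r.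
Proof.
have [M M0 hM] := bounded_set_le (wg_res_bounded hW).
have [N N0 hN] := bounded_set_le (wg_omega_bounded hW).
exists (M + N + `|L| + 1) => x; rewrite (wg_decomp hW) => -[Rx _|[oy z0] zL].
  by apply: le_trans (hM _ Rx) _; have := normr_ge0 L; lra.
have : ball (0 : 'rV[R]_n.+1) (M + N + `|L| + 1) x.
  have L0 := normr_ge0 L; have LL := ler_norm L.
  apply/ball_rowE; split; first by lra.
  move=> j; rewrite mxE sub0r normrN; case: (unliftP ord_max j) => [k|] ->.
    have := le_trans (coord_le_norm (ycoord x) k) (hN _ oy); rewrite mxE; lra.
  by rewrite -[x 0 _]/(zcoord x) ger0_norm//; lra.
by rewrite ball0E/= => /ltW.
Qed.

Lemma bsupp_zcut (chi : R -> R) L : cutoff chi -> bsupp Omega (zcut chi L).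
Proof.
move=> hc; have [r hr] := truncated_bounded (L + 1); exists r => x Ox rx.
rewrite /zcut (cutoff_one hc) ?subrr//; rewrite leNgt; apply/negP => h.
by move: rx; rewrite ltNge hr//; lra.
Qed.

Lemma bsupp_pderiv_zcut (chi : R -> R) L i : cutoff chi -> bsupp Omega (pderiv i (@zcut R chi n L)).
Proof.
move=> hc; have [r hr] := truncated_bounded (L + 1); exists r => x Ox rx.
rewrite (pderiv_zcut hc) dcut0 ?mulr0//; right; rewrite ltNge; apply/negP => h.
by move: rx; rewrite ltNge hr.
Qed.

Lemma clO_sub : closure O `<=` Omega.
Proof. by move=> x /(dp_sub hO) Rx; rewrite (wg_decomp hW); left. Qed.

Lemma O_sub : O `<=` Omega.
Proof. by move=> x Ox; apply: clO_sub; exact: subset_closure. Qed.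

Lemma clO_neg x : closure O x -> zcoord x < 0.
Proof. by move=> /(dp_sub hO)/(wg_neg hW). Qed.

Let mclO : measurable (closure O).
Proof. by apply: closed_measurable_row; exact: closed_closure. Qed.

Lemma measurable_b : measurable_fun Omega b.
Proof.
have [f sf fb] := abs_smooth hb.
have EE : Omega = closure O `|` (Omega `\` closure O).
  by apply/seteqP; split=> x /= => [Ex|[/clO_sub//|[]//]]; have [|] := pselect (closure O x); [left|right].
rewrite EE; apply/measurable_funU => //; first exact: measurableD.
split.
  have : measurable_fun (closure O) f by apply: continuous_measurable_row => //; exact: smooth_cont.
  by apply: eq_measurable_fun => x /set_mem cx; rewrite fb.
have : measurable_fun (Omega `\` closure O) (fun=> 0 : R) by exact: measurable_cst.
by apply: eq_measurable_fun => x /set_mem nx; rewrite (abs_out hb).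
Qed.

Lemma bounded_b : exists2 M, 0 <= M & forall x, Omega x -> `|b x| <= M.
Proof.
have [f sf fb] := abs_smooth hb.
have [r hr] := truncated_bounded 0.
have [M M0 hM] := continuous_bounded_ball (r + 1) (smooth_cont sf).
exists M; first exact: ltW.
move=> x Ox; have [cx|ncx] := pselect (closure O x).
  rewrite fb//; apply: hM; rewrite ball0E/=.
  by have := hr _ Ox (ltW (clO_neg cx)); lra.
by rewrite (abs_out hb)// normr0 ltW.
Qed.

Lemma null_boundary : {ae leb n.+1, forall x, ~ (closure O `\` O) x}.
Proof.
apply: (boundary_null (P := @smooth R n)) (dp_smooth hO) (dp_open hO) => f; exact: smooth_cont.
Qed.

(** The absorption is controlled by the closure of O, the matrix entries by O; the null boundary
    reconciles the two domains. *)
Lemma cint_closure f : cmeas (closure O) f -> cint (closure O) f = cint O f.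
Proof.
move=> mf; have mO : measurable O by apply: open_measurable_row; exact: dp_open hO.
transitivity (cint (closure O) (fun x => (\1_O x : R)%:C * f x)).
  apply: cint_ae => //.
    by apply: cmeasM => //; apply: cmeas_real; apply: measurable_funTS; exact: measurable_indic.
  apply: filterS null_boundary => x nb cx; rewrite indicE mem_set ?mul1r//.
  by apply: contrapT => nO; apply: nb.
rewrite (cint_support (@subset_closure _ O)); last first.
  by move=> x _ nO; rewrite indicE memNset// mul0r.
by apply: cint_eq => x Ox; rewrite indicE mem_set// mul1r.
Qed.

Definition coef (lambda eta : R) (x : 'rV[R]_n.+1) : C := lambda%:C * (1 +i* (eta * b x)).

Lemma cmeas_coef lambda eta : cmeas Omega (coef lambda eta).
Proof.
apply: cmeasM; first exact: cmeas_cst.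
split=> /=; first exact: measurable_cst.
by apply: measurable_funM => //; exact: measurable_b.
Qed.

Lemma bounded_coef lambda eta : exists M, forall x, Omega x -> sqmod (coef lambda eta x) <= M.
Proof.
have [M M0 hM] := bounded_b; exists (lambda ^+ 2 * (1 + (eta * M) ^+ 2)) => x Ox.
rewrite sqmodM sqmod_real; apply: ler_wpM2l; first exact: sqr_ge0.
rewrite /sqmod /= expr1n lerD2l !exprMn; apply: ler_wpM2l; first exact: sqr_ge0.
by rewrite -[b x ^+ 2]real_normK ?num_real// lerXn2r ?nnegrE// hM.
Qed.

(** [green] with the cut-off [zcut chi L]: its only derivative is axial and lives where
    [z >= L > 1], inside the half-cylinder, and [zcut] is 1 on the closure of O, which lies in z <
    0. *)
Lemma green_cyl (chi : R -> R) k1 k2 u (g : 'I_n.+1 -> 'rV[R]_n.+1 -> C) v (h : 'I_n.+1 -> 'rV[R]_n.+1 -> C)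
    (L M : R) : cutoff chi -> 1 < L ->
  weak_sol Omega k1 u g -> weak_sol Omega k2 v h ->
  cmeas Omega k1 -> (forall x, Omega x -> sqmod (k1 x) <= M) ->
  cmeas Omega k2 -> (forall x, Omega x -> sqmod (k2 x) <= M) ->
  (forall x, Omega x -> ~ closure O x -> k1 x = k2 x) ->
  cint D1 (fun x => (dcut chi L (zcoord x))%:C * (g ord_max x * v x - h ord_max x * u x)) =
  cint O (fun x => (k1 x - k2 x) * u x * v x).
Proof.
move=> hc L1' su sv mk1 hk1 mk2 hk2 k12.
have := green mOm su sv mk1 hk1 mk2 hk2 (smooth_zcut hc n L) (bsupp_zcut L hc) (fun i => bsupp_pderiv_zcut L i hc).
rewrite (cint_eq (g := fun x => (dcut chi L (zcoord x))%:C * (g ord_max x * v x - h ord_max x * u x))); last first.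
  move=> x _; rewrite (bigD1 ord_max)//= big1 ?addr0; first by rewrite (pderiv_zcut hc) eqxx mul1r.
  by move=> i im; rewrite (pderiv_zcut hc) eq_sym (negbTE im) !mul0r.
rewrite (cint_support sub_cyl1); last first.
  by move=> x Ox nD; rewrite dcut0// ?mul0r//; left; apply: le_lt_trans (out_cyl1 Ox nD) L1'.
move=> ->.
rewrite (cint_support clO_sub); last first.
  by move=> x Ox nO; rewrite k12// subrr !mul0r mulr0.
have zcut1 x : closure O x -> zcut chi L x = 1.
  move=> /clO_neg x0; rewrite /zcut (cutoff_zero hc) ?subr0//.
  by rewrite subr_le0 ltW// (lt_trans x0)// (lt_trans ltr01).
have [[Lu Lg wu] _] := su; have [[Lv Lh wv] _] := sv.
have S f : cmeas Omega f -> cmeas (closure O) f by apply: cmeasS => //; exact: clO_sub.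
rewrite (cint_eq (g := fun x => (k1 x - k2 x) * u x * v x)).
  apply: cint_closure; apply: cmeasM; last by apply: S; exact: L2loc_cmeas.
  by apply: cmeasM; apply: S; [apply: cmeasD => //; exact: cmeasN|exact: L2loc_cmeas].
by move=> x cx; rewrite zcut1// mul1r.
Qed.
End geometry.

(** * Flux identities and the absorption matrix *)

Section scattering.
Context {R : realType} {n : nat}.
Local Notation C := R[i].
Variables (Res Omega O : set 'rV[R]_n.+1) (omega : set 'rV[R]_n).
Hypotheses (hW : waveguide Res omega Omega) (hO : dissipative_part Res O).
Variables (b : 'rV[R]_n.+1 -> R) (lam : nat -> R) (phi : nat -> 'rV[R]_n -> R).
Hypotheses (hb : absorption Omega O b) (hspec : neumann_spectrum omega lam phi).
Variables (J : nat) (lambda beta : R) (chi : R -> R).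
Hypotheses (lamJ : forall m : 'I_J, lam m < lambda) (beta0 : 0 < beta) (hc : cutoff chi).
Local Notation D1 := (cyl omega (`]1, +oo[%classic : set (measurableTypeR R))).
Local Notation asym := (asym omega lam phi lambda beta).
Implicit Types (p q : 'I_J -> C) (u v k : 'rV[R]_n.+1 -> C).

Let oOm : open Omega := wg_open hW.
Let mOm : measurable Omega := open_measurable_row oOm.
Let oo : open omega := open_cross_section hW.
Let lo := leb_cross_section hW.
Let mD1 : measurable D1.
Proof. by apply: measurable_cyl; [exact: open_measurable_row|exact: measurable_itv]. Qed.

(** omega is bounded, so local square integrability up to the boundary is square integrability. *)
Lemma L2_eigenfunction m : L2 omega (fun y => (phi m y)%:C).
Proof.
have [g [Lphi _ _] _] := ns_eigen hspec m.
have [M _ h] := bounded_set_le (wg_omega_bounded hW).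
by have := Lphi (M + 1); rewrite setIidl// => y /h; rewrite ball0E/=; lra.
Qed.

Let Lp := L2_eigenfunction.
Let ortho := ns_orthonormal hspec.

Lemma solution_flux k1 k2 p q p' q' u v (g h : 'I_n.+1 -> 'rV[R]_n.+1 -> C) (M : R) :
  weak_sol Omega k1 u g -> weak_sol Omega k2 v h ->
  asym p q u (g ord_max) -> asym p' q' v (h ord_max) ->
  cmeas Omega k1 -> (forall x, Omega x -> sqmod (k1 x) <= M) ->
  cmeas Omega k2 -> (forall x, Omega x -> sqmod (k2 x) <= M) ->
  (forall x, Omega x -> ~ closure O x -> k1 x = k2 x) ->
  cint O (fun x => (k1 x - k2 x) * u x * v x) = - \sum_m 'i%C * (q m * p' m - p m * q' m).
Proof.
move=> su sv au av mk1 hk1 mk2 hk2 k12.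
have [[Lu Lg _] _] := su; have [[Lv Lh _] _] := sv.
have S f : L2loc Omega f -> cmeas D1 f.
  by move=> /(L2loc_cmeas mOm); apply: cmeasS => //; exact: sub_cyl1 hW.
apply: (asym_flux oo Lp ortho lamJ beta0 hc au av); try exact: S.
move=> L; apply: (green_cyl hW hO hc _ su sv mk1 hk1 mk2 hk2 k12).
by rewrite ltr_wpDl// ltr1n.
Qed.

Lemma solution_asym k p q u (g : 'I_n.+1 -> 'rV[R]_n.+1 -> C) ut : weak_sol Omega k u g -> W1 beta Omega ut ->
  (forall x, Omega x -> 1 < zcoord x -> u x = wave lam phi lambda p q x + ut x) ->
  asym p q u (g ord_max).
Proof.
move=> [H1u _] [[gt [Lut Lgt wt]] _] uE.
have sub := sub_cyl1 hW.
have wu : weak_partial ord_max D1 u (g ord_max) by apply: (weak_partialS mD1 mOm sub); exact: weak_grad_partial.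
apply: (asym_solution oo lo Lp hc wu (ut := ut) (gt := gt)).
  split; [exact: L2S Lut|by move=> i; exact: L2S (Lgt i)|].
  move=> i psi tp.
  have : weak_partial i D1 (weighted beta ut) (gt i).
    by apply: (weak_partialS mD1 mOm sub); split; [exact: L2_L2loc|exact: L2_L2loc|exact: wt].
  by case=> _ _; apply.
move=> x Dx; apply: uE; first exact: sub.
by case: Dx => _ /=; rewrite in_itv/= andbT.
Qed.

Variables (eta : R) (S : 'M[C]_J) (u : 'I_J -> 'rV[R]_n.+1 -> C).
Hypothesis hu : forall j, scattering_solution Omega lam phi lambda beta chi b eta S j (u j).
Local Notation ka := (coef b lambda eta).

(** Where z > 1 the cut-off is 1: the amplitudes of u_j are the j-th unit vector on w^- and the j-th
    row of S on w^+. *)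
Lemma scattering_data : exists g : 'I_J -> 'I_n.+1 -> 'rV[R]_n.+1 -> C, forall j,
  weak_sol Omega ka (u j) (g j) /\ asym (fun m => (m == j)%:R) (S j) (u j) (g j ord_max).
Proof.
suff /choice[g hg] : forall j, exists g : 'I_n.+1 -> 'rV[R]_n.+1 -> C,
  weak_sol Omega ka (u j) g /\ asym (fun m => (m == j)%:R) (S j) (u j) (g ord_max) by exists g.
move=> j; have [[g Hu su] [ut Wut uE]] := hu j.
have ws : weak_sol Omega ka (u j) g by split.
exists g; split=> //; apply: (solution_asym ws Wut) => x Ox x1.
rewrite uE// (cutoff_one hc (ltW x1)) !mul1r; congr (_ + _).
rewrite /wave big_split/=; congr (_ + _).
rewrite (bigD1 j)//= eqxx mul1r big1 ?addr0// => m mj.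
by rewrite (negbTE mj) mul0r.
Qed.

Lemma scattering_symmetric : S^T = S.
Proof.
have [g hg] := scattering_data; have [M hM] := bounded_coef hW hO hb lambda eta.
have mk := cmeas_coef hW hO hb lambda eta.
apply/matrixP => k j; rewrite mxE.
have [sj aj] := hg j; have [sk ak] := hg k.
have := solution_flux sj sk aj ak mk hM mk hM (fun _ _ _ => erefl).
rewrite (cint_eq (g := fun=> 0)); last by move=> x _; rewrite subrr !mul0r.
rewrite cint0; last by apply: open_measurable_row; exact: dp_open hO.
rewrite -mulr_sumr => /esym/eqP; rewrite oppr_eq0 mulf_eq0 => /orP[/eqP/(congr1 (@complex.Im R))/= /eqP|].
  by rewrite oner_eq0.
(* Against unit vectors the two sums collapse to [S j k] and [S k j]. *)
rewrite sumrB (bigD1 k)//= [X in _ - X](bigD1 j)//= !eqxx mulr1 mul1r.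
rewrite big1 ?addr0; last by move=> m mk'; rewrite (negbTE mk') mulr0.
rewrite big1 ?addr0; last by move=> m mj; rewrite (negbTE mj) mul0r.
by rewrite subr_eq0 => /eqP.
Qed.

Lemma cL1_absorption j l : cL1 O (fun x => (b x)%:C * u j x * (u l x)^*%C).
Proof.
have mO : measurable O by apply: open_measurable_row; exact: dp_open hO.
have [g hg] := scattering_data.
have [r hr] := truncated_bounded hW 0.
have OB : O `<=` Omega `&` ball 0 (r + 1).
  move=> x Ox; split; first exact: (O_sub hW hO).
  have := hr _ (O_sub hW hO Ox) (ltW (clO_neg hW hO (subset_closure Ox))); rewrite ball0E/=; lra.
have mB : measurable (Omega `&` ball 0 (r + 1)) by exact: measurable_setI_ball.
have Lu m : L2 O (u m) by have [[[Lu _ _] _] _] := hg m; exact: L2S (Lu (r + 1)).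
have [M M0 hM] := bounded_b hW hO hb.
apply: cL1_mul => //; last exact: L2_conj.
apply: (L2M mO _ (M := M ^+ 2)) => //.
  apply: cmeas_real; apply: measurable_funS (measurable_b hW hO hb) => //; exact: (O_sub hW hO).
move=> x Ox; rewrite sqmod_real -[b x ^+ 2]real_normK ?num_real// lerXn2r ?nnegrE// hM//.
exact: (O_sub hW hO).
Qed.

(** The conjugate of u_l solves the equation with the conjugate coefficient, and the difference of
    the two coefficients is [2 i lambda eta b]. Its amplitudes are exchanged and conjugated, so the
    flux is, up to the factor -i, an entry of [S *m S ^t*] minus one of the identity. *)
Lemma scattering_energy :
  S *m S ^t* + (2 * lambda * eta)%:C *: absorption_matrix O b u = 1%:M.
Proof.
have [g hg] := scattering_data; have [M hM] := bounded_coef hW hO hb lambda eta.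
have mk := cmeas_coef hW hO hb lambda eta.
have mO : measurable O by apply: open_measurable_row; exact: dp_open hO.
apply/matrixP => j l; have [sj aj] := hg j; have [sl al] := hg l.
have hM' x : Omega x -> sqmod ((ka x)^*%C) <= M by move=> /hM; rewrite /sqmod Re_conj Im_conj sqrrN.
have := solution_flux sj (weak_sol_conj sl) aj (asym_conj al) mk hM (cmeas_conj mk) hM' _.
have -> : (forall x, Omega x -> ~ closure O x -> ka x = (ka x)^*%C) = True.
  apply/propeqP; split=> // _ x Ox nO.
  rewrite /coef (abs_out hb)// mulr0 cconjM cconjR; congr (_ * _).
  by apply: complex_ext; rewrite ?Re_conj ?Im_conj /= ?oppr0.
move=> /(_ I).
pose B := cint O (fun x => (b x)%:C * u j x * (u l x)^*%C).
rewrite (cint_eq (g := fun x => ('i%C * (2 * lambda * eta)%:C) * ((b x)%:C * u j x * (u l x)^*%C))); last first.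
  move=> x _; have -> : ka x - (ka x)^*%C = 'i%C * (2 * lambda * eta)%:C * (b x)%:C.
    apply: complex_ext; rewrite /coef !(ReM, ImM, ReD, ImD, ReN, ImN, Re_conj, Im_conj) /=; ring.
  by rewrite !mulrA.
rewrite (cintZ _ mO (cL1_absorption j l)) -/B -mulr_sumr -mulrN -mulrA => /mulfI.
have -> : ('i%C : C) != 0 by apply/eqP => /(congr1 (@complex.Im R))/= /eqP; rewrite oner_eq0.
move=> /(_ isT) E.
rewrite !mxE [X in _ + _ * X = _](_ : _ = B)// E.
have -> : \sum_(m < J) S j m * (S ^t* ) m l = \sum_(m < J) S j m * (S l m)^*%C.
  by apply: eq_bigr => m _; rewrite !mxE.
rewrite sumrB subKr (bigD1 j)//= eqxx mul1r big1 ?addr0.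
  by rewrite conjc_nat.
by move=> m mj; rewrite (negbTE mj) mul0r.
Qed.

(* The sum vanishes on O, hence on Omega by unique continuation; its flux
   against w_m^+ is therefore zero, but it is also i c_m. *)
Lemma scattering_eq0 (c : 'I_J -> C) : 0 <= lambda -> 
  {ae leb n.+1, forall x, O x -> \sum_j c j * u j x = 0} -> forall m, c m = 0.
Proof.
move=> l0 U0; have [g hg] := scattering_data.
have mO : measurable O by apply: open_measurable_row; exact: dp_open hO.
pose U x := \sum_j c j * u j x; pose G i x := \sum_j c j * g j i x.
have LU : L2loc Omega U.
  move=> r; apply: L2_sum => [|j]; first by exact: measurable_setI_ball.
  apply: L2Z; first by exact: measurable_setI_ball.
  by have [[[Lu _ _] _] _] := hg j; exact: Lu.
have wU : weak_partial ord_max Omega U (G ord_max).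
  apply: (weak_partial_sum (index_enum 'I_J) mOm (F := fun j x => c j * u j x) (G := fun j x => c j * g j ord_max x)) => j.
  by apply: weak_partialZ => //; apply: weak_grad_partial; have [[h _] _] := hg j.
have HU psi : test_function Omega psi ->
    cint Omega (fun x => U x * (laplacian psi x)%:C) = - lambda%:C * cint Omega (fun x => U x * (psi x)%:C).
  move=> tp.
  have tl := test_laplacian tp.
  have mk := cmeas_coef hW hO hb lambda eta; have [M hM] := bounded_coef hW hO hb lambda eta.
  have Lu j : L2loc Omega (u j) by have [[[Lu _ _] _] _] := hg j.
  have Lku j : L2loc Omega (fun x => ka x * u j x).
    move=> r; have mB : measurable (Omega `&` ball 0 r) by exact: measurable_setI_ball.
    have sB : Omega `&` ball 0 r `<=` Omega by move=> x [].
    by apply: (L2M mB (cmeasS mOm sB mk) (M := M)); [move=> x [Ox _]; exact: hM|exact: Lu].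
  rewrite (cint_eq (g := fun x => \sum_j c j * (u j x * (laplacian psi x)%:C))); last first.
    by move=> x _; rewrite /U mulr_suml; apply: eq_bigr => j _; rewrite mulrA.
  rewrite cint_sum//; last by move=> j; apply: cL1Z => //; exact: cL1_testr tl (Lu j).
  transitivity (- cint Omega (fun x => \sum_j c j * (ka x * u j x * (psi x)%:C))).
    rewrite cint_sum//; last by move=> j; apply: cL1Z => //; exact: cL1_testr tp (Lku j).
    rewrite -sumrN; apply: eq_bigr => j _.
    rewrite cintZ//; last exact: cL1_testr tl (Lu j).
    rewrite cintZ//; last exact: cL1_testr tp (Lku j).
    by have [wj _] := hg j; rewrite (helmholtz_test mOm wj tp) mulrN.
  rewrite mulNr -cintZ//; last exact: cL1_testr tp LU.
  (* The coefficient acts on U as lambda almost everywhere: U vanishes almost everywhere on O, the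
     coefficient is lambda outside the closure, and the boundary between them is null. *)
  congr (- _); apply: cint_ae => //.
  - by apply: cmeas_sum => j; apply: cmeasM; [exact: cmeas_cst|exact: cL1_meas (cL1_testr mOm tp (Lku j))].
  - by apply: cmeasM; [exact: cmeas_cst|exact: cL1_meas (cL1_testr mOm tp LU)].
  apply: filterS2 U0 (null_boundary hO) => x hx nb Ox.
  have -> : \sum_j c j * (ka x * u j x * (psi x)%:C) = ka x * (U x * (psi x)%:C).
    rewrite /U mulr_suml mulr_sumr; apply: eq_bigr => j _.
    by move: (c j) (ka x) (u j x) ((psi x)%:C) => *; ring.
  have [cx|ncx] := pselect (closure O x).
    have Oxx : O x by apply: contrapT => nO; exact: nb.
    by rewrite /U hx// mul0r !mulr0.
  rewrite /coef (abs_out hb)// mulr0.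
  by rewrite -[1 +i* 0]/(1 : C) mulr1.
(* Unique continuation concerns real functions; f will be the real part and then the imaginary
   part. *)
have ae0 (f : C -> R) : f 0 = 0 ->
    (forall r, L1 (leb n.+1) (Omega `&` ball 0 r) (fun x => f (U x))) ->
    (forall psi, test_function Omega psi ->
     \int[leb n.+1]_(y in Omega) (f (U y) * laplacian psi y) =
     - lambda * \int[leb n.+1]_(y in Omega) (f (U y) * psi y)) ->
    {ae leb n.+1, forall x, Omega x -> f (U x) = 0}.
  move=> f0 Lf hf.
  apply: (unique_continuation hc oOm (wg_connected hW) Lf l0 hf (dp_open hO) (dp_nonempty hO) (O_sub hW hO)).
  by apply: filterS U0 => x hx Ox; rewrite /U hx.
have cU r : cL1 (Omega `&` ball 0 r) U.
  have mB : measurable (Omega `&` ball 0 r) by exact: measurable_setI_ball.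
  apply: (cL1_eq mB (f := fun x => U x * 1)); first by move=> x _; rewrite mulr1.
  by apply: cL1_mul => //; exact: (L2loc_cst 1 mOm r).
have Uae : {ae leb n.+1, forall x, Omega x -> U x = 0}.
  have hR : {ae leb n.+1, forall x, Omega x -> complex.Re (U x) = 0}.
    apply: ae0 => // [r|psi tp]; first exact: (cU r).1.
    have := congr1 (@complex.Re R) (HU _ tp); rewrite ReM /= oppr0 mul0r subr0.
    have E (f : 'rV[R]_n.+1 -> R) : \int[leb n.+1]_(x in Omega) complex.Re (U x * (f x)%:C) =
        \int[leb n.+1]_(x in Omega) (complex.Re (U x) * f x).
      by apply: Rint_eq => x _; rewrite ReM /= mulr0 subr0.
    by rewrite !E.
  have hI : {ae leb n.+1, forall x, Omega x -> complex.Im (U x) = 0}.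
    apply: ae0 => // [r|psi tp]; first exact: (cU r).2.
    have := congr1 (@complex.Im R) (HU _ tp); rewrite ImM /= oppr0 mul0r addr0.
    have E (f : 'rV[R]_n.+1 -> R) : \int[leb n.+1]_(x in Omega) complex.Im (U x * (f x)%:C) =
        \int[leb n.+1]_(x in Omega) (complex.Im (U x) * f x).
      by apply: Rint_eq => x _; rewrite ImM /= mulr0 add0r.
    by rewrite !E.
  apply: filterS2 hR hI => x hx hy Ox; apply: complex_ext; [exact: hx|exact: hy].
have sub := sub_cyl1 hW.
have Gae : {ae leb n.+1, forall x, Omega x -> G ord_max x = 0}.
  exact: (weak_partial_uniq hc oOm Uae wU (weak_partial0 ord_max mOm)).
have aU := asym_sum oo c (fun j => (hg j).2).
move=> m; pose e (l : 'I_J) : C := (l == m)%:R.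
(* [asym_flux] relies on expansions in the half-cylinder alone, so the bare mode w_m^+ can serve as
   second function. *)
have aW := asym_wave lam phi lambda beta oo (fun=> 0) e.
have S' f : L2loc Omega f -> cmeas D1 f.
  by move=> /(L2loc_cmeas mOm); apply: cmeasS => //; exact: sub.
have mw (P Q : 'I_J -> C) : cmeas D1 (wave lam phi lambda P Q).
  apply: (L2_weighted_cmeas (a := - beta)) => //.
  exact: (L2_wave lam lambda oo Lp P Q beta0).
have [_ LG _] := wU.
have := asym_flux oo Lp ortho lamJ beta0 hc aU aW (S' _ LU) (S' _ LG) (mw _ _) (mw _ _) (c := 0).
have -> : (forall L : nat, cint D1 (fun x => (dcut chi (L%:R + 2) (zcoord x))%:C *
    (G ord_max x * wave lam phi lambda (fun=> 0) e x -
     wave lam phi lambda (dzm lam lambda (fun=> 0)) (dzp lam lambda e) x * U x)) = 0) = True.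
  apply/propeqP; split=> // _ L; rewrite -[RHS](cint0 mD1); apply: cint_ae => //; last first.
    apply: filterS2 Uae Gae => x hx hgx Dx; rewrite hx ?hgx; [|exact: sub|exact: sub].
    by rewrite mul0r mulr0 subr0 mulr0.
  apply: cmeasM; last first.
    by apply: cmeasD; [|apply: cmeasN]; apply: cmeasM => //; exact: S'.
  apply: cmeasR => // x; apply: (@continuous_comp _ _ _ (@zcoord R n) (dcut chi (L%:R + 2))); first exact: continuous_zcoord.
  exact: continuous_dcut.
move=> /(_ I); rewrite -mulr_sumr => /esym/eqP; rewrite oppr_eq0 mulf_eq0 => /orP[/eqP/(congr1 (@complex.Im R))/= /eqP|].
  by rewrite oner_eq0.
(* The summand of the flux against w_m^+: only the amplitude of U on w_m^-, that is [c m],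
   survives. *)
pose F (l : 'I_J) : C := (\sum_k c k * S k l) * 0 - (\sum_k c k * (l == k)%:R) * e l.
rewrite -[\sum_l _]/(\sum_l F l) (_ : \sum_l F l = - c m); first by rewrite oppr_eq0 => /eqP.
have Fl l : F l = - (c l * (l == m)%:R).
  rewrite /F /e mulr0 sub0r; congr (- (_ * _)).
  rewrite (bigD1 l)//= eqxx mulr1 big1 ?addr0// => k kl.
  by rewrite eq_sym (negbTE kl) mulr0.
rewrite (bigD1 m)//= big1 ?addr0; first by rewrite Fl eqxx mulr1.
by move=> l lm; rewrite Fl (negbTE lm) mulr0 oppr0.
Qed.

Lemma absorption_hermitian : absorption_matrix O b u \is hermsymmx.
Proof.
apply/is_hermitianmxP; rewrite expr0 scale1r; apply/matrixP => j k; rewrite !mxE.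
rewrite Num_conjE -cint_conj; apply: cint_eq => x _.
by rewrite !cconjM cconjR Num_conjE conjcK -!mulrA [_ * u j x]mulrC.
Qed.

Lemma absorption_posdef : 0 <= lambda -> hermitian_posdef (absorption_matrix O b u).
Proof.
move=> l0; split; first exact: absorption_hermitian.
move=> c c0; have mO : measurable O by apply: open_measurable_row; exact: dp_open hO.
pose U x := \sum_j c 0 j * u j x.
have EU x : \sum_l \sum_j (c 0 j * (c 0 l)^*%C) * ((b x)%:C * u j x * (u l x)^*%C) = (b x * sqmod (U x))%:C.
  rewrite rmorphM/= (_ : (sqmod (U x))%:C = U x * (U x)^*%C); last first.
    by apply: complex_ext; rewrite !(ReM, ImM, Re_conj, Im_conj) /= /sqmod; ring.
  rewrite /U cconj_sum exchange_big mulr_suml mulr_sumr; apply: eq_bigr => j _.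
  rewrite mulr_sumr mulr_sumr; apply: eq_bigr => l _; rewrite cconjM.
  by move: (c 0 j) ((c 0 l)^*%C) ((b x)%:C) (u j x) ((u l x)^*%C) => *; ring.
have LL j l : cL1 O (fun x => (c 0 j * (c 0 l)^*%C) * ((b x)%:C * u j x * (u l x)^*%C)).
  by apply: cL1Z => //; exact: cL1_absorption.
have LE : cL1 O (fun x => (b x * sqmod (U x))%:C).
  by apply: (cL1_eq mO (fun x _ => EU x)); apply: cL1_sum => // l; apply: cL1_sum.
have -> : (c *m absorption_matrix O b u *m c ^t* ) 0 0 = cint O (fun x => (b x * sqmod (U x))%:C).
  rewrite mxE -(cint_eq (fun x _ => EU x)) cint_sum//; last by move=> l; exact: cL1_sum.
  apply: eq_bigr => l _; rewrite cint_sum// !mxE mulr_suml; apply: eq_bigr => j _.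
  rewrite !mxE cintZ//; last exact: cL1_absorption.
  by rewrite Num_conjE mulrAC.
have b0 x : O x -> 0 <= b x * sqmod (U x).
  by move=> Ox; rewrite mulr_ge0 ?sqmod_ge0// ltW// (abs_pos hb)//; exact: subset_closure.
(* The order of [R[i]] asks for equal imaginary parts, here both 0, and for a strict inequality
   between real parts. *)
rewrite ltcE /= Rint_0// eqxx/= lt_neqAle Rintegral_ge0// andbT eq_sym.
apply/eqP => I0; move/eqP: c0; apply; apply/rowP => m; rewrite mxE.
apply: (scattering_eq0 l0).
have Lf := LE.1.
have I0' : (\int[leb n.+1]_(x in O) (b x * sqmod (U x))%:E = 0)%E.
  by rewrite -(fineK (integrable_fin_num mO Lf)); congr EFin; exact: I0.
have : (\int[leb n.+1]_(x in O) `|(b x * sqmod (U x))%:E| = 0)%E.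
  rewrite -I0'; apply: eq_integral => x /set_mem Ox.
  by rewrite /= ger0_norm ?b0.
have mf : measurable_fun O (fun x => (b x * sqmod (U x))%:E).
  by apply/measurable_EFinP; exact: L1_measurable Lf.
move/(ae_eq_integral_abs _ mO mf); apply: filterS => x hx Ox.
have /eqP := hx Ox; rewrite eqe mulf_eq0 gt_eqF ?(abs_pos hb)//=; last exact: subset_closure.
rewrite paddr_eq0 ?sqr_ge0// !sqrf_eq0 => /andP[/eqP hR /eqP hI].
exact: complex_ext.
Qed.
End scattering.

(* The dimension is d = n + 1. *)
Theorem proposition3p3 (R : realType) (n : nat) (hd : (2 <= n.+1)%N)
    (Res Omega O : set 'rV[R]_n.+1) (omega : set 'rV[R]_n)
    (hOmega : waveguide Res omega Omega) (hO : dissipative_part Res O)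
    (b : 'rV[R]_n.+1 -> R) (hb : absorption Omega O b)
    (lam : nat -> R) (phi : nat -> 'rV[R]_n -> R)
    (hspec : neumann_spectrum omega lam phi)
    (J : nat) (hJ : (1 <= J)%N)
    (lambda : R) (hlambda : lam J.-1 < lambda < lam J)
    (beta : R) (hbeta : 0 < beta < Num.sqrt (lam J - lambda))
    (chi : R -> R) (hchi : cutoff chi)
    (T : nat) (vtr : 'I_T -> 'rV[R]_n.+1 -> R[i])
    (hvtr : trapped_basis Omega lambda beta vtr)
    (eta : R) (heta : 0 <= eta)
    (S : 'M[R[i]]_J) (u : 'I_J -> 'rV[R]_n.+1 -> R[i])
    (hu : forall j,
      scattering_solution Omega lam phi lambda beta chi b eta S j (u j))
    (hu0 : eta = 0 -> forall j t,
      cint O (fun x => (b x)%:C * u j x * (vtr t x)^*) = 0) :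
  [/\ S^T = S,
      S *m S ^t* + (2 * lambda * eta)%:C *: absorption_matrix O b u = 1%:M &
      hermitian_posdef (absorption_matrix O b u)].
Proof.
have [lam_lt _] := andP hlambda; have [beta0 _] := andP hbeta.
have lamJ (m : 'I_J) : lam m < lambda.
  by apply: le_lt_trans lam_lt; apply: (ns_mono hspec); rewrite -ltnS prednK.
have lambda0 : 0 <= lambda.
  by rewrite -(ns_0 hspec); apply: le_trans (ltW lam_lt); exact: (ns_mono hspec).
split.
- exact: (scattering_symmetric hOmega hO hb hspec lamJ beta0 hchi hu).
- exact: (scattering_energy hOmega hO hb hspec lamJ beta0 hchi hu).
- exact: (absorption_posdef hOmega hO hb hspec lamJ beta0 hchi hu lambda0).
Qed.
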